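(* Let $a$ be a classical amplitude. The corresponding pseudo-differential operator $A$ on $\mathcal{G}_{\tau,\mathcal{S}}(\mathbb{R}^n)$ is an extension of the classical operator $A$ with amplitude $a$ defined on $\mathcal{S}(\mathbb{R}^n)$, i.e. for every $f\in\mathcal{S}(\mathbb{R}^n)$ $$A(\imath(f))=\imath(Af)\qquad\text{in }\mathcal{G}_{\tau,\mathcal{S}}(\mathbb{R}^n).$$
   Context: Notation: $\langle x\rangle=(1+|x|^2)^{1/2}$, $\hat f(\xi)=\int e^{-ix\xi}f(x)\,dx$. $f(z)\prec g(z)$ on a set means $f\le c\,g$ there with a constant $c>0$ independent of $z$; $f\sim g$ means both $f\prec g$ and $g\prec f$. $\mathcal{E}[\mathbb{R}^n]$ is the algebra of all nets $(u_\epsilon)_{\epsilon\in(0,1]}$ with $u_\epsilon\in\mathcal{C}^\infty(\mathbb{R}^n)$. $\mathcal{E}_\tau(\mathbb{R}^n)$ is the set of $(u_\epsilon)_\epsilon\in\mathcal{E}[\mathbb{R}^n]$ such that for all $\alpha$ there is $N\in\mathbb{N}$ with $\sup_\epsilon\epsilon^N\|\langle x\rangle^{-N}\partial^\alpha u_\epsilon\|_{L^\infty}<\infty$; $\mathcal{N}_{\mathcal{S}}(\mathbb{R}^n)$ is the set of those such that for all $\alpha,\beta$, $q\in\mathbb{N}$, $\sup_\epsilon\epsilon^{-q}\|x^\alpha\partial^\beta u_\epsilon\|_{L^\infty}<\infty$; $\mathcal{G}_{\tau,\mathcal{S}}(\mathbb{R}^n)=\mathcal{E}_\tau(\mathbb{R}^n)/\mathcal{N}_{\mathcal{S}}(\mathbb{R}^n)$.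 Mollifier: $\varphi\in\mathcal{S}(\mathbb{R}^n)$ is fixed with $\int\varphi\,dx=1$ and $\int x^\alpha\varphi\,dx=0$ for all $\alpha\neq0$; $\varphi_\epsilon(x)=\epsilon^{-n}\varphi(x/\epsilon)$, so $\widehat{\varphi_\epsilon}(y)=\hat\varphi(\epsilon y)$. Embedding: $\imath(w)=(w\ast\varphi_\epsilon)_\epsilon+\mathcal{N}_{\mathcal{S}}(\mathbb{R}^n)$ for $w\in\mathcal{S}'(\mathbb{R}^n)$; for $f\in\mathcal{S}(\mathbb{R}^n)$, $\imath(f)$ is also the class of the constant net $(f)_\epsilon$. Weight function: a continuous real function $\Lambda$ on $\mathbb{R}^{2n}$ such that (i) there is $\mu>0$ with $\langle z\rangle^\mu\prec\Lambda(z)\prec\langle z\rangle$; (ii) $\Lambda(z)\sim\Lambda(\zeta)$ on $\{|\zeta-z|\le\mu\Lambda(z)\}$; (iii) for all $t\in\mathbb{R}^{2n}$, $\Lambda(t_1z_1,\dots,t_{2n}z_{2n})\prec\Lambda(z)$. Classical amplitude: a function $a\in\mathcal{C}^\infty(\mathbb{R}^{3n})$ for which there are a weight function $\Lambda$, $m\in\mathbb{R}$, $\rho\in(0,1]$ and $m'\in\mathbb{R}$ such that for all $\alpha,\beta,\gamma\in\mathbb{N}^n$ there is $c>0$ with $|\partial_\xi^\alpha\partial_x^\beta\partial_y^\gamma a(x,y,\xi)|\le c\,\Lambda(x,\xi)^m\langle x-y\rangle^{m'}\big(1+\Lambda(x,\xi)\langle x-y\rangle^{-m'}\big)^{-\rho|\alpha+\beta+\gamma|}$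 on $\mathbb{R}^{3n}$. Operators: on $\mathcal{G}_{\tau,\mathcal{S}}(\mathbb{R}^n)$, $A$ sends the class of $(u_\epsilon)_\epsilon$ to the class of $A_\epsilon u_\epsilon(x)=(2\pi)^{-n}\int e^{i(x-y)\xi}a(x,y,\xi)u_\epsilon(y)\widehat{\varphi_\epsilon}(y)\,dy\,d\xi$. The classical operator on $\mathcal{S}(\mathbb{R}^n)$ is $Af(x)=(2\pi)^{-n}\int e^{i(x-y)\xi}a(x,y,\xi)f(y)\,dy\,d\xi\in\mathcal{S}(\mathbb{R}^n)$. Integrals over $\mathbb{R}^{2n}$ are oscillatory: the limit as $h\to0^+$ after inserting a factor $\psi(hy,h\xi)$, $\psi\in\mathcal{S}(\mathbb{R}^{2n})$, $\psi(0)=1$. *)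

(* Defs.v *)
From HB Require Import structures.
From mathcomp Require Import all_boot all_order all_algebra.
From mathcomp Require Import complex.
From mathcomp Require Import all_classical all_reals all_analysis.

Set Implicit Arguments.
Unset Strict Implicit.
Unset Printing Implicit Defensive.

Import Order.TTheory GRing.Theory Num.Theory numFieldNormedType.Exports.

Local Open Scope classical_set_scope.
Local Open Scope ring_scope.
Local Open Scope complex_scope.

(* Lebesgue measure on R^n, on the Borel space [n.-tuple R], built by
   recursion as the image of lambda^1 \x lambda^n under (x, t) |-> x :: t. *)
Section lebesgue_tuple.
Variable R : realType.
Local Notation T := (measurableTypeR R).

Definition tcons (n : nat) (p : T * n.-tuple T) : n.+1.-tuple T :=
  [tuple of p.1 :: p.2].

Lemma measurable_tcons n : measurable_fun [set: T * n.-tuple T] (@tcons n).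
Proof. exact: (measurable_cons measurable_fst measurable_snd). Qed.

Section step.
Variables (n : nat) (m : {sigma_finite_measure set (n.-tuple T) -> \bar R}).

Definition leb_step : set (n.+1.-tuple T) -> \bar R :=
  pushforward (@lebesgue_measure R \x m)%E (@tcons n).

Let leb_step0 : leb_step set0 = 0%E.
Proof. by rewrite /leb_step /pushforward preimage_set0 measure0. Qed.

Let leb_step_ge0 A : (0 <= leb_step A)%E.
Proof. exact: (measure_ge0 (@lebesgue_measure R \x m)%E). Qed.

Let leb_step_sigma_additive : semi_sigma_additive leb_step.
Proof.
move=> F mF tF mUF; rewrite /leb_step /pushforward preimage_bigcup.
have mtcons (A : set (n.+1.-tuple T)) :
    measurable A -> measurable (@tcons n @^-1` A).
  by move=> mA; rewrite -[X in measurable X]setTI; exact: measurable_tcons.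
apply: measure_semi_sigma_additive.
- by move=> k; exact: mtcons.
- apply/trivIsetP => /= i j _ _ ij; rewrite -preimage_setI.
  by move/trivIsetP : tF => /(_ _ _ _ _ ij) ->//; rewrite preimage_set0.
- by rewrite -preimage_bigcup; exact: mtcons.
Qed.

HB.instance Definition _ := isMeasure.Build _ _ _ leb_step
  leb_step0 leb_step_ge0 leb_step_sigma_additive.

Let leb_step_sigma_finite : sigma_finite [set: n.+1.-tuple T] leb_step.
Proof.
have /sigma_finiteP[F [TF ndF Foo]] := sigma_finiteT (@lebesgue_measure R).
have /sigma_finiteP[G [TG ndG Goo]] := sigma_finiteT m.
pose g (t : n.+1.-tuple T) : T * n.-tuple T := (thead t, [tuple of behead t]).
have gK p : g (tcons p) = p by case: p => x t; congr pair; exact/val_inj.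
have mg : measurable_fun setT g.
  apply/measurable_fun_pairP; split.
    exact: (@measurable_tnth _ T n.+1 ord0).
  exact: measurable_behead.
exists (fun k => g @^-1` (F k `*` G k)).
  apply/esym/seteqP; split => // t _.
  have : setT (g t).1 by []. rewrite TF => -[i _ Fi].
  have : setT (g t).2 by []. rewrite TG => -[j _ Gj].
  exists (maxn i j) => //; split.
  - by move: Fi; exact/subsetPset/ndF/leq_maxl.
  - by move: Gj; exact/subsetPset/ndG/leq_maxr.
move=> k; have [mF Fk] := Foo k; have [mG Gk] := Goo k; split.
  by rewrite -[X in measurable X]setTI; apply: mg => //; exact: measurableX.
rewrite /leb_step /pushforward.
have -> : @tcons n @^-1` (g @^-1` (F k `*` G k)) = F k `*` G k.
  by rewrite -comp_preimage (_ : g \o @tcons n = id) //; exact/funext.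
by rewrite product_measure1E// lte_mul_pinfty// ge0_fin_numE.
Qed.

HB.instance Definition _ := Measure_isSigmaFinite.Build _ _ _ leb_step
  leb_step_sigma_finite.

End step.

Fixpoint lebesgue_tuple (n : nat) :
    {sigma_finite_measure set (n.-tuple T) -> \bar R} :=
  match n with
  | 0 => dirac ([tuple] : 0.-tuple T)
  | n'.+1 => leb_step (lebesgue_tuple n')
  end.

End lebesgue_tuple.

Section integrals.
Variables (R : realType) (n : nat).

Definition Cintegral d (T : measurableType d) (mu : {measure set T -> \bar R})
    (F : T -> R[i]) : R[i] :=
  (\int[mu]_t complex.Re (F t)) +i* (\int[mu]_t complex.Im (F t)).

Definition vec (t : n.-tuple R) : 'rV[R]_n := \row_i tnth t i.

Definition int_Rn (f : 'rV[R]_n -> R[i]) : R[i] :=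
  Cintegral (lebesgue_tuple R n) (fun t => f (vec t)).

Definition int_R2n (F : 'rV[R]_n -> 'rV[R]_n -> R[i]) : R[i] :=
  Cintegral (lebesgue_tuple R n \x lebesgue_tuple R n)%E
    (fun p => F (vec p.1) (vec p.2)).

End integrals.

Section calculus.
Variables (R : realType) (N : nat).
Implicit Types (f : 'rV[R]_N -> R[i]) (x y : 'rV[R]_N).

Definition dot x y : R := \sum_i x 0 i * y 0 i.

Definition enorm x : R := Num.sqrt (dot x x).

(* The Japanese bracket <x>. *)
Definition jb x : R := Num.sqrt (1 + enorm x ^+ 2).

Definition cmod (z : R[i]) : R := Normc.normc z.

Definition expi (t : R) : R[i] := cos t +i* sin t.

Definition pderiv (i : 'I_N) f : 'rV[R]_N -> R[i] := fun x =>
  'D_(delta_mx 0 i) (fun y => complex.Re (f y)) x +i*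
  'D_(delta_mx 0 i) (fun y => complex.Im (f y)) x.

(* C^infinity: all iterated partial derivatives exist and are continuous. *)
Definition smooth f : Prop := forall s : seq 'I_N,
  let g := foldr pderiv f s in
  [/\ continuous (fun x => complex.Re (g x)),
      continuous (fun x => complex.Im (g x)) &
      forall x (i : 'I_N),
        derivable (fun y => complex.Re (g y)) x (delta_mx 0 i) /\
        derivable (fun y => complex.Im (g y)) x (delta_mx 0 i)].

(* The multi-index derivative of order alpha in the group of variables
   numbered j 0, ..., j (k - 1). *)
Definition mderiv (k : nat) (j : 'I_k -> 'I_N) (alpha : {ffun 'I_k -> nat}) f :=
  foldr (fun i g => iter (alpha i) (pderiv (j i)) g) f (enum 'I_k).

Definition mpow x (alpha : {ffun 'I_N -> nat}) : R := \prod_i x 0 i ^+ alpha i.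

Definition schwartz f : Prop :=
  smooth f /\ forall alpha beta : {ffun 'I_N -> nat}, exists c : R,
    forall x, cmod ((mpow x alpha)%:C * mderiv id beta f x) <= c.

End calculus.

Definition mlen (k : nat) (alpha : {ffun 'I_k -> nat}) : nat := \sum_i alpha i.

Section generalized_functions.
Variables (R : realType) (n : nat).
Local Notation V := 'rV[R]_n.
Local Notation C := R[i].

(* Only the values at 0 < eps <= 1 of a net are meaningful. *)
Definition net := R -> V -> C.

Implicit Types u v w : net.

Definition smooth_net u : Prop :=
  forall eps : R, 0 < eps <= 1 -> smooth (u eps).

Definition E_tau u : Prop :=
  smooth_net u /\
  forall alpha : {ffun 'I_n -> nat}, exists (N : nat) (c : R),
    forall (eps : R) (x : V), 0 < eps <= 1 ->
      eps ^+ N * (jb x ^- N * cmod (mderiv id alpha (u eps) x)) <= c.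

Definition N_S u : Prop :=
  smooth_net u /\
  forall (alpha beta : {ffun 'I_n -> nat}) (q : nat), exists c : R,
    forall (eps : R) (x : V), 0 < eps <= 1 ->
      eps ^- q * cmod ((mpow x alpha)%:C * mderiv id beta (u eps) x) <= c.

(* The coset u + N_S. *)
Definition cls u : set net := [set v | N_S (fun eps x => v eps x - u eps x)].

(* The quotient E_tau / N_S, as a set of cosets. *)
Definition G_tau_S : set (set net) := [set cls u | u in E_tau].

Definition fourier (f : V -> C) : V -> C := fun xi =>
  int_Rn (fun x => expi (- dot x xi) * f x).

Definition mollifier (phi : V -> C) : Prop :=
  [/\ schwartz phi, int_Rn phi = 1 &
      forall alpha : {ffun 'I_n -> nat}, alpha != 0 ->
        int_Rn (fun x => (mpow x alpha)%:C * phi x) = 0].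

Definition moll (phi : V -> C) (eps : R) : V -> C := fun x =>
  (eps ^- n)%:C * phi (eps^-1 *: x).

(* The tempered distribution defined by a function. *)
Definition distr (f : V -> C) : (V -> C) -> C := fun g =>
  int_Rn (fun y => f y * g y).

(* w * phi_eps (x) = w (phi_eps (x - .)), for a tempered distribution w. *)
Definition embed (phi : V -> C) (w : (V -> C) -> C) : set net :=
  cls (fun eps x => w (fun y => moll phi eps (x - y))).

Definition is_oscint (F : V -> V -> C) (L : C) : Prop :=
  forall psi : 'rV[R]_(n + n) -> C, schwartz psi -> psi 0 = 1 ->
    let I h := int_R2n (fun y xi => F y xi * psi (row_mx (h *: y) (h *: xi))) in
    complex.Re (I h) @[h --> 0^'+] --> complex.Re L /\
    complex.Im (I h) @[h --> 0^'+] --> complex.Im L.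

(* The oscillatory integral of F, with the conventional value 0 if the limit
   does not exist or depends on psi. *)
Definition oscint (F : V -> V -> C) : C := xget 0 [set L | is_oscint F L].

Definition prec (T : Type) (D : set T) (f g : T -> R) : Prop :=
  exists2 c : R, 0 < c & forall z, D z -> f z <= c * g z.

Definition weight (Lam : 'rV[R]_(n + n) -> R) : Prop :=
  continuous Lam /\
  (exists mu : R,
    [/\ 0 < mu,
        prec setT (fun z => jb z `^ mu) Lam /\ prec setT Lam (@jb R (n + n)) &
        let D := [set p | enorm (p.2 - p.1) <= mu * Lam p.1] in
        prec D (fun p => Lam p.1) (fun p => Lam p.2) /\
        prec D (fun p => Lam p.2) (fun p => Lam p.1)]) /\
  (forall t : 'rV[R]_(n + n),
    prec setT (fun z : 'rV[R]_(n + n) => Lam (\row_i (t 0 i * z 0 i))) Lam).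

(* The three groups of variables (x, y, xi) of R^{3n}. *)
Definition var_x (i : 'I_n) : 'I_(n + n + n) := lshift n (lshift n i).
Definition var_y (i : 'I_n) : 'I_(n + n + n) := lshift n (rshift n i).
Definition var_xi (i : 'I_n) : 'I_(n + n + n) := rshift (n + n) i.
Definition pt3 (x y xi : V) : 'rV[R]_(n + n + n) := row_mx (row_mx x y) xi.

Definition classical_amplitude (a : 'rV[R]_(n + n + n) -> C) : Prop :=
  smooth a /\
  exists (Lam : 'rV[R]_(n + n) -> R) (m rho m' : R),
    [/\ weight Lam, 0 < rho <= 1 &
    forall alpha beta gamma : {ffun 'I_n -> nat}, exists2 c : R, 0 < c &
    forall x y xi : V,
      cmod (mderiv var_xi alpha (mderiv var_x beta (mderiv var_y gamma a))
              (pt3 x y xi)) <=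
      c * Lam (row_mx x xi) `^ m * jb (x - y) `^ m' *
        (1 + Lam (row_mx x xi) * jb (x - y) `^ (- m'))
          `^ (- (rho * (mlen (alpha + beta + gamma))%:R))].

Definition classical_op (a : 'rV[R]_(n + n + n) -> C) (f : V -> C) : V -> C :=
  fun x => (((2 * pi) ^- n : R)%:C) *
    oscint (fun y xi => expi (dot (x - y) xi) * a (pt3 x y xi) * f y).

Definition net_op (phi : V -> C) (a : 'rV[R]_(n + n + n) -> C) (u : net) : net :=
  fun eps x => (((2 * pi) ^- n : R)%:C) *
    oscint (fun y xi => expi (dot (x - y) xi) * a (pt3 x y xi) * u eps y *
                        fourier (moll phi eps) y).

(* The operator on classes: the union of the classes of the images of all
   representatives, so that [G_op phi a U] is a single class exactly when the
   image class does not depend on the representative. *)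
Definition G_op (phi : V -> C) (a : 'rV[R]_(n + n + n) -> C)
    (U : set net) : set net :=
  \bigcup_(u in U) cls (net_op phi a u).

End generalized_functions.

(* Main.v *)
(* All moments of phi of positive order vanish, so Taylor's formula gives that
   f * phi_eps - f is O(eps^q) in the Schwartz space for every q.  Hence every
   representative u of the embedding of f satisfies u - f in N_S, and, since
   phi^(eps y) - 1 = O(eps^q <y>^q) by the same Taylor expansion,
   u_eps(y) phi^(eps y) - f(y) is again negligible.  It remains to see that
   the classical operator maps Schwartz functions to Schwartz functions, with
   estimates linear in the input.  A classical amplitude has derivatives bounded
   by powers of <x><y><xi>; integrating by parts in y turns the oscillatory
   integral into an absolutely convergent one, whose x-derivatives and
   products with x_j are of the same form, because the phase satisfies
   (d/dx_j + d/dy_j) phase = 0 and x_j phase = (y_j - i d/dxi_j) phase. *)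
Require Import Defs.
From HB Require Import structures.
From mathcomp Require Import all_boot all_order all_algebra.
From mathcomp Require Import complex.
From mathcomp Require Import all_classical all_reals all_analysis.
From mathcomp Require Import measurable_realfun.
From mathcomp Require Import ring lra.

Set Implicit Arguments.
Unset Strict Implicit.
Unset Printing Implicit Defensive.

Import Order.TTheory GRing.Theory Num.Theory numFieldNormedType.Exports.

Local Open Scope classical_set_scope.
Local Open Scope ring_scope.
Local Open Scope complex_scope.

(** * Smooth complex-valued functions *)

(** Every bound ([bd0], [bdn], [rapid], [amp]) concerns a family over an arbitrary index type, with
    a constant independent of the index. Over [unit] it is an estimate for one function, over
    [unit_itv] one that is uniform in eps; thus the same mapping property serves the classical
    operator and negligible nets. The two uses of the moments are also one: after rescaling, f *
    phi_eps (x) and phi^(eps y) are both integrals of Psi(x, eps z) phi(z), to be compared with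
    Psi(x, 0). The obstacle is that [oscint] is a limit over all test functions. With psi(hy, h xi)
    inserted everything converges absolutely, but not uniformly in h; so the integration by parts is
    done for each h > 0, and only then does h tend to 0, under a majorant independent of h. For the
    limit to determine [oscint], some Schwartz psi with psi(0) = 1 must exist; it is built from
    [phi]. Since [G_op] is a union over all representatives, the images of all of them must be shown
    to lie in one coset. *)

Section complex_basics.
Variable R : realType.
Implicit Types z w : R[i].

Lemma cmod_ge0 z : 0 <= cmod z.
Proof. by case: z => a b; exact: sqrtr_ge0. Qed.

Lemma cmodM z w : cmod (z * w) = cmod z * cmod w.
Proof. exact: Normc.normcM. Qed.

Lemma cmodD z w : cmod (z + w) <= cmod z + cmod w.
Proof. exact: le_normcD. Qed.

Lemma cmodN z : cmod (- z) = cmod z.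
Proof. exact: normcN. Qed.

Lemma cmod0 : cmod (0 : R[i]) = 0.
Proof. exact: Normc.normc0. Qed.

Lemma cmod1 : cmod (1 : R[i]) = 1.
Proof. exact: Normc.normc1. Qed.

Lemma cmod_real (x : R) : cmod x%:C = `|x|.
Proof. by rewrite /cmod /= expr0n addr0 sqrtr_sqr. Qed.

Lemma cmod_Re z : `|complex.Re z| <= cmod z.
Proof.
case: z => a b /=; rewrite /cmod /= -sqrtr_sqr ler_sqrt ?addr_ge0 ?sqr_ge0//.
by rewrite lerDl sqr_ge0.
Qed.

Lemma cmod_Im z : `|complex.Im z| <= cmod z.
Proof.
case: z => a b /=; rewrite /cmod /= -sqrtr_sqr ler_sqrt ?addr_ge0 ?sqr_ge0//.
by rewrite lerDr sqr_ge0.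
Qed.

Lemma cmod_le z : cmod z <= `|complex.Re z| + `|complex.Im z|.
Proof.
case: z => a b /=; rewrite /cmod /= -[leRHS]ger0_norm ?addr_ge0//.
rewrite -sqrtr_sqr ler_sqrt ?sqr_ge0// sqrrD !real_normK ?num_real//.
by rewrite addrAC lerDl mulrn_wge0// mulr_ge0.
Qed.

Lemma cmod_expi (t : R) : cmod (expi t) = 1.
Proof. by rewrite /cmod /expi /= cos2Dsin2 sqrtr1. Qed.

Lemma cReM z w : complex.Re (z * w) =
  complex.Re z * complex.Re w - complex.Im z * complex.Im w.
Proof. by case: z w => [a b] [c d]. Qed.

Lemma cImM z w : complex.Im (z * w) =
  complex.Re z * complex.Im w + complex.Im z * complex.Re w.
Proof. by case: z w => [a b] [c d]. Qed.

Lemma cReD z w : complex.Re (z + w) = complex.Re z + complex.Re w.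
Proof. by case: z w => [a b] [c d]. Qed.

Lemma cImD z w : complex.Im (z + w) = complex.Im z + complex.Im w.
Proof. by case: z w => [a b] [c d]. Qed.

Lemma cReN z : complex.Re (- z) = - complex.Re z.
Proof. by case: z. Qed.

Lemma cImN z : complex.Im (- z) = - complex.Im z.
Proof. by case: z. Qed.

Lemma ceq z w : complex.Re z = complex.Re w ->
  complex.Im z = complex.Im w -> z = w.
Proof. by case: z w => [a b] [c d] /= -> ->. Qed.

End complex_basics.

Section cder.
Variable R : realType.
Variable N : nat.
Implicit Types (f g : 'rV[R]_N -> R[i]) (x v : 'rV[R]_N).

Definition cder f x v := derivable (fun y => complex.Re (f y)) x v /\
  derivable (fun y => complex.Im (f y)) x v.

Definition cD v f x : R[i] :=
  'D_v (fun y => complex.Re (f y)) x +i* 'D_v (fun y => complex.Im (f y)) x.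

Definition is_cder f x v (d : R[i]) :=
  is_derive x v (fun y => complex.Re (f y)) (complex.Re d) /\
  is_derive x v (fun y => complex.Im (f y)) (complex.Im d).

Lemma cderP f x v : cder f x v -> is_cder f x v (cD v f x).
Proof. by move=> [h1 h2]; split; split. Qed.

Lemma is_cder_cder f x v d : is_cder f x v d -> cder f x v.
Proof. by move=> [h1 h2]; split; apply: ex_derive. Qed.

Lemma is_cder_cD f x v d : is_cder f x v d -> cD v f x = d.
Proof. by move=> [h1 h2]; apply: ceq; rewrite /= derive_val. Qed.

Lemma is_cder_eq f x v d d' : is_cder f x v d -> d = d' -> is_cder f x v d'.
Proof. by move=> h <-. Qed.

Lemma is_cderD f g x v df dg : is_cder f x v df -> is_cder g x v dg ->
  is_cder (fun y => f y + g y) x v (df + dg).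
Proof.
move=> [f1 f2] [g1 g2]; split.
  rewrite (_ : (fun y => _) = (fun y => complex.Re (f y)) + (fun y => complex.Re (g y))).
    by rewrite cReD; apply: is_deriveD.
  by apply/funext => y; rewrite cReD.
rewrite (_ : (fun y => _) = (fun y => complex.Im (f y)) + (fun y => complex.Im (g y))).
  by rewrite cImD; apply: is_deriveD.
by apply/funext => y; rewrite cImD.
Qed.

Lemma is_cderM f g x v df dg : is_cder f x v df -> is_cder g x v dg ->
  is_cder (fun y => f y * g y) x v (df * g x + f x * dg).
Proof.
move=> [f1 f2] [g1 g2]; split.
  rewrite (_ : (fun y => _) = (fun y => complex.Re (f y)) * (fun y => complex.Re (g y))
    - (fun y => complex.Im (f y)) * (fun y => complex.Im (g y))).
    apply: is_derive_eq (is_deriveB (is_deriveM f1 g1) (is_deriveM f2 g2)) _.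
    rewrite cReD !cReM /GRing.scale/=; ring.
  by apply/funext => y; rewrite cReM.
rewrite (_ : (fun y => _) = (fun y => complex.Re (f y)) * (fun y => complex.Im (g y))
    + (fun y => complex.Im (f y)) * (fun y => complex.Re (g y))).
  apply: is_derive_eq (is_deriveD (is_deriveM f1 g2) (is_deriveM f2 g1)) _.
  rewrite cImD !cImM /GRing.scale/=; ring.
by apply/funext => y; rewrite cImM.
Qed.

Lemma is_cder_cst (c : R[i]) x v : is_cder (fun=> c) x v 0.
Proof. by split => /=; exact: is_derive_cst. Qed.

(** Turns directional derivatives into derivatives of one real variable, for which the chain rule
    and the mean value theorem are at hand. *)
Lemma derive_lineE (W : normedModType R) (f : 'rV[R]_N -> W) x v (t : R) d :
  is_derive t (1 : R) (fun s : R => f (x + s *: v)) d <->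
  is_derive (x + t *: v) v f d.
Proof.
have E : (fun h : R => h^-1 *: (((fun s : R => f (x + s *: v)) \o shift t) (h *: 1)
    - f (x + t *: v))) =
   (fun h : R => h^-1 *: ((f \o shift (x + t *: v)) (h *: v) - f (x + t *: v))).
  apply/funext => h /=; congr (_ *: (f _ - _)).
  by rewrite [h *: 1]mulr1 scalerDl addrCA.
split=> -[h1 h2]; split.
- by move: h1; rewrite /derivable E.
- by move: h2; rewrite /derive E.
- by move: h1; rewrite /derivable -E.
- by move: h2; rewrite /derive -E.
Qed.

Lemma derive_line0 (W : normedModType R) (f : 'rV[R]_N -> W) x v d :
  is_derive (0 : R) (1 : R) (fun s : R => f (x + s *: v)) d <->
  is_derive x v f d.
Proof. by rewrite derive_lineE scale0r addr0. Qed.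

Lemma is_derive_comp1 (g : R -> R) (q : 'rV[R]_N -> R) x v dq dg :
  is_derive x v q dq -> is_derive (q x) 1 g dg ->
  is_derive x v (g \o q) (dg * dq).
Proof.
move=> /derive_line0 h1 h2; apply/derive_line0.
apply: (@is_derive1_comp _ g (fun s : R => q (x + s *: v))) => //.
by rewrite scale0r addr0.
Qed.

Lemma is_cder_expi (q : 'rV[R]_N -> R) x v dq : is_derive x v q dq ->
  is_cder (fun y => expi (q y)) x v ('i * dq%:C * expi (q x)).
Proof.
move=> h; split => /=.
  apply: is_derive_eq; first exact: is_derive_comp1 h (is_derive_cos _).
  by rewrite /=; ring.
apply: is_derive_eq; first exact: is_derive_comp1 h (is_derive_sin _).
by rewrite /=; ring.
Qed.

Lemma is_cder_real (q : 'rV[R]_N -> R) x v dq :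
  is_derive x v q dq -> is_cder (fun y => (q y)%:C) x v dq%:C.
Proof. by move=> h; split => //=; exact: is_derive_cst. Qed.

Lemma pderivE i f : pderiv i f = cD (delta_mx 0 i) f.
Proof. by []. Qed.

Definition ccont f := continuous (fun x => complex.Re (f x)) /\
  continuous (fun x => complex.Im (f x)).

Definition c1 f := ccont f /\ forall x i, cder f x (delta_mx 0 i).

Lemma ccontD f g : ccont f -> ccont g -> ccont (fun x => f x + g x).
Proof.
move=> [f1 f2] [g1 g2]; split => x.
  under eq_fun do rewrite cReD; apply: continuousD; [exact: f1|exact: g1].
under eq_fun do rewrite cImD; apply: continuousD; [exact: f2|exact: g2].
Qed.

Lemma ccontM f g : ccont f -> ccont g -> ccont (fun x => f x * g x).
Proof.
move=> [f1 f2] [g1 g2]; split => x.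
  have E : (fun x => complex.Re (f x * g x)) =
      (fun x => complex.Re (f x)) * (fun x => complex.Re (g x))
      - (fun x => complex.Im (f x)) * (fun x => complex.Im (g x)).
    by apply/funext => y; rewrite cReM.
  by rewrite E; exact: (cvgB (cvgM (f1 x) (g1 x)) (cvgM (f2 x) (g2 x))).
have E : (fun x => complex.Im (f x * g x)) =
    (fun x => complex.Re (f x)) * (fun x => complex.Im (g x))
    + (fun x => complex.Im (f x)) * (fun x => complex.Re (g x)).
  by apply/funext => y; rewrite cImM.
by rewrite E; exact: (cvgD (cvgM (f1 x) (g2 x)) (cvgM (f2 x) (g1 x))).
Qed.

Lemma ccont_cst c : ccont (fun=> c).
Proof. by split; exact: cst_continuous. Qed.

Lemma ccont_real (q : 'rV[R]_N -> R) : continuous q -> ccont (fun x => (q x)%:C).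
Proof. by move=> h; split => //; exact: cst_continuous. Qed.

Lemma ccont_expi (q : 'rV[R]_N -> R) : continuous q -> ccont (fun x => expi (q x)).
Proof.
move=> h; split => x /=.
  by apply: (@continuous_comp _ _ _ q cos); [exact: h|exact: continuous_cos].
by apply: (@continuous_comp _ _ _ q sin); [exact: h|exact: continuous_sin].
Qed.

Lemma smooth_unfold f : smooth f <-> c1 f /\ forall i, smooth (pderiv i f).
Proof.
split=> [h|[[[h1 h2] h3] h4] s].
  split.
    by have [? ? ?] := h [::]; split.
  by move=> i s; have := h (rcons s i); rewrite -cats1 foldr_cat.
elim/last_ind: s => [|s i _] /=; first by split.
by have := h4 i s; rewrite -cats1 foldr_cat.
Qed.

(** Smooth functions form the largest class of C^1 functions stable under partial derivatives, so
    any such class [P] consists of smooth functions. *)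
Lemma smooth_coind (P : ('rV[R]_N -> R[i]) -> Prop) :
  (forall f, P f -> c1 f /\ forall i, P (pderiv i f)) ->
  forall f, P f -> smooth f.
Proof.
move=> H f Pf s.
suff : forall f, P f -> P (foldr (@pderiv R N) f s).
  by move=> /(_ f Pf) /H [[[h1 h2] h3] _]; split.
elim: s => //= i s IH g Pg; exact: (H _ (IH _ Pg)).2.
Qed.

Lemma smooth_pderiv i f : smooth f -> smooth (pderiv i f).
Proof. by move=> /smooth_unfold[_]. Qed.

Lemma smooth_foldr s f : smooth f -> smooth (foldr (@pderiv R N) f s).
Proof. move=> h; elim: s => [|i s IH]; [exact: h|exact: (smooth_pderiv i IH)]. Qed.

Lemma smooth_c1 f : smooth f -> c1 f.
Proof. by move=> /smooth_unfold[]. Qed.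

Lemma smooth_ccont f : smooth f -> ccont f.
Proof. by move=> /smooth_c1[]. Qed.

Lemma smooth_is_cder f x i : smooth f -> is_cder f x (delta_mx 0 i) (pderiv i f x).
Proof. by move=> /smooth_c1[_ h]; exact: cderP. Qed.

Lemma pderivD i f g : smooth f -> smooth g ->
  pderiv i (fun x => f x + g x) = fun x => pderiv i f x + pderiv i g x.
Proof.
move=> hf hg; apply/funext => x; rewrite pderivE; apply: is_cder_cD.
by apply: is_cderD; exact: smooth_is_cder.
Qed.

Lemma pderivM i f g : smooth f -> smooth g ->
  pderiv i (fun x => f x * g x) = fun x => pderiv i f x * g x + f x * pderiv i g x.
Proof.
move=> hf hg; apply/funext => x; rewrite pderivE; apply: is_cder_cD.
by apply: is_cderM; exact: smooth_is_cder.
Qed.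

Lemma pderiv_cst i c : pderiv i (fun _ : 'rV[R]_N => c) = fun=> 0.
Proof. by apply/funext => x; rewrite pderivE; apply: is_cder_cD; exact: is_cder_cst. Qed.

End cder.

(** * Directional derivatives and equality of mixed derivatives *)

Section directional.
Variables (R : realType) (N : nat).
Implicit Types (f : 'rV[R]_N -> R) (x v w : 'rV[R]_N).

(** Continuity of the derivative is required on the whole space and not only along lines of
    direction [v]; additivity in the direction rests on it. *)
Definition dirC1 f v := (forall x, derivable f x v) /\ continuous ('D_v f).

Lemma dir_is_derive f v x (t : R) : dirC1 f v ->
  is_derive t (1 : R) (fun s : R => f (x + s *: v)) ('D_v f (x + t *: v)).
Proof. by move=> [h _]; apply/derive_lineE; split. Qed.

Lemma line_continuous f v x : dirC1 f v -> continuous (fun s : R => f (x + s *: v)).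
Proof.
move=> h t; apply/differentiable_continuous/derivable1_diffP.
by have [] := dir_is_derive x t h.
Qed.

Lemma dir_MVT f v x (h : R) : dirC1 f v ->
  exists2 t : R, `|t| <= `|h| & f (x + h *: v) - f x = h * 'D_v f (x + t *: v).
Proof.
move=> H.
have [h0|h0|->] := ltgtP h 0; last first.
- by exists 0 => //; rewrite scale0r addr0 subrr mul0r.
- have [|c] := @MVT _ (fun s : R => f (x + s *: v)) _ _ _ h0
    (fun t _ => dir_is_derive x t H).
    by apply: continuous_subspaceT; exact: line_continuous.
  rewrite in_itv /= => /andP[c1 c2]; rewrite scale0r addr0 subr0 mulrC => E.
  by exists c => //; rewrite !ger0_norm ?ltW// (lt_trans c1).
- have [|c] := @MVT _ (fun s : R => f (x + s *: v)) _ _ _ h0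
    (fun t _ => dir_is_derive x t H).
    by apply: continuous_subspaceT; exact: line_continuous.
  rewrite in_itv /= => /andP[c1 c2]; rewrite scale0r addr0 sub0r mulrN => E.
  exists c; first by rewrite !ler0_norm ?lerN2 ?ltW// (lt_trans c2).
  by apply: oppr_inj; rewrite opprB E mulrC.
Qed.

(** The increment along [h *: (v + w)] is split at the corner [x + h *: v]. On the second leg the
    mean value theorem gives ['D_w f] at a point tending to [x], and continuity of ['D_w f] gives
    the limit. *)
Lemma dirC1_add f v w : dirC1 f v -> dirC1 f w ->
  dirC1 f (v + w) /\ 'D_(v + w) f = fun x => 'D_v f x + 'D_w f x.
Proof.
move=> Hv Hw.
have K x : is_derive x (v + w) f ('D_v f x + 'D_w f x).
  have C : h^-1 *: ((f \o shift x) (h *: (v + w)) - f x) @[h --> 0^'] -->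
      'D_v f x + 'D_w f x.
    have cw : 'D_w f (y + x) @[y --> (0 : 'rV[R]_N)] --> 'D_w f x.
      have c0 : y + x @[y --> (0 : 'rV[R]_N)] --> x.
        have := @cvgD _ _ _ (nbhs (0 : 'rV[R]_N)) _ id (cst x) 0 x cvg_id (cvg_cst _).
        by rewrite add0r => H; exact: H.
      exact: cvg_comp c0 ((proj2 Hw) x).
    have := proj1 Hv x => /derivableP[] /= dv _.
    have E : (fun h : R => h^-1 *: ((f \o shift x) (h *: (v + w)) - f x)) =
       (fun h => h^-1 *: ((f \o shift x) (h *: v) - f x) +
                 h^-1 *: (f (h *: v + x + h *: w) - f (h *: v + x))).
      apply/funext => h /=; rewrite -scalerDr; congr (_ *: _).
      by rewrite scalerDr addrAC [RHS]addrC addrA subrK.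
    rewrite E; apply: cvgD; first exact: dv.
    apply/cvgrPdist_le => e e0.
    move/cvgrPdist_le : cw => /(_ e e0) /nbhs_ballP[d /= d0 dP].
    have Nz : 0 < `|v| + `|w| + 1 by rewrite ltr_wpDl// addr_ge0.
    near=> h.
    have h0 : h != 0 by near: h; exact: nbhs_dnbhs_neq.
    have [t th ->] := dir_MVT (h *: v + x) h Hw.
    rewrite /GRing.scale/= mulKf//.
    have -> : h *: v + x + t *: w = (h *: v + t *: w) + x by rewrite addrAC.
    apply: dP; rewrite -ball_normE /= sub0r normrN.
    apply: (@le_lt_trans _ _ (`|h| * (`|v| + `|w| + 1))).
      rewrite (le_trans (ler_normD _ _))// !normrZ -addrA mulrDr lerD2l.
      by rewrite mulrDr mulr1 ler_wpDr// ler_wpM2r.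
    rewrite -ltr_pdivlMr//; near: h; apply: dnbhs0_lt; exact: divr_gt0.
  split; first by apply/cvg_ex; exists ('D_v f x + 'D_w f x).
  by apply: cvg_lim.
have E : 'D_(v + w) f = fun x => 'D_v f x + 'D_w f x.
  by apply/funext => x; rewrite (derive_val (is_derive := K x)).
split; last exact: E.
split; first by move=> x; have [] := K x.
by rewrite E => x; exact: (cvgD (proj2 Hv x) (proj2 Hw x)).
Unshelve. all: end_near. Qed.

Lemma dirC1_scale f v (c : R) : dirC1 f v ->
  dirC1 f (c *: v) /\ 'D_(c *: v) f = fun x => c * 'D_v f x.
Proof.
move=> Hv.
have K x : is_derive x (c *: v) f (c * 'D_v f x).
  apply/derive_line0.
  rewrite (_ : (fun s : R => _) = (fun s : R => f (x + s *: v)) \o ( *%R c)).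
    have h1 := dir_is_derive x (c * 0) Hv.
    have h2 : is_derive (0 : R) (1 : R) ( *%R c) c.
      have := @is_deriveZ _ _ _ (@id R) c 0 1 1 (is_derive_id _ _).
      by rewrite [c *: 1]mulr1.
    have := is_derive1_comp h1 h2.
    by rewrite mulr0 scale0r addr0 mulrC.
  by apply/funext => s /=; rewrite scalerA mulrC.
have E : 'D_(c *: v) f = fun x => c * 'D_v f x.
  by apply/funext => x; rewrite (derive_val (is_derive := K x)).
split; last exact: E.
split; first by move=> x; have [] := K x.
by rewrite E => x; exact: (cvgM (cvg_cst _) (proj2 Hv x)).
Qed.

Lemma dirC1_0 f : dirC1 f 0 /\ 'D_0 f = fun=> 0.
Proof.
have E : 'D_0 f = fun=> 0 by apply/funext => x; rewrite derive0.
split; last exact: E.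
split; first by move=> x; exact: derivable0.
by rewrite E; exact: cst_continuous.
Qed.

Lemma dirC1_basis f v : (forall i, dirC1 f (delta_mx 0 i)) ->
  dirC1 f v /\ 'D_v f = fun x => \sum_i v 0 i * 'D_(delta_mx 0 i) f x.
Proof.
move=> H.
suff K (r : seq 'I_N) : dirC1 f (\sum_(i <- r) v 0 i *: delta_mx 0 i) /\
  'D_(\sum_(i <- r) v 0 i *: delta_mx 0 i) f =
   fun x => \sum_(i <- r) v 0 i * 'D_(delta_mx 0 i) f x.
  by have := K (index_enum _); rewrite -row_sum_delta.
elim: r => [|i r [IH1 IH2]].
  rewrite big_nil; have [h1 ->] := dirC1_0 f; split; first exact: h1.
  by apply/funext => x; rewrite big_nil.
rewrite big_cons; have [h1 h2] := dirC1_scale (v 0 i) (H i).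
have [h3 ->] := dirC1_add h1 IH1; split; first exact: h3.
by apply/funext => x; rewrite big_cons (congr1 (@^~ x) h2) (congr1 (@^~ x) IH2).
Qed.

(** The common values are taken at points of boxes that shrink to [x] with [h], so continuity at [x]
    alone identifies [F x] with [G x]. *)
Lemma box_limit (F G : 'rV[R]_N -> R) x v w :
  {for x, continuous F} -> {for x, continuous G} ->
  (forall h : R, h != 0 -> exists s1 t1 s2 t2 : R,
    [/\ `|s1| <= `|h|, `|t1| <= `|h|, `|s2| <= `|h|, `|t2| <= `|h| &
     F (x + s1 *: v + t1 *: w) = G (x + s2 *: w + t2 *: v)]) -> F x = G x.
Proof.
move=> Fx Gx H.
apply/eqP; rewrite -subr_eq0 -normr_le0; apply/ler_addgt0Pr => e e0.
rewrite add0r.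
have near_cont (g : 'rV[R]_N -> R) u1 u2 (d : R) : 0 < d -> {for x, continuous g} ->
   \forall h \near (0 : R)^', forall s t : R, `|s| <= `|h| -> `|t| <= `|h| ->
    `|g x - g (x + s *: u1 + t *: u2)| <= d.
  move=> d0 /cvgrPdist_le /(_ d d0) /nbhs_ballP[r /= r0 rP].
  have Nz : 0 < `|u1| + `|u2| + 1 :> R by rewrite ltr_wpDl// addr_ge0.
  near=> h => s t sh th; apply: rP.
  rewrite -ball_normE /= -addrA opprD addNKr normrN.
  apply: (@le_lt_trans _ _ (`|h| * (`|u1| + `|u2| + 1))).
    rewrite (le_trans (ler_normD _ _))// !normrZ -addrA mulrDr lerD// ?ler_wpM2r//.
    by rewrite mulrDr mulr1 ler_wpDr// ler_wpM2r.
  by rewrite -ltr_pdivlMr//; near: h; apply: dnbhs0_lt; exact: divr_gt0.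
have e2 : 0 < e / 2 by exact: divr_gt0.
have A := near_cont _ v w _ e2 (Fx).
have B := near_cont _ w v _ e2 (Gx).
have N0 : \forall h \near (0 : R)^', h != 0 by exact: nbhs_dnbhs_neq.
have /filter_ex[h [h0 HA HB]] : \forall h \near (0 : R)^', [/\ h != 0,
    (forall s t : R, `|s| <= `|h| -> `|t| <= `|h| ->
     `|F x - F (x + s *: v + t *: w)| <= e / 2) &
    (forall s t : R, `|s| <= `|h| -> `|t| <= `|h| ->
     `|G x - G (x + s *: w + t *: v)| <= e / 2)].
  by apply: filterS3 N0 A B => h; split.
have [s1 [t1 [s2 [t2 [s1h t1h s2h t2h EE]]]]] := H h h0.
have hA : `|F x - F (x + s1 *: v + t1 *: w)| <= e / 2.
  exact: HA.
have hB : `|G x - G (x + s2 *: w + t2 *: v)| <= e / 2.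
  exact: HB.
rewrite [leRHS]splitr (le_trans _ (lerD hA hB))//.
rewrite EE [X in _ <= _ + X]distrC (le_trans _ (ler_normD _ _))//.
by rewrite addrA subrK.
Unshelve. all: end_near. Qed.

(** The second difference of [f] on the parallelogram with sides [h *: v], [h *: w] is symmetric in
    the two directions. Two applications of the mean value theorem express it as [h ^+ 2] times
    either mixed derivative at a nearby point. *)
Lemma clairaut f v w : dirC1 f v -> dirC1 f w ->
  dirC1 ('D_v f) w -> dirC1 ('D_w f) v -> 'D_w ('D_v f) = 'D_v ('D_w f).
Proof.
move=> fv fw fvw fwv; apply/funext => x.
have second u1 u2 (h : R) : dirC1 f u1 -> dirC1 f u2 -> dirC1 ('D_u1 f) u2 -> h != 0 ->
  exists s t : R, [/\ `|s| <= `|h|, `|t| <= `|h| &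
    f (x + h *: u1 + h *: u2) - f (x + h *: u1) - (f (x + h *: u2) - f x)
    = h ^+ 2 * 'D_u2 ('D_u1 f) (x + s *: u1 + t *: u2)].
  move=> d1 d2 d12 h0.
  pose g := fun y => f (y + h *: u2) - f y.
  have gE y : is_derive y u1 g ('D_u1 f (y + h *: u2) - 'D_u1 f y).
    apply: is_deriveB; last by apply/derivableP; exact: (proj1 d1).
    apply/derive_line0.
    rewrite (_ : (fun s : R => _) = (fun s : R => f (y + h *: u2 + s *: u1))).
      by rewrite -{2}[y + _]addr0 -(scale0r u1); exact: dir_is_derive.
    by apply/funext => s; rewrite addrAC.
  have gE' : 'D_u1 g = fun y => 'D_u1 f (y + h *: u2) - 'D_u1 f y.
    by apply/funext => y; rewrite (derive_val (is_derive := gE y)).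
  have Hg : dirC1 g u1.
    split; first by move=> y; have [] := gE y.
    have c0 (y : 'rV[R]_N) : (z + h *: u2) @[z --> y] --> y + h *: u2.
      by have H := @cvgD _ _ _ (nbhs y) _ id (cst (h *: u2)) _ _ cvg_id (cvg_cst _); exact: H.
    rewrite gE' => y; exact: (cvgB (cvg_comp _ _ (c0 y) (proj2 d1 _)) (proj2 d1 y)).
  have [s sh E1] := dir_MVT x h Hg.
  have [t th E2] := dir_MVT (x + s *: u1) h d12.
  exists s, t; split => //.
  move: E1; rewrite /g (congr1 (@^~ (x + s *: u1)) gE') => ->; rewrite E2 expr2 mulrA.
  done.
apply: (@box_limit ('D_w ('D_v f)) ('D_v ('D_w f)) x v w);
  [exact: (proj2 fvw)|exact: (proj2 fwv)|move=> h h0].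
have [s1 [t1 [s1h t1h E1]]] := second v w h fv fw fvw h0.
have [s2 [t2 [s2h t2h E2]]] := second w v h fw fv fwv h0.
exists s1, t1, s2, t2; split; [exact: s1h|exact: t1h|exact: s2h|exact: t2h|].
have h2 : h ^+ 2 != 0 by rewrite expf_neq0.
apply: (mulfI h2); rewrite -[LHS]E1 -[RHS]E2.
have perm (k1 k2 k3 k4 : R) : k1 - k2 - (k3 - k4) = k1 - k3 - (k2 - k4) by ring.
by rewrite perm [x + h *: w + _]addrAC.
Qed.

End directional.

(** * Stability of smoothness under algebraic operations *)

Section smooth_algebra.
Variable R : realType.

Lemma rV_cvg (T : Type) (F : set_system T) {FF : Filter F} M (g : T -> 'rV[R]_M) (l : 'rV[R]_M) :
  (forall j, g x 0 j @[x --> F] --> l 0 j) -> g @ F --> l.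
Proof.
move=> H; apply/cvg_ballP => e e0.
have : \forall x \near F, forall j, ball (l 0 j) e (g x 0 j).
  by apply: filter_forall => j; move/cvg_ballP : (H j); exact.
by apply: filterS => x Hx; split => // i j; rewrite ord1; exact: Hx.
Qed.

Lemma cvg_bigsum (T : Type) (F : set_system T) {FF : Filter F} (I : Type) (r : seq I)
    (g : I -> T -> R) (l : I -> R) : (forall i, g i @ F --> l i) ->
  (fun x => \sum_(i <- r) g i x) @ F --> \sum_(i <- r) l i.
Proof.
move=> H; elim: r => [|i r IH].
  by rewrite big_nil; under eq_fun do rewrite big_nil; exact: cvg_cst.
by rewrite big_cons; under eq_fun do rewrite big_cons; exact: (cvgD (H i) IH).
Qed.

Lemma affine_continuous N M (L : 'M[R]_(N, M)) (b : 'rV[R]_M) :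
  continuous (fun x : 'rV[R]_N => x *m L + b).
Proof.
move=> x; apply: (@rV_cvg _ (nbhs x) (nbhs_filter x)) => j.
rewrite (_ : (fun y : 'rV[R]_N => _) =
  (fun y : 'rV[R]_N => \sum_i y 0 i * L i j + b 0 j)); last first.
  by apply/funext => y; rewrite !mxE.
have H i : (fun y : 'rV[R]_N => y 0 i * L i j) @ x --> x 0 i * L i j.
  exact: (cvgM (@coord_continuous R 1 N 0 i x) (cvg_cst _)).
have K := @cvg_bigsum _ _ (nbhs_filter x) _ (index_enum _) _ _ H.
rewrite !mxE; apply: cvgD; [exact: K|exact: cvg_cst].
Qed.

Section fixN.
Variable N : nat.
Implicit Types (f g : 'rV[R]_N -> R[i]) (x v : 'rV[R]_N).

Lemma smooth_dirC1 f i : smooth f ->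
  dirC1 (fun y => complex.Re (f y)) (delta_mx 0 i) /\
  dirC1 (fun y => complex.Im (f y)) (delta_mx 0 i).
Proof.
move=> /smooth_unfold [[_ h1] /(_ i) /smooth_ccont [h2 h3]]; split.
  by split; [move=> x; exact: (h1 x i).1|exact: h2].
by split; [move=> x; exact: (h1 x i).2|exact: h3].
Qed.

Lemma smooth_dir f x v : smooth f ->
  is_cder f x v (\sum_i (v 0 i)%:C * pderiv i f x).
Proof.
move=> sf.
have [h1 h2] := dirC1_basis v (fun i => (smooth_dirC1 i sf).1).
have [h3 h4] := dirC1_basis v (fun i => (smooth_dirC1 i sf).2).
have RS (F : 'I_N -> R[i]) : complex.Re (\sum_i F i) = \sum_i complex.Re (F i).
  by elim/big_rec2 : _ => // i y1 y2 _; rewrite cReD => ->.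
have IS (F : 'I_N -> R[i]) : complex.Im (\sum_i F i) = \sum_i complex.Im (F i).
  by elim/big_rec2 : _ => // i y1 y2 _; rewrite cImD => ->.
split.
  split; first exact: h1.1.
  rewrite (congr1 (@^~ x) h2) RS; apply: eq_bigr => i _.
  by rewrite cReM /= mul0r subr0.
split; first exact: h3.1.
rewrite (congr1 (@^~ x) h4) IS; apply: eq_bigr => i _.
by rewrite cImM /= mul0r addr0.
Qed.

Lemma pderiv_comm i j f : smooth f -> pderiv i (pderiv j f) = pderiv j (pderiv i f).
Proof.
move=> sf; have [a1 a2] := smooth_dirC1 i sf; have [b1 b2] := smooth_dirC1 j sf.
have [c1 c2] := smooth_dirC1 j (smooth_pderiv i sf).
have [d1 d2] := smooth_dirC1 i (smooth_pderiv j sf).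
have E1 := clairaut a1 b1 c1 d1; have E2 := clairaut a2 b2 c2 d2.
apply/funext => x; apply: ceq.
  by rewrite -[LHS]/('D_(delta_mx 0 i) ('D_(delta_mx 0 j) (fun y => complex.Re (f y))) x)
   -(congr1 (@^~ x) E1).
by rewrite -[LHS]/('D_(delta_mx 0 i) ('D_(delta_mx 0 j) (fun y => complex.Im (f y))) x)
   -(congr1 (@^~ x) E2).
Qed.

Opaque pderiv smooth.

(** Used to compare derivatives along an arbitrary sequence of variables with multi-index
    derivatives, which are taken in a fixed order. *)
Lemma foldr_pderiv_perm s t f : smooth f -> perm_eq s t ->
  foldr (@pderiv R N) f s = foldr (@pderiv R N) f t.
Proof.
move=> sf; elim: s t => [|i s IH] t; first by rewrite perm_sym => /perm_nilP ->.
move=> pst; have it : i \in t by rewrite -(perm_mem pst) mem_head.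
rewrite /= (IH (rem i t)); last first.
  by rewrite -(perm_cons i) (perm_trans pst)// perm_to_rem.
move: it {IH pst}; elim: t => //= j t IH; rewrite inE eq_sym.
case: eqP => [-> _|_ /= it]; first reflexivity.
by rewrite -(IH it) pderiv_comm; [reflexivity|exact: smooth_foldr].
Qed.

End fixN.

(* Closed under partial derivatives, whence smoothness by coinduction. *)
Inductive alg (N : nat) : ('rV[R]_N -> R[i]) -> Prop :=
| alg_comp M (f : 'rV[R]_M -> R[i]) (L : 'M[R]_(N, M)) b :
    smooth f -> alg (fun x => f (x *m L + b))
| alg_cst c : alg (fun=> c)
| alg_coord i : alg (fun x => (x 0 i)%:C)
| algD f g : alg f -> alg g -> alg (fun x => f x + g x)
| algM f g : alg f -> alg g -> alg (fun x => f x * g x)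
| alg_expi q : alg (fun x => (q x)%:C) -> alg (fun x => expi (q x)).

Lemma is_cder_affine N M (f : 'rV[R]_M -> R[i]) (L : 'M[R]_(N, M)) b x v :
  smooth f -> is_cder (fun x => f (x *m L + b)) x v
    (\sum_j ((v *m L) 0 j)%:C * pderiv j f (x *m L + b)).
Proof.
move=> sf; have [h1 h2] := smooth_dir (x *m L + b) (v *m L) sf.
have E (s : R) : (x + s *: v) *m L + b = x *m L + b + s *: (v *m L).
  by rewrite mulmxDl -scalemxAl addrAC.
split; apply/derive_line0.
  rewrite (_ : (fun s : R => _) =
    (fun s : R => complex.Re (f (x *m L + b + s *: (v *m L))))).
    by move/derive_line0 : h1.
  by apply/funext => s; rewrite E.
rewrite (_ : (fun s : R => _) =
  (fun s : R => complex.Im (f (x *m L + b + s *: (v *m L))))).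
  by move/derive_line0 : h2.
by apply/funext => s; rewrite E.
Qed.

Lemma pderiv_affine N M (f : 'rV[R]_M -> R[i]) (L : 'M[R]_(N, M)) b i : smooth f ->
  pderiv i (fun x => f (x *m L + b)) =
  fun x => \sum_j (L i j)%:C * pderiv j f (x *m L + b).
Proof.
move=> sf; apply/funext => x; rewrite pderivE.
rewrite (is_cder_cD (is_cder_affine _ _ _ _ sf)); apply: eq_bigr => j _.
by rewrite -rowE mxE.
Qed.

Lemma is_cder_coord N (i : 'I_N) x v :
  is_cder (fun y : 'rV[R]_N => (y 0 i)%:C) x v (v 0 i)%:C.
Proof.
apply: is_cder_real; apply/derive_line0.
rewrite (_ : (fun s : R => _) = (fun s : R => x 0 i + s * v 0 i)); last first.
  by apply/funext => s; rewrite !mxE.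
apply: is_derive_eq.
by rewrite ?add0r /GRing.scale/= ?mulr1 ?mulr0 ?add0r ?addr0 mul1r.
Qed.

Lemma alg_sum N (I : Type) (r : seq I) (F : I -> 'rV[R]_N -> R[i]) :
  (forall i, alg (F i)) -> alg (fun x => \sum_(i <- r) F i x).
Proof.
move=> H; elim: r => [|i r IH].
  by under eq_fun do rewrite big_nil; exact: alg_cst.
by under eq_fun do rewrite big_cons; exact: algD.
Qed.

Lemma alg_c1 N (f : 'rV[R]_N -> R[i]) : alg f -> c1 f /\ forall i, alg (pderiv i f).
Proof.
elim=> {f} [M f L b sf|c|j|f g _ [[f1 f2] f3] _ [[g1 g2] g3]
   |f g af [[f1 f2] f3] ag [[g1 g2] g3]|q aq [[f1 f2] f3]].
- split; last first.
    move=> i; rewrite pderiv_affine//; apply: alg_sum => j.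
    by apply: algM; [exact: alg_cst|apply: alg_comp; exact: smooth_pderiv].
  split; last by move=> x i; exact: is_cder_cder (is_cder_affine _ _ _ _ sf).
  have [h1 h2] := smooth_ccont sf.
  split => x; first exact: (cvg_comp _ _ (@affine_continuous N M L b x) (h1 _)).
  exact: (cvg_comp _ _ (@affine_continuous N M L b x) (h2 _)).
- split; last by move=> i; rewrite pderiv_cst; exact: alg_cst.
  split; first exact: ccont_cst.
  by move=> x i; exact: is_cder_cder (is_cder_cst _ _ _).
- split; last first.
    move=> i; rewrite (_ : pderiv i _ = fun=> ((delta_mx 0 i : 'rV[R]_N) 0 j)%:C).
      exact: alg_cst.
    by apply/funext => x; rewrite pderivE (is_cder_cD (is_cder_coord _ _ _)).
  split; last by move=> x i; exact: is_cder_cder (is_cder_coord _ _ _).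
  by apply: ccont_real => x; exact: coord_continuous.
- split; last first.
    move=> i; rewrite (_ : pderiv i _ = fun x => pderiv i f x + pderiv i g x).
      by apply: algD.
    apply/funext => x; rewrite pderivE; apply: is_cder_cD.
    by apply: is_cderD; exact: cderP.
  split; first exact: ccontD.
  by move=> x i; exact: is_cder_cder (is_cderD (cderP (f2 x i)) (cderP (g2 x i))).
- split; last first.
    move=> i; rewrite (_ : pderiv i _ = fun x => pderiv i f x * g x + f x * pderiv i g x).
      by apply: algD; exact: algM.
    apply/funext => x; rewrite pderivE; apply: is_cder_cD.
    by apply: is_cderM; exact: cderP.
  split; first exact: ccontM.
  by move=> x i; exact: is_cder_cder (is_cderM (cderP (f2 x i)) (cderP (g2 x i))).
- have H x i : is_cder (fun y => expi (q y)) x (delta_mx 0 i)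
      ('i * pderiv i (fun x => (q x)%:C) x * expi (q x)).
    have [/derivableP h _] := f2 x i.
    apply: is_cder_eq; first exact: is_cder_expi h.
    congr (_ * _ * _); rewrite pderivE.
    by rewrite (is_cder_cD (is_cder_real h)).
  split; last first.
    move=> i; rewrite (_ : pderiv i _ = fun x =>
       'i * pderiv i (fun x => (q x)%:C) x * expi (q x)).
      apply: algM; last exact: alg_expi.
      by apply: algM; [exact: alg_cst|exact: f3].
    by apply/funext => x; rewrite pderivE (is_cder_cD (H x i)).
  split; last by move=> x i; exact: is_cder_cder (H x i).
  by apply: ccont_expi; exact: f1.1.
Qed.

Lemma alg_smooth N (f : 'rV[R]_N -> R[i]) : alg f -> smooth f.
Proof. by move=> af; apply: (@smooth_coind _ _ (@alg N)) => //; exact: alg_c1. Qed.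

Lemma smooth_alg N (f : 'rV[R]_N -> R[i]) : smooth f -> alg f.
Proof.
move=> sf; rewrite (_ : f = fun x => f (x *m 1%:M + 0)); first exact: alg_comp.
by apply/funext => x; rewrite mulmx1 addr0.
Qed.

Lemma smoothD N (f g : 'rV[R]_N -> R[i]) : smooth f -> smooth g ->
  smooth (fun x => f x + g x).
Proof. by move=> /smooth_alg a /smooth_alg b; exact: alg_smooth (algD a b). Qed.

Lemma smoothM N (f g : 'rV[R]_N -> R[i]) : smooth f -> smooth g ->
  smooth (fun x => f x * g x).
Proof. by move=> /smooth_alg a /smooth_alg b; exact: alg_smooth (algM a b). Qed.

Lemma smooth_cst N (c : R[i]) : smooth (fun _ : 'rV[R]_N => c).
Proof. exact: alg_smooth (alg_cst _ _). Qed.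

Lemma smooth_coord N (i : 'I_N) : smooth (fun x : 'rV[R]_N => (x 0 i)%:C).
Proof. exact: alg_smooth (alg_coord i). Qed.

Lemma smooth_affine N M (f : 'rV[R]_M -> R[i]) (L : 'M[R]_(N, M)) b :
  smooth f -> smooth (fun x => f (x *m L + b)).
Proof. by move=> sf; exact: alg_smooth (alg_comp _ _ sf). Qed.

Lemma smooth_sum N (I : Type) (r : seq I) (F : I -> 'rV[R]_N -> R[i]) :
  (forall i, smooth (F i)) -> smooth (fun x => \sum_(i <- r) F i x).
Proof. by move=> H; apply: alg_smooth; apply: alg_sum => i; exact: smooth_alg. Qed.

Lemma smooth_expi N (q : 'rV[R]_N -> R) : smooth (fun x => (q x)%:C) ->
  smooth (fun x => expi (q x)).
Proof. by move=> /smooth_alg h; exact: alg_smooth (alg_expi h). Qed.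

Lemma pderivZ N (i : 'I_N) (c : R[i]) (f : 'rV[R]_N -> R[i]) : smooth f ->
  pderiv i (fun x => c * f x) = fun x => c * pderiv i f x.
Proof.
move=> sf; rewrite pderivM; [|exact: smooth_cst|exact: sf].
by rewrite pderiv_cst; apply/funext => x; rewrite mul0r add0r.
Qed.

Lemma smoothZ N (c : R[i]) (f : 'rV[R]_N -> R[i]) : smooth f ->
  smooth (fun x => c * f x).
Proof. by move=> sf; apply: smoothM; [exact: smooth_cst|exact: sf]. Qed.

Lemma foldr_pderivD N s (f g : 'rV[R]_N -> R[i]) : smooth f -> smooth g ->
  foldr (@pderiv R N) (fun x => f x + g x) s =
  fun x => foldr (@pderiv R N) f s x + foldr (@pderiv R N) g s x.
Proof.
move=> sf sg; elim: s => // i s IH; rewrite [LHS]/= IH pderivD; first by [].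
  exact: smooth_foldr.
exact: smooth_foldr.
Qed.

Lemma foldr_pderivZ N s c (f : 'rV[R]_N -> R[i]) : smooth f ->
  foldr (@pderiv R N) (fun x => c * f x) s =
  fun x => c * foldr (@pderiv R N) f s x.
Proof.
move=> sf; elim: s => // i s IH; rewrite [LHS]/= IH pderivZ; first by [].
exact: smooth_foldr.
Qed.

End smooth_algebra.

(** * Weights and uniform bounds on derivatives *)

Section polynomial_weight.
Variable R : realType.

(* Comparable to powers of <x>, but multiplicative in the coordinates, so that
   its integrability reduces to dimension one. *)
Definition pw N (x : 'rV[R]_N) : R := \prod_i (1 + x 0 i ^+ 2).

Lemma pw_ge1 N (x : 'rV[R]_N) : 1 <= pw x.
Proof.
rewrite /pw; elim/big_ind : _ => // [a b a1 b1|i _]; last by rewrite lerDl sqr_ge0.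
by rewrite mulr_ege1.
Qed.

Lemma pw_gt0 N (x : 'rV[R]_N) : 0 < pw x.
Proof. exact: lt_le_trans (pw_ge1 x). Qed.

Lemma pwX_ge1 N (x : 'rV[R]_N) k : 1 <= pw x ^+ k.
Proof. exact/exprn_ege1/pw_ge1. Qed.

Lemma pwX_gt0 N (x : 'rV[R]_N) k : 0 < pw x ^+ k.
Proof. exact/exprn_gt0/pw_gt0. Qed.

Lemma pwX_ge0 N (x : 'rV[R]_N) k : 0 <= pw x ^+ k.
Proof. exact/ltW/pwX_gt0. Qed.

Lemma pwXV_gt0 N (x : 'rV[R]_N) k : 0 < pw x ^- k.
Proof. by rewrite invr_gt0 pwX_gt0. Qed.

Lemma pwXV_ge0 N (x : 'rV[R]_N) k : 0 <= pw x ^- k.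
Proof. exact/ltW/pwXV_gt0. Qed.

Lemma pwX_mono N (x : 'rV[R]_N) k l : (k <= l)%N -> pw x ^+ k <= pw x ^+ l.
Proof. by move=> kl; exact: ler_weXn2l (pw_ge1 x) _ _ kl. Qed.

Lemma pwXV_mono N (x : 'rV[R]_N) k l : (k <= l)%N -> pw x ^- l <= pw x ^- k.
Proof. by move=> kl; rewrite lef_pV2 ?posrE ?pwX_gt0// pwX_mono. Qed.

Lemma prod_le N (F G : 'I_N -> R) : (forall i, 0 <= F i <= G i) ->
  \prod_i F i <= \prod_i G i.
Proof. by move=> H; apply: ler_prod => i _; exact: H. Qed.

Lemma sq1_ge0 (a : R) : 0 <= 1 + a ^+ 2.
Proof. by rewrite addr_ge0// sqr_ge0. Qed.

Lemma pw_add N (x y : 'rV[R]_N) : pw (x + y) <= 2 ^+ N * (pw x * pw y).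
Proof.
rewrite /pw -big_split /= -[X in 2 ^+ X]card_ord -prodr_const -big_split /=.
apply: prod_le => i; rewrite sq1_ge0 !mxE /=.
set a := x 0 i; set b := y 0 i.
have : 0 <= (a - b) ^+ 2 by exact: sqr_ge0.
have : 0 <= (a * b) ^+ 2 by exact: sqr_ge0.
by rewrite exprMn; nra.
Qed.

Lemma pwN N (x : 'rV[R]_N) : pw (- x) = pw x.
Proof. by apply: eq_bigr => i _; rewrite !mxE sqrrN. Qed.

Lemma pw_sub N (x y : 'rV[R]_N) : pw (x - y) <= 2 ^+ N * (pw x * pw y).
Proof. by rewrite -[pw y]pwN; exact: pw_add. Qed.

(* Peetre's inequality. *)
Lemma pw_subV N (x y : 'rV[R]_N) k :
  pw (x - y) ^- k <= 2 ^+ (N * k) * (pw y ^+ k * pw x ^- k).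
Proof.
have H : pw x ^+ k <= 2 ^+ (N * k) * (pw y ^+ k * pw (x - y) ^+ k).
  rewrite exprM -!exprMn.
  apply: lerXn2r; rewrite ?nnegrE ?mulr_ge0 ?exprn_ge0 ?(ltW (pw_gt0 _))//.
  by rewrite -{1}[x](subrK y) [X in _ * X]mulrC pw_add.
rewrite -(ler_pM2r (pwX_gt0 (x - y) k)) mulVf ?gt_eqF ?pwX_gt0//.
rewrite -(ler_pM2r (pwX_gt0 x k)) mul1r (le_trans H)// le_eqVlt; apply/orP; left.
by apply/eqP; field; rewrite gt_eqF ?pwX_gt0.
Qed.

Lemma pw_scale N (x : 'rV[R]_N) (t : R) : `|t| <= 1 -> pw (t *: x) <= pw x.
Proof.
move=> t1; apply: prod_le => i; rewrite sq1_ge0 mxE lerD2l exprMn.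
by rewrite ler_piMl ?sqr_ge0// -real_normK ?num_real// expr_le1.
Qed.

Lemma pw_row_mx N M (x : 'rV[R]_N) (y : 'rV[R]_M) : pw (row_mx x y) = pw x * pw y.
Proof.
rewrite /pw big_split_ord /=; congr (_ * _); apply: eq_bigr => i _.
  by rewrite row_mxEl.
by rewrite row_mxEr.
Qed.

Lemma sq1_le_pw N (x : 'rV[R]_N) i : 1 + x 0 i ^+ 2 <= pw x.
Proof.
rewrite /pw (bigD1 i)//= ler_peMr ?sq1_ge0//.
elim/big_ind : _ => // [a b a1 b1|j _]; last by rewrite lerDl sqr_ge0.
by rewrite mulr_ege1.
Qed.

Lemma coord_le_pw N (x : 'rV[R]_N) i : `|x 0 i| <= pw x.
Proof.
apply: le_trans (sq1_le_pw x i); rewrite -real_normK ?num_real//.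
by have := sqr_ge0 (`|x 0 i| - 1); have := normr_ge0 (x 0 i); nra.
Qed.

Lemma jb_ge1 N (x : 'rV[R]_N) : 1 <= jb x.
Proof. by rewrite /jb -{1}sqrtr1 ler_sqrt ?sq1_ge0// lerDl sqr_ge0. Qed.

Lemma jb_le_pw N (x : 'rV[R]_N) : jb x <= pw x.
Proof.
rewrite /jb -[leRHS]ger0_norm ?(ltW (pw_gt0 _))// -sqrtr_sqr ler_sqrt ?sqr_ge0//.
have d0 : 0 <= dot x x by rewrite sumr_ge0// => i _; rewrite -expr2 sqr_ge0.
apply: (@le_trans _ _ (pw x)); last by rewrite expr2 ler_peMl ?pw_ge1 ?(ltW (pw_gt0 _)).
rewrite sqr_sqrtr// /pw.
have -> : dot x x = \sum_i x 0 i ^+ 2 by apply: eq_bigr => i _; rewrite expr2.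
(* Nonnegativity of the partial sums is carried along because the induction step discards a product
   of two of the terms. *)
suff : 1 + \sum_i x 0 i ^+ 2 <= \prod_i (1 + x 0 i ^+ 2) /\
   0 <= \sum_i x 0 i ^+ 2 by case.
elim/big_rec2 : _ => [|i a b _ [IH b0]]; first by rewrite addr0.
have s0 := sqr_ge0 (x 0 i); split; last by rewrite addr_ge0.
apply: (@le_trans _ _ ((1 + x 0 i ^+ 2) * (1 + a))); first by nra.
by rewrite ler_wpM2l ?sq1_ge0.
Qed.

End polynomial_weight.

(** * Bounds and convergence of derivatives in families of functions *)

Section families.
Variable R : realType.

Section fix_family.
Variables (I : Type) (N : nat).
Implicit Types (F G : I -> 'rV[R]_N -> R[i]) (W V : I -> 'rV[R]_N -> R).

(* The constant is uniform in the index [i : I], which will be eps. *)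
Definition bd0 F W := exists2 C : R, 0 <= C & forall i x, cmod (F i x) <= C * W i x.

(** One weight controls all derivatives up to order [L]. The recursion differentiates the family
    first, so sums, products and compositions are handled by one differentiation per step instead of
    by multi-index Leibniz formulas. *)
Fixpoint bdn (L : nat) F W : Prop := bd0 F W /\
  if L is L'.+1 then forall j, bdn L' (fun i => pderiv j (F i)) W else True.

Definition sfam F := forall i, smooth (F i).

Lemma bdn0 L F W : bdn L F W -> bd0 F W.
Proof. by case: L => [|L] []. Qed.

Lemma bdnW L F W : bdn L.+1 F W -> bdn L F W.
Proof.
elim: L F => [|L IH] F [H1 H2]; split => //.
by move=> j; exact: IH (H2 j).
Qed.

Lemma bdn_foldr L F W s : (size s <= L)%N -> bdn L F W ->
  bd0 (fun i => foldr (@pderiv R N) (F i) s) W.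
Proof.
elim/last_ind: s L F => [|s j IH] L F sL H; first exact: bdn0 H.
move: sL H; rewrite size_rcons; case: L => // L sL [_ /(_ j) /IH] /(_ sL).
by under [X in _ -> bd0 X _]eq_fun do rewrite -cats1 foldr_cat.
Qed.

Lemma foldr_bdn L F W :
  (forall s, (size s <= L)%N -> bd0 (fun i => foldr (@pderiv R N) (F i) s) W) ->
  bdn L F W.
Proof.
elim: L F => [|L IH] F H; split => //; first exact: (H [::]).
  exact: (H [::]).
move=> j; apply: IH => s sL; have := H (rcons s j); rewrite size_rcons => /(_ sL).
by under [X in bd0 X _ -> _]eq_fun do rewrite -cats1 foldr_cat.
Qed.

Lemma bdn_weight L F W V (c : R) : 0 <= c -> (forall i x, W i x <= c * V i x) ->
  bdn L F W -> bdn L F V.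
Proof.
move=> c0 WV.
have H0 G : bd0 G W -> bd0 G V.
  move=> [C C0 H]; exists (C * c); first exact: mulr_ge0.
  by move=> i x; rewrite (le_trans (H i x))// -mulrA ler_wpM2l.
elim: L F => [|L IH] F [H1 H2]; split; [exact: H0|by []|exact: H0|].
by move=> j; exact: IH (H2 j).
Qed.

Lemma bd0D F G W : bd0 F W -> bd0 G W -> bd0 (fun i x => F i x + G i x) W.
Proof.
move=> [C C0 H] [D D0 K]; exists (C + D); first exact: addr_ge0.
by move=> i x; rewrite (le_trans (cmodD _ _))// mulrDl lerD.
Qed.

Lemma bd0M F G W V : bd0 F W -> bd0 G V ->
  bd0 (fun i x => F i x * G i x) (fun i x => W i x * V i x).
Proof.
move=> [C C0 H] [D D0 K]; exists (C * D); first exact: mulr_ge0.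
by move=> i x; rewrite cmodM mulrACA ler_pM ?cmod_ge0.
Qed.

Lemma bdnD L F G W : sfam F -> sfam G -> bdn L F W -> bdn L G W ->
  bdn L (fun i x => F i x + G i x) W.
Proof.
elim: L F G => [|L IH] F G sF sG [F1 F2] [G1 G2]; split; [exact: bd0D|by []|exact: bd0D|].
move=> j; have := IH _ _ (fun i => smooth_pderiv j (sF i))
  (fun i => smooth_pderiv j (sG i)) (F2 j) (G2 j).
by congr bdn; apply/funext => i; rewrite pderivD; [|exact: sF|exact: sG].
Qed.

Lemma bdnM L F G W V : sfam F -> sfam G -> bdn L F W -> bdn L G V ->
  bdn L (fun i x => F i x * G i x) (fun i x => W i x * V i x).
Proof.
elim: L F G => [|L IH] F G sF sG HF HG.
  by case: HF HG => [F1 _] [G1 _]; split; [exact: bd0M|].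
have [[F1 F2] [G1 G2]] := (HF, HG); split; first exact: bd0M.
move=> j.
have sF' i := smooth_pderiv j (sF i); have sG' i := smooth_pderiv j (sG i).
have H1 := IH _ _ sF' sG (F2 j) (bdnW HG).
have H2 := IH _ _ sF sG' (bdnW HF) (G2 j).
have := bdnD (fun i => smoothM (sF' i) (sG i)) (fun i => smoothM (sF i) (sG' i)) H1 H2.
by congr bdn; apply/funext => i; rewrite pderivM; [|exact: sF|exact: sG].
Qed.

Lemma bdn_cst L (c : I -> R[i]) W (C : R) : 0 <= C ->
  (forall i x, cmod (c i) <= C * W i x) -> (forall i x, 0 <= W i x) ->
  bdn L (fun i _ => c i) W.
Proof.
elim: L c C => [|L IH] c C C0 H W0; split; [by exists C|by []|by exists C|].
move=> j; have := IH (fun=> 0) 0 (lexx 0); rewrite cmod0.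
have K : forall i x, 0 <= 0 * W i x by move=> i x; rewrite mul0r.
move=> /(_ (fun i x => K i x) W0).
by congr bdn; apply/funext => i; rewrite pderiv_cst.
Qed.

Lemma bdnZ L F W (c : I -> R[i]) (C : R) : 0 <= C -> (forall i, cmod (c i) <= C) ->
  sfam F -> bdn L F W -> bdn L (fun i x => c i * F i x) W.
Proof.
move=> C0 cC sF HF.
have Hc : bdn L (fun i _ => c i) (fun _ _ => 1).
  by apply: (@bdn_cst _ _ _ C) => // i x; rewrite mulr1.
have := bdnM (fun i => smooth_cst _) sF Hc HF.
by congr bdn; apply/funext => i; apply/funext => x; rewrite mul1r.
Qed.

Lemma bdn_sum L (J : Type) (r : seq J) (F : J -> I -> 'rV[R]_N -> R[i]) W :
  (forall i x, 0 <= W i x) ->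
  (forall j, sfam (F j)) -> (forall j, bdn L (F j) W) ->
  bdn L (fun i x => \sum_(j <- r) F j i x) W.
Proof.
move=> W0 sF H; elim: r => [|j r IH].
  have : bdn L (fun (i : I) (_ : 'rV[R]_N) => 0) W.
    by apply: (@bdn_cst _ _ _ 0) => // i x; rewrite mul0r cmod0.
  by congr bdn; apply/funext => i; apply/funext => x; rewrite big_nil.
have := bdnD (sF j) (fun i => smooth_sum r (fun j => sF j i)) (H j) IH.
by congr bdn; apply/funext => i; apply/funext => x; rewrite big_cons.
Qed.

End fix_family.

(** The chain rule produces entries of [A i]; their common bound [c] keeps the constant uniform in
    the index. The translations [b i] may be arbitrary. *)
Lemma bdn_affine (I : Type) L N M (F : I -> 'rV[R]_M -> R[i]) W
    (A : I -> 'M[R]_(N, M)) (b : I -> 'rV[R]_M) (c : R) :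
  0 <= c -> (forall i j k, `|A i j k| <= c) -> (forall i x, 0 <= W i x) ->
  sfam F -> bdn L F W ->
  bdn L (fun i x => F i (x *m A i + b i)) (fun i x => W i (x *m A i + b i)).
Proof.
move=> c0 Ac W0.
have H0 G : bd0 G W -> bd0 (fun i (x : 'rV[R]_N) => G i (x *m A i + b i))
     (fun i x => W i (x *m A i + b i)).
  by move=> [C C0 H]; exists C.
elim: L F => [|L IH] F sF [F1 F2]; split; [exact: H0|by []|exact: H0|].
move=> j.
have := @bdn_sum I N L _ (index_enum 'I_M) (fun k i x => (A i j k)%:C *
   pderiv k (F i) (x *m A i + b i)) (fun i x => W i (x *m A i + b i)).
have s1 k i : smooth (fun x : 'rV[R]_N => pderiv k (F i) (x *m A i + b i)).
  exact/smooth_affine/smooth_pderiv/sF.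
have K k : bdn L (fun i (x : 'rV[R]_N) => (A i j k)%:C *
   pderiv k (F i) (x *m A i + b i)) (fun i x => W i (x *m A i + b i)).
  apply: (@bdnZ _ _ _ _ _ _ c c0).
  - by move=> i; rewrite cmod_real.
  - by move=> i; exact: s1.
  - by apply: IH (F2 k) => i; exact/smooth_pderiv/sF.
move=> /(_ (fun _ _ => W0 _ _) (fun k i => smoothZ _ (s1 k i)) K).
by congr bdn; apply/funext => i; rewrite pderiv_affine; [|exact: sF].
Qed.

(** Mostly used with [I = unit], to view a bound on one function as a bound on a constant family. *)
Lemma bdn_reindex (I J : Type) (p : J -> I) L N (F : I -> 'rV[R]_N -> R[i]) W :
  bdn L F W -> bdn L (fun j => F (p j)) (fun j => W (p j)).
Proof.
have H0 G : bd0 G W -> bd0 (fun j => G (p j)) (fun j => W (p j)).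
  by move=> [C C0 H]; exists C.
elim: L F => [|L IH] F [H1 H2]; split; [exact: H0|by []|exact: H0|].
by move=> j; exact: IH (H2 j).
Qed.

(** Limits are taken along sequences, as dominated convergence requires; the limit [h --> 0^'+] is
    reduced to them by [cvg_at_rightP]. *)
Definition ccvg (z : nat -> R[i]) (l : R[i]) :=
  (fun k => complex.Re (z k)) @ \oo --> complex.Re l /\
  (fun k => complex.Im (z k)) @ \oo --> complex.Im l.

Lemma ccvg_cst l : ccvg (fun=> l) l.
Proof. by split; exact: cvg_cst. Qed.

Lemma ccvgD z w l m : ccvg z l -> ccvg w m -> ccvg (fun k => z k + w k) (l + m).
Proof.
move=> [z1 z2] [w1 w2]; split.
  rewrite (_ : (fun k => _) = (fun k => complex.Re (z k)) + (fun k => complex.Re (w k))).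
    by rewrite cReD; exact: (cvgD z1 w1).
  by apply/funext => k; rewrite cReD.
rewrite (_ : (fun k => _) = (fun k => complex.Im (z k)) + (fun k => complex.Im (w k))).
  by rewrite cImD; exact: (cvgD z2 w2).
by apply/funext => k; rewrite cImD.
Qed.

Lemma ccvgM z w l m : ccvg z l -> ccvg w m -> ccvg (fun k => z k * w k) (l * m).
Proof.
move=> [z1 z2] [w1 w2]; split.
  rewrite (_ : (fun k => _) = (fun k => complex.Re (z k)) * (fun k => complex.Re (w k))
     - (fun k => complex.Im (z k)) * (fun k => complex.Im (w k))).
    by rewrite cReM; exact: (cvgB (cvgM z1 w1) (cvgM z2 w2)).
  by apply/funext => k; rewrite cReM.
rewrite (_ : (fun k => _) = (fun k => complex.Re (z k)) * (fun k => complex.Im (w k))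
   + (fun k => complex.Im (z k)) * (fun k => complex.Re (w k))).
  by rewrite cImM; exact: (cvgD (cvgM z1 w2) (cvgM z2 w1)).
by apply/funext => k; rewrite cImM.
Qed.

(** Derivatives must converge as well, because the limit is taken after an integration by parts that
    has differentiated the amplitude. *)
Fixpoint cvn N (L : nat) (F : nat -> 'rV[R]_N -> R[i]) (G : 'rV[R]_N -> R[i]) : Prop :=
  (forall x, ccvg (F^~ x) (G x)) /\
  if L is L'.+1 then forall j, cvn L' (fun k => pderiv j (F k)) (pderiv j G) else True.

Lemma cvn0 N L (F : nat -> 'rV[R]_N -> R[i]) G : cvn L F G -> forall x, ccvg (F^~ x) (G x).
Proof. by case: L => [|L] []. Qed.

Lemma cvnW N L (F : nat -> 'rV[R]_N -> R[i]) G : cvn L.+1 F G -> cvn L F G.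
Proof.
elim: L F G => [|L IH] F G [H1 H2]; split => //.
by move=> j; exact: IH (H2 j).
Qed.

Lemma cvnD N L (F1 F2 : nat -> 'rV[R]_N -> R[i]) G1 G2 :
  sfam F1 -> sfam F2 -> smooth G1 -> smooth G2 -> cvn L F1 G1 -> cvn L F2 G2 ->
  cvn L (fun k x => F1 k x + F2 k x) (fun x => G1 x + G2 x).
Proof.
elim: L F1 F2 G1 G2 => [|L IH] F1 F2 G1 G2 sF1 sF2 sG1 sG2 H K.
  by split => // x; exact: ccvgD (cvn0 H x) (cvn0 K x).
split; first by move=> x; exact: ccvgD (cvn0 H x) (cvn0 K x).
move=> j; have := IH _ _ _ _ (fun i => smooth_pderiv j (sF1 i))
   (fun i => smooth_pderiv j (sF2 i)) (smooth_pderiv j sG1) (smooth_pderiv j sG2)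
   (H.2 j) (K.2 j).
congr cvn; last by rewrite pderivD; [|exact: sG1|exact: sG2].
by apply/funext => i; rewrite pderivD; [|exact: sF1|exact: sF2].
Qed.

Lemma cvnM N L (F1 F2 : nat -> 'rV[R]_N -> R[i]) G1 G2 :
  sfam F1 -> sfam F2 -> smooth G1 -> smooth G2 -> cvn L F1 G1 -> cvn L F2 G2 ->
  cvn L (fun k x => F1 k x * F2 k x) (fun x => G1 x * G2 x).
Proof.
elim: L F1 F2 G1 G2 => [|L IH] F1 F2 G1 G2 sF1 sF2 sG1 sG2 H K.
  by split => // x; exact: ccvgM (cvn0 H x) (cvn0 K x).
split; first by move=> x; exact: ccvgM (cvn0 H x) (cvn0 K x).
move=> j.
have sF1' i := smooth_pderiv j (sF1 i); have sF2' i := smooth_pderiv j (sF2 i).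
have sG1' := smooth_pderiv j sG1; have sG2' := smooth_pderiv j sG2.
have := cvnD (fun i => smoothM (sF1' i) (sF2 i)) (fun i => smoothM (sF1 i) (sF2' i))
   (smoothM sG1' sG2) (smoothM sG1 sG2')
   (IH _ _ _ _ sF1' sF2 sG1' sG2 (H.2 j) (cvnW K))
   (IH _ _ _ _ sF1 sF2' sG1 sG2' (cvnW H) (K.2 j)).
congr cvn; last by rewrite pderivM; [|exact: sG1|exact: sG2].
by apply/funext => i; rewrite pderivM; [|exact: sF1|exact: sF2].
Qed.

Lemma cvn_cst N L (F : 'rV[R]_N -> R[i]) : cvn L (fun=> F) F.
Proof.
by elim: L F => [|L IH] F; split; [move=> x; exact: ccvg_cst|by []|
  move=> x; exact: ccvg_cst|move=> j; exact: IH].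
Qed.

End families.

(** * Integration over R^n *)

Section measurability.
Context {R : realType} d {T : measurableType d}.

(** Bridges the product sigma-algebra on tuples and the topology of row vectors: the preimage of an
    open interval under [g] is open, hence a union of the countably many rational boxes that it
    contains. *)
Lemma measurable_cont_rV N (v : T -> 'rV[R]_N) (g : 'rV[R]_N -> R) :
  (forall i, measurable_fun setT (fun t => v t 0 i)) -> continuous g ->
  measurable_fun setT (fun t => g (v t)).
Proof.
move=> mv cg; apply: (measurability _ (RGenOpens.measurableE R)).
move=> _ [_ [a [b ->] <-]]; rewrite setTI.
have oU : open (g @^-1` `]a, b[%classic).
  by move/continuousP : cg; apply; exact: interval_open.
set U := g @^-1` _ in oU.
pose box (q : {ffun 'I_N -> rat * rat}) : set 'rV[R]_N :=
  [set x | forall i, x 0 i \in `]ratr (q i).1, ratr (q i).2[].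
have -> : (fun t => g (v t)) @^-1` `]a, b[%classic =
   \bigcup_(q : {ffun 'I_N -> rat * rat})
      [set t | box q `<=` U /\ box q (v t)].
  apply/seteqP; split=> t; last by move=> [q _ [qU /qU]].
  move=> Ut; have : nbhs (v t) U by apply: open_nbhs_nbhs.
  move=> /nbhs_ballP[e /= e0 eU].
  have /choice[q Hq] : forall i, exists q : rat * rat,
      (v t 0 i - e < ratr q.1 < v t 0 i) /\ (v t 0 i < ratr q.2 < v t 0 i + e).
    move=> i; have /rat_in_itvoo[q1 h1] : v t 0 i - e < v t 0 i by rewrite ltrBlDr ltrDl.
    have /rat_in_itvoo[q2 h2] : v t 0 i < v t 0 i + e by rewrite ltrDl.
    by exists (q1, q2); move: h1 h2; rewrite !in_itv /= => -> ->.
  exists [ffun i => q i] => //; split.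
    move=> x xq; apply: eU; split => // i j; rewrite ord1.
    have := xq j; rewrite ffunE; have [] := Hq j; rewrite in_itv /=.
    move=> /andP[h1 h2] /andP[h3 h4] /andP[h5 h6].
    rewrite /ball /= ltr_norml; apply/andP; split; lra.
  move=> i; rewrite ffunE; have [] := Hq i; rewrite in_itv /=.
  by move=> /andP[h1 h2] /andP[h3 h4]; rewrite h2 h3.
apply: countable_bigcupT_measurable => [|q]; first exact: countableP.
have [qU|qU] := pselect (box q `<=` U); last first.
  rewrite (_ : [set t | _] = set0); first exact: measurable0.
  by apply/seteqP; split=> // t [].
rewrite (_ : [set t | _] = \bigcap_(i in [set: 'I_N])
   ((fun t => v t 0 i) @^-1` `]ratr (q i).1, ratr (q i).2[%classic)).
  apply: fin_bigcap_measurable; first exact: finite_finset.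
  by move=> i _; rewrite -[X in measurable X]setTI; exact: mv.
apply/seteqP; split=> t /=.
  by move=> [_ H] i _; exact: H.
by move=> H; split => // i; exact: H.
Qed.

Lemma measurable_vec n i : measurable_fun setT (fun t : n.-tuple (measurableTypeR R) => vec t 0 i).
Proof.
rewrite (_ : (fun t : _ => vec t 0 i) = (@tnth n R)^~ i); first exact: measurable_tnth.
by apply/funext => t; rewrite mxE.
Qed.

End measurability.

Section complex_integral.
Context {R : realType} d {T : measurableType d} (mu : {measure set T -> \bar R}).
Implicit Types (F G : T -> R[i]) (g : T -> R).

Definition Cmeas F := measurable_fun setT (fun t => complex.Re (F t)) /\
  measurable_fun setT (fun t => complex.Im (F t)).

Definition Cint F := mu.-integrable setT (EFin \o (fun t => complex.Re (F t))) /\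
  mu.-integrable setT (EFin \o (fun t => complex.Im (F t))).

Definition dominated F g := forall t, cmod (F t) <= g t.

Lemma CintP F g : Cmeas F -> mu.-integrable setT (EFin \o g) ->
  dominated F g -> Cint F.
Proof.
move=> [m1 m2] ig Fg; split; apply: (le_integrable _ _ _ ig) => //.
- exact/measurable_EFinP.
- move=> t _ /=; rewrite lee_fin (le_trans (cmod_Re _))// (le_trans (Fg t))// ler_norm//.
- exact/measurable_EFinP.
- move=> t _ /=; rewrite lee_fin (le_trans (cmod_Im _))// (le_trans (Fg t))// ler_norm//.
Qed.

Lemma CintegralD F G : Cint F -> Cint G ->
  Cintegral mu (fun t => F t + G t) = Cintegral mu F + Cintegral mu G.
Proof.
move=> [f1 f2] [g1 g2]; apply: ceq; rewrite /Cintegral /=.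
  by rewrite -RintegralD//; apply: eq_Rintegral => t _; rewrite cReD.
by rewrite -RintegralD//; apply: eq_Rintegral => t _; rewrite cImD.
Qed.

Lemma integrableZlE g (c : R) : mu.-integrable setT (EFin \o g) ->
  mu.-integrable setT (EFin \o (fun t => c * g t)).
Proof. by move=> ig; have := integrableZl measurableT c ig. Qed.

Lemma CintegralZ F (c : R[i]) : Cint F ->
  Cintegral mu (fun t => c * F t) = c * Cintegral mu F.
Proof.
move=> [f1 f2]; apply: ceq; rewrite /Cintegral ?cReM ?cImM /=.
  rewrite -!RintegralZl// -RintegralB//; try exact: integrableZlE.
  by apply: eq_Rintegral => t _; rewrite cReM.
rewrite -!RintegralZl// -RintegralD//; try exact: integrableZlE.
by apply: eq_Rintegral => t _; rewrite cImM.
Qed.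

(** The factor 2 comes from estimating real and imaginary parts separately. *)
Lemma Cintegral_le F g : Cmeas F -> mu.-integrable setT (EFin \o g) ->
  dominated F g -> cmod (Cintegral mu F) <= 2 * \int[mu]_t g t.
Proof.
move=> mF ig Fg; have [f1 f2] := CintP mF ig Fg.
rewrite (le_trans (cmod_le _))// mulr_natl mulr2n /= lerD//.
  rewrite (le_trans (le_normr_Rintegral _ f1))//; apply: le_Rintegral => //.
    by have := integrable_abse f1.
  by move=> t _; rewrite (le_trans (cmod_Re _)).
rewrite (le_trans (le_normr_Rintegral _ f2))//; apply: le_Rintegral => //.
  by have := integrable_abse f2.
by move=> t _; rewrite (le_trans (cmod_Im _)).
Qed.

Lemma Cintegral_cvg (F : nat -> T -> R[i]) G g :
  (forall k, Cmeas (F k)) -> Cmeas G -> (forall t, ccvg (F^~ t) (G t)) ->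
  mu.-integrable setT (EFin \o g) -> (forall k, dominated (F k) g) ->
  ccvg (fun k => Cintegral mu (F k)) (Cintegral mu G).
Proof.
move=> mF mG FG ig Fg.
have main (p : R[i] -> R) : (forall k, measurable_fun setT (fun t => p (F k t))) ->
    measurable_fun setT (fun t => p (G t)) ->
    (forall t, (fun k => p (F k t)) @ \oo --> p (G t)) ->
    (forall z, `|p z| <= cmod z) ->
    (fun k => \int[mu]_t p (F k t)) @ \oo --> \int[mu]_t p (G t).
  move=> m1 m2 cv pz.
  have c1 : {ae mu, forall x, setT x ->
      (fun k => (p (F k x))%:E) @ \oo --> (p (G x))%:E}.
    apply: aeW => t _; apply: cvg_EFin; [exact: nearW|exact: cv].
  have c2 : {ae mu, forall x (k : nat), setT x ->
      (`|(p (F k x))%:E| <= (EFin \o g) x)%E}.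
    by apply: aeW => t k _; rewrite /= lee_fin; exact: (le_trans (pz _) (Fg k t)).
  have [ip _ cvg] := dominated_convergence measurableT
    (fun k => proj2 (measurable_EFinP _ _) (m1 k)) (proj2 (measurable_EFinP _ _) m2) c1 ig c2.
  apply: fine_cvg; rewrite /Rintegral fineK; first exact: cvg.
  exact: integrable_fin_num.
split; rewrite /Cintegral /=.
  apply: (main (@complex.Re R)) => [k||t|]; [exact: (mF k).1|exact: mG.1|
    exact: (FG t).1|exact: cmod_Re].
apply: (main (@complex.Im R)) => [k||t|]; [exact: (mF k).2|exact: mG.2|
  exact: (FG t).2|exact: cmod_Im].
Qed.

End complex_integral.

(** Only sequences staying in the unit ball around [x] have to be tested, so that a majorant valid
    near [x] suffices. *)
Lemma seq_continuous (R : realType) N (f : 'rV[R]_N -> R) x :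
  (forall u : nat -> 'rV[R]_N, (forall k, ball x 1 (u k)) -> u @ \oo --> x ->
     f \o u @ \oo --> f x) -> {for x, continuous f}.
Proof.
move=> H; apply/(@cvgrPdist_lt _ _ _ _ (nbhs_filter x)) => e e0; apply: contrapT => nH.
have /choice[u Hu] : forall k : nat, exists y, ball x k.+1%:R^-1 y /\ e <= `|f x - f y|.
  move=> k; apply: contrapT => nE; apply: nH.
  apply/nbhs_ballP; exists k.+1%:R^-1; first by rewrite /= invr_gt0.
  move=> y xy /=; rewrite ltNge; apply/negP => ey; apply: nE; by exists y.
have u1 k : ball x 1 (u k).
  by apply: le_ball (Hu k).1; rewrite invf_le1 ?ler1n.
have ux : u @ \oo --> x.
  apply/cvg_ballP => r r0; near=> k.
  apply: (@le_ball _ _ x k.+1%:R^-1); last exact: (Hu k).1.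
  by apply: ltW; near: k; exact: (near_infty_natSinv_lt (PosNum r0)).
have /cvgrPdist_lt/(_ e e0)[k _ /(_ k (leqnn k))] := H u u1 ux.
by rewrite ltNge /= (Hu k).2.
Unshelve. all: end_near. Qed.

(** * Integrals depending on a parameter *)

Section parametric_integral.
Context {R : realType} d {T : measurableType d} (mu : {measure set T -> \bar R}).
Context {N : nat}.
Implicit Types (Phi : 'rV[R]_N -> T -> R[i]).

(** The majorant may depend on the base point. This is necessary here, since the integrands are
    allowed to grow polynomially in the parameter. *)
Definition locdom Phi := forall x0 : 'rV[R]_N, exists2 g : T -> R,
  mu.-integrable setT (EFin \o g) &
  forall x : 'rV[R]_N, (forall i, `|x 0 i - x0 0 i| <= 1) -> dominated (Phi x) g.

Lemma locdom_Cint Phi : (forall x, Cmeas (Phi x)) -> locdom Phi ->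
  forall x, Cint mu (Phi x).
Proof.
move=> m H x; have [g ig Hg] := H x; apply: (CintP (m x) ig).
by apply: Hg => i; rewrite subrr normr0.
Qed.

Lemma ccont_Cintegral Phi : (forall x, Cmeas (Phi x)) ->
  (forall t, ccont (Phi^~ t)) -> locdom Phi ->
  ccont (fun x => Cintegral mu (Phi x)).
Proof.
move=> mP cP dP.
have K x (u : nat -> 'rV[R]_N) : (forall k, ball x 1 (u k)) -> u @ \oo --> x ->
    ccvg (fun k => Cintegral mu (Phi (u k))) (Cintegral mu (Phi x)).
  move=> u1 ux; have [g ig Hg] := dP x.
  apply: (@Cintegral_cvg _ _ _ mu _ _ g) => //.
  - move=> t; have [h1 h2] := cP t.
    by split; [exact: (cvg_comp _ _ ux (h1 x))|exact: (cvg_comp _ _ ux (h2 x))].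
  - move=> k; apply: Hg => i; rewrite distrC ltW//.
    by have [_ /(_ 0 i)] := u1 k.
by split => x; apply: seq_continuous => u u1 ux; have [] := K x u u1 ux.
Qed.

Lemma is_cder_Cintegral Phi dPhi i : (forall x, Cmeas (Phi x)) ->
  (forall x t, is_cder (Phi^~ t) x (delta_mx 0 i) (dPhi x t)) ->
  locdom Phi -> locdom dPhi ->
  forall x, is_cder (fun y => Cintegral mu (Phi y)) x (delta_mx 0 i)
    (Cintegral mu (dPhi x)).
Proof.
move=> mP dP lP ldP x; have [g ig Hg] := ldP x.
have iP := locdom_Cint mP lP.
have g0 t : 0 <= g t.
  by apply: le_trans (Hg x _ t); [exact: cmod_ge0|move=> j; rewrite subrr normr0].
have main (p : R[i] -> R) : (forall z, `|p z| <= cmod z) ->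
    (forall y, mu.-integrable setT (EFin \o (fun t => p (Phi y t)))) ->
    (forall y t, is_derive y (delta_mx 0 i) (fun y => p (Phi y t)) (p (dPhi y t))) ->
    is_derive x (delta_mx 0 i) (fun y => \int[mu]_t p (Phi y t))
      (\int[mu]_t p (dPhi x t)).
  move=> pz ip dp; apply/derive_line0.
  pose f (s : R) t := p (Phi (x + s *: delta_mx 0 i) t).
  have df s t : is_derive s (1 : R) (f^~ t) (p (dPhi (x + s *: delta_mx 0 i) t)).
    by apply/derive_lineE; exact: dp.
  have E s t : partial1of2 f s t = p (dPhi (x + s *: delta_mx 0 i) t).
    by rewrite partial1of2E (derive_val (is_derive := df s t)).
  (* For line parameters in this interval the points stay in the unit cube around [x], where [g]
     dominates. *)
  have Ia : `](-1 : R), 1[%classic (0 : R) by rewrite /= in_itv /= ltrN10 ltr01.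
  have Gub s t : `](-1 : R), 1[%classic s -> [set: T] t -> `|partial1of2 f s t| <= g t.
    rewrite /= in_itv /= => /andP[s1 s2] _; rewrite E (le_trans (pz _))//.
    apply: Hg => j; rewrite !mxE addrAC subrr add0r eqxx /=.
    case: (j == i); rewrite ?mulr1 ?mulr0 ?normr0// ler_norml.
    by rewrite !ltW.
  have ex s t : `](-1 : R), 1[%classic s -> [set: T] t -> derivable (f^~ t) s 1.
    by move=> _ _; have [] := df s t.
  split.
    exact: (derivable_under_integral measurableT Ia (fun s _ => ip _) ex g0 ig Gub).
  rewrite -derive1E.
  rewrite (differentiation_under_integral measurableT Ia (fun s _ => ip _) ex g0 ig Gub).
  by apply: eq_Rintegral => t _; rewrite E scale0r addr0.
split; rewrite /Cintegral /=.
  apply: (main (@complex.Re R)) => [|y|y t]; [exact: cmod_Re|exact: (iP y).1|exact: (dP y t).1].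
apply: (main (@complex.Im R)) => [|y|y t]; [exact: cmod_Im|exact: (iP y).2|exact: (dP y t).2].
Qed.

End parametric_integral.

(** * Affine changes of variables and integrability of the weight *)

Section affine_change.
Variable R : realType.
Local Notation lam := (@lebesgue_measure R).
Local Notation T := (measurableTypeR R).

Definition aff1 (a b : R) : T -> T := fun x => a * x + b.

Lemma measurable_aff1 a b : measurable_fun [set: T] (aff1 a b).
Proof.
apply: measurable_funD; last exact: measurable_cst.
by apply: measurable_funM; [exact: measurable_cst|exact: measurable_id].
Qed.

(** Both sides are measures of [A]; they agree on half-open intervals, and this determines Lebesgue
    measure. *)
Lemma lebesgue_measure_aff1 (a b : R) (A : set T) : a != 0 -> measurable A ->
  lam A = (`|a|%:E * lam (aff1 a b @^-1` A))%E.
Proof.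
move=> a0 mA.
pose k := NngNum (normr_ge0 a).
pose mf := measurable_aff1 a b.
rewrite [RHS](_ : _ = mscale k (pushforward lam (aff1 a b)) A)//.
apply: lebesgue_measure_unique mA => //= _ [[l r]] _ <-.
rewrite /mscale /= lebesgue_measure_itv /= lte_fin /pushforward.
have [a_gt0|a_lt0|/eqP] := ltgtP a 0; last by rewrite (negbTE a0).
(* In this case [a] is negative, contrary to what the name of the hypothesis suggests: the map
   reverses orientation, so the closed end moves to the left. *)
- rewrite (_ : aff1 a b @^-1` _ = `[(r - b) / a, (l - b) / a[%classic).
    rewrite [X in (_ * X)%E]lebesgue_measure_itv /= lte_fin.
    rewrite ltr_ndivrMr// divfK// ltrD2r; case: ifP => lr; last by rewrite mule0.
    rewrite -EFinB -EFinM ltr0_norm//; congr EFin; field.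
    by rewrite lt_eqF.
  apply/seteqP; split => x; rewrite /= !in_itv /aff1 /=;
  by rewrite ler_ndivrMr// ltr_ndivlMr// lerBrDr ltrBlDr [x * a]mulrC andbC.
- rewrite (_ : aff1 a b @^-1` _ = `](l - b) / a, (r - b) / a]%classic).
    rewrite [X in (_ * X)%E]lebesgue_measure_itv /= lte_fin.
    rewrite ltr_pdivrMr// divfK ?gt_eqF// ltrD2r; case: ifP => lr; last by rewrite mule0.
    rewrite -EFinB -EFinM gtr0_norm//; congr EFin; field.
    by rewrite gt_eqF.
  apply/seteqP; split => x; rewrite /= !in_itv /aff1 /=;
  by rewrite ler_pdivlMr// ltr_pdivrMr// lerBrDr ltrBlDr [x * a]mulrC.
Qed.

Lemma ge0_integral_aff1 (a b : R) (f : T -> \bar R) : a != 0 ->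
  measurable_fun setT f -> (forall x, 0 <= f x)%E ->
  (\int[lam]_x f (aff1 a b x) = (`|a|^-1)%:E * \int[lam]_x f x)%E.
Proof.
move=> a0 mf f0.
have na : 0 < `|a| by rewrite normr_gt0.
pose k := NngNum (normr_ge0 a).
have E : (\int[lam]_x f x = `|a|%:E * \int[lam]_x f (aff1 a b x))%E.
  pose P : {measure set T -> \bar R} :=
    measure_function_pushforward__canonical__measure_function_Measure lam
      (measurable_aff1 a b).
  transitivity (\int[mscale k P]_x f x)%E.
    by apply: eq_measure_integral => A mA _; exact: lebesgue_measure_aff1.
  have := @ge0_integral_mscale _ _ R _ _ measurableT k f mf (fun x _ => f0 x).
  move=> ->; congr (_ * _)%E.
  by rewrite ge0_integral_pushforward //; exact: measurable_aff1.
by rewrite E muleA -EFinM mulVf ?gt_eqF// mul1e.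
Qed.

Local Notation mu n := (lebesgue_tuple R n).

Lemma tcons_surj n (t : n.+1.-tuple T) : t = tcons (thead t, [tuple of behead t]).
Proof. by rewrite [LHS]tuple_eta; exact/val_inj. Qed.

Lemma ge0_integral_tcons n (f : n.+1.-tuple T -> \bar R) :
  measurable_fun setT f -> (forall t, 0 <= f t)%E ->
  (\int[mu n.+1]_t f t = \int[lam]_x \int[mu n]_t f (tcons (x, t)))%E.
Proof.
move=> mf f0.
transitivity (\int[(lam \x mu n)%E]_p f (tcons p))%E.
  exact: (@ge0_integral_pushforward _ _ _ _ _ _ (@measurable_tcons R n)
    (lam \x mu n)%E _ _ measurableT mf (fun t _ => f0 t)).
rewrite -(fubini_tonelli1 (f \o @tcons R n)); first by [].
  exact: (measurableT_comp mf (@measurable_tcons R n)).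
by move=> p; exact: f0.
Qed.

Definition aff n (a : R) (b t : n.-tuple T) : n.-tuple T :=
  [tuple aff1 a (tnth b i) (tnth t i) | i < n].

Lemma measurable_aff n a b : measurable_fun setT (@aff n a b).
Proof.
apply/measurable_fun_tnthP => i.
rewrite (_ : _ \o _ = aff1 a (tnth b i) \o (@tnth n T)^~ i); last first.
  by apply/funext => t /=; rewrite tnth_mktuple.
by apply: measurableT_comp; [exact: measurable_aff1|exact: measurable_tnth].
Qed.

Lemma aff_tcons n a (b : n.+1.-tuple T) p :
  aff a b (tcons p) = tcons (aff1 a (thead b) p.1, aff a [tuple of behead b] p.2).
Proof.
apply: eq_from_tnth => i; rewrite tnth_mktuple.
case: (unliftP ord0 i) => [j|] ->.
  by rewrite !tnthS tnth_mktuple {1}(tcons_surj b) tnthS.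
by rewrite !tnth0.
Qed.

Lemma vec_aff n a (b t : n.-tuple T) : vec (aff a b t) = a *: vec t + vec b.
Proof. by apply/rowP => i; rewrite !mxE tnth_mktuple. Qed.

(** By Tonelli each coordinate contributes one factor [|a|^-1]; the translation vector is split
    along with the tuple. *)
Lemma ge0_integral_aff n (a : R) (b : n.-tuple T) (f : n.-tuple T -> \bar R) :
  a != 0 -> measurable_fun setT f -> (forall t, 0 <= f t)%E ->
  (\int[mu n]_t f (aff a b t) = (`|a| ^- n)%:E * \int[mu n]_t f t)%E.
Proof.
move=> a0; elim: n b f => [|n IH] b f mf f0.
  rewrite expr0 invr1 mul1e; apply: eq_integral => t _; congr f.
  by rewrite (tuple0 t) (tuple0 (aff _ _ _)).
have mfa : measurable_fun setT (fun t => f (aff a b t)).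
  exact: (measurableT_comp mf (measurable_aff a b)).
rewrite ge0_integral_tcons //.
have mfc : measurable_fun setT (f \o @tcons R n).
  exact: (measurableT_comp mf (@measurable_tcons R n)).
have mfx x : measurable_fun setT (fun t => f (tcons (x, t))).
  exact: (measurableT_comp mfc (pair1_measurable x)).
have E x : (\int[mu n]_t f (aff a b (tcons (x, t))) =
    (`|a| ^- n)%:E * \int[mu n]_t f (tcons (aff1 a (thead b) x, t)))%E.
  under eq_integral do rewrite aff_tcons.
  exact: (IH _ (fun t => f (tcons (aff1 a (thead b) x, t)))).
under eq_integral do rewrite E.
have mF : measurable_fun setT (fun x => \int[mu n]_t f (tcons (x, t)))%E.
  exact: (measurable_fun_fubini_tonelli_F (f \o @tcons R n) mfc (fun p => f0 _)).
have F0 x : (0 <= \int[mu n]_t f (tcons (x, t)))%E by exact: integral_ge0.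
rewrite ge0_integralZl//; last exact: (measurableT_comp mF (measurable_aff1 _ _)).
rewrite (ge0_integral_aff1 (thead b) a0 mF F0) ge0_integral_tcons // muleA -EFinM.
by rewrite exprSr invfM mulrC.
Qed.

Lemma Rintegral_aff n (a : R) (b : n.-tuple T) (f : n.-tuple T -> R) :
  a != 0 -> (mu n).-integrable setT (EFin \o f) ->
  (mu n).-integrable setT (EFin \o (fun t => f (aff a b t))) /\
  \int[mu n]_t f (aff a b t) = `|a| ^- n * \int[mu n]_t f t.
Proof.
move=> a0 /[dup] iF /integrableP[mf foo].
have mfa : measurable_fun setT (fun t => (f (aff a b t))%:E).
  by apply: (measurableT_comp mf); exact: measurable_aff.
split.
  apply/integrableP; split => //=.
  have := @ge0_integral_aff n a b (fun t => `|(f t)%:E|%E) a0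
     (measurableT_comp (@abse_measurable R setT) mf) (fun t => abse_ge0 _).
  move=> ->.
  by rewrite lte_mul_pinfty ?lee_fin ?invr_ge0 ?exprn_ge0.
rewrite /Rintegral -[RHS]/(fine ((`|a| ^- n)%:E) * _) -fineM//; last exact: integrable_fin_num.
congr fine.
have E1 := integralE (mu n) setT (fun t => (f (aff a b t))%:E).
have E2 := integralE (mu n) setT (EFin \o f).
have E3 := ge0_integral_aff b a0 (measurable_funepos mf) (fun=> funepos_ge0 _ _).
have E4 := ge0_integral_aff b a0 (measurable_funeneg mf) (fun=> funeneg_ge0 _ _).
transitivity ((`|a| ^- n)%:E * (\int[mu n]_t (EFin \o f) t))%E; last by [].
rewrite E1 E2 muleBr//; last first.
  apply: fin_num_adde_defr.
  exact: (integrable_fin_num measurableT (integrable_funepos measurableT iF)).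
have P3 := funepos_comp (EFin \o f) (aff a b).
have P4 := funeneg_comp (EFin \o f) (aff a b).
rewrite -E3 -E4 -[X in (_ = X - _)%E]/(\int[mu n]_t ((EFin \o f)^\+ \o aff a b) t)%E.
by rewrite -[X in (_ = _ - X)%E]/(\int[mu n]_t ((EFin \o f)^\- \o aff a b) t)%E -P3 -P4.
Qed.

Lemma continuous_pw n : continuous (@pw R n).
Proof.
move=> x; rewrite /pw.
suff H (r : seq 'I_n) : (fun y : 'rV[R]_n => \prod_(i <- r) (1 + y 0 i ^+ 2)) @ x -->
  \prod_(i <- r) (1 + x 0 i ^+ 2) by exact: H.
elim: r => [|i r IH].
  rewrite big_nil (_ : (fun y => _) = fun=> 1); last first.
    by apply/funext => y; rewrite big_nil.
  exact: (@cvg_cst R 1 _ (nbhs x) (nbhs_filter x)).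
rewrite big_cons (_ : (fun y => _) = fun y : 'rV[R]_n =>
   (1 + y 0 i ^+ 2) * \prod_(i <- r) (1 + y 0 i ^+ 2)); last first.
  by apply/funext => y; rewrite big_cons.
have h1 := @coord_continuous R 1 n 0 i x.
have h2 : (fun y : 'rV[R]_n => 1 + y 0 i ^+ 2) @ x --> 1 + x 0 i ^+ 2.
  have H := @cvgD _ _ _ (nbhs x) (nbhs_filter x) (cst (1 : R)) _ 1 _
    (cvg_cst _) (cvgM h1 h1).
  exact: H.
exact: (cvgM h2 IH).
Qed.

Lemma measurable_pwV n k : measurable_fun setT (fun t : n.-tuple T => pw (vec t) ^- k).
Proof.
apply: (@measurable_cont_rV _ _ _ _ (@vec R n) (fun x => pw x ^- k)).
  by move=> i; exact: measurable_vec.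
move=> x.
have H : (fun y : 'rV[R]_n => pw y ^+ k) @ x --> pw x ^+ k.
  elim: k => [|k IH]; first exact: (@cvg_cst R 1 _ (nbhs x) (nbhs_filter x)).
  rewrite exprS (_ : (fun y => _) = fun y : 'rV[R]_n => pw y * pw y ^+ k).
    exact: (cvgM (@continuous_pw n x) IH).
  by apply/funext => y; rewrite exprS.
exact: (cvgV (lt0r_neq0 (pwX_gt0 x k)) H).
Qed.

Lemma lebesgue_oneDsqr_lty : (\int[lam]_x ((1 + x ^+ 2)^-1)%:E < +oo)%E.
Proof.
pose f (x : R) := ((1 + x ^+ 2)^-1)%:E.
have f0 x : (0 <= f x)%E by rewrite lee_fin invr_ge0 sq1_ge0.
have mf : measurable_fun setT f.
  apply/measurable_EFinP; apply: continuous_measurable_fun => x.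
  exact: (@continuous_oneDsqrV R x).
have h1 : (\int[lam]_(x in `[0%R, +oo[) f x < +oo)%E.
  by have := @integral0y_oneDsqr R; rewrite /oneDsqr /f => ->; rewrite ltry.
have h2 : (\int[lam]_(x in `]-oo, 0%R]) f x < +oo)%E.
  have := ge0_integration_by_substitution0 mf f0.
  rewrite (_ : (fun r => f (- r)) = f); first by move=> <-.
  by apply/funext => r; rewrite /f sqrrN.
have E : [set: R] = `]-oo, 0%R]%classic `|` `]0%R, +oo[%classic.
  apply/seteqP; split => x // _; rewrite /= !in_itv /= andbT.
  by case: (leP x 0); [left|right].
rewrite E ge0_integral_setU//=.
- rewrite lte_add_pinfty//; apply: le_lt_trans h1.
  apply: ge0_subset_integral => //.
  + exact: measurable_funTS.
  + by move=> x _; exact: f0.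
  + by move=> x; rewrite /= !in_itv /= !andbT; exact: ltW.
- exact: measurable_funTS.
- by move=> x _; exact: f0.
- apply/disj_set2P/seteqP; split=> // x [] /=; rewrite !in_itv /= andbT.
  by move=> /le_lt_trans h /h; rewrite ltxx.
Qed.

Lemma pw_tcons n p : pw (vec (@tcons R n p)) = (1 + p.1 ^+ 2) * pw (vec p.2).
Proof.
rewrite /pw big_ord_recl !mxE tnth0; congr (_ * _).
by apply: eq_bigr => i _; rewrite !mxE tnthS.
Qed.

Lemma integrable_pwV n : (mu n).-integrable setT (EFin \o (fun t => (pw (vec t))^-1)).
Proof.
have mp k : measurable_fun setT (fun t : k.-tuple T => ((pw (vec t))^-1)%:E).
  apply/measurable_EFinP; have := @measurable_pwV k 1.
  by under eq_fun do rewrite expr1.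
have p0 k (t : k.-tuple T) : (0 <= ((pw (vec t))^-1)%:E)%E.
  by rewrite lee_fin invr_ge0 ltW ?pw_gt0.
apply/integrableP; split; first exact: mp.
under eq_integral => t _ do rewrite [`|_|%E](gee0_abs (p0 n t)).
elim: n => [|n IH].
  under eq_integral => t _ do rewrite /pw big_ord0 invr1.
  rewrite integral_cst//= mul1e.
  by rewrite -[X in (X < _)%E]/(\d_[tuple] setT) diracT ltry.
rewrite ge0_integral_tcons//.
have E x : (\int[mu n]_t ((pw (vec (tcons (x, t))))^-1)%:E =
    ((1 + x ^+ 2)^-1)%:E * \int[mu n]_t ((pw (vec t))^-1)%:E)%E.
  rewrite -ge0_integralZl//; last by rewrite lee_fin invr_ge0 sq1_ge0.
    by apply: eq_integral => t _; rewrite pw_tcons invfM EFinM.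
  exact: mp.
under eq_integral do rewrite E.
have I0 : (0 <= \int[mu n]_t ((pw (vec t))^-1)%:E)%E by exact: integral_ge0.
under eq_integral do rewrite muleC.
rewrite ge0_integralZl//=.
- by rewrite lte_mul_pinfty ?lebesgue_oneDsqr_lty// ge0_fin_numE.
- apply/measurable_EFinP; apply: continuous_measurable_fun => x.
  exact: (@continuous_oneDsqrV R x).
- by move=> x _; rewrite lee_fin invr_ge0 sq1_ge0.
Qed.

End affine_change.

(** * Integration by parts on R^n and R^2n *)

Section integration_on_Rn.
Variable R : realType.
Local Notation T := (measurableTypeR R).
Local Notation mu n := (lebesgue_tuple R n).

Lemma Cmeas_cont d (S : measurableType d) N (v : S -> 'rV[R]_N) (f : 'rV[R]_N -> R[i]) :
  (forall i, measurable_fun setT (fun s => v s 0 i)) -> ccont f ->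
  Cmeas (fun s => f (v s)).
Proof. by move=> mv [h1 h2]; split; [exact: (measurable_cont_rV mv h1)|exact: (measurable_cont_rV mv h2)]. Qed.

Lemma Cmeas_vec n (f : 'rV[R]_n -> R[i]) : ccont f ->
  Cmeas (fun t : n.-tuple T => f (vec t)).
Proof. by apply: Cmeas_cont => i; exact: measurable_vec. Qed.

Lemma pw_loc n (x x0 : 'rV[R]_n) : (forall i, `|x 0 i - x0 0 i| <= 1) ->
  pw x <= 4 ^+ n * pw x0.
Proof.
move=> H; rewrite -{1}[x](subrK x0); apply: (le_trans (pw_add _ _)).
(* In each coordinate one factor 2 comes from [pw_add] and the other bounds
   [1 + (x 0 i - x0 0 i) ^+ 2]. *)
rewrite (_ : 4 = 2 * 2 :> R); last by rewrite -natrM.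
rewrite exprMn -mulrA ler_wpM2l ?exprn_ge0// ler_wpM2r ?(ltW (pw_gt0 _))//.
rewrite /pw -[X in 2 ^+ X]card_ord -prodr_const; apply: prod_le => j.
rewrite sq1_ge0 !mxE /= -[leRHS]/(1 + 1) lerD2l.
by rewrite -real_normK ?num_real// expr_le1//; exact: H.
Qed.

Lemma integrable_CpwV n (C : R) :
  (mu n).-integrable setT (EFin \o (fun t => C * (pw (vec t))^-1)).
Proof. by apply: integrableZlE; exact: integrable_pwV. Qed.

Definition L1dom n (f : 'rV[R]_n -> R[i]) (C : R) := forall x, cmod (f x) <= C * (pw x)^-1.

Lemma L1dom_Cint n f C : ccont f -> @L1dom n f C -> Cint (mu n) (fun t => f (vec t)).
Proof.
move=> cf H; apply: (CintP (Cmeas_vec cf) (integrable_CpwV n C)) => t.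
exact: H.
Qed.

Lemma int_Rn_aff n f C (a : R) (b : 'rV[R]_n) : a != 0 -> ccont f -> L1dom f C ->
  int_Rn (fun x => f (a *: x + b)) = (`|a| ^- n)%:C * int_Rn f.
Proof.
move=> a0 cf fC; have [i1 i2] := L1dom_Cint cf fC.
pose b' : n.-tuple T := [tuple b 0 i | i < n].
have vb : vec b' = b by apply/rowP => i; rewrite !mxE tnth_mktuple.
have [_ e1] := Rintegral_aff b' a0 i1.
have [_ e2] := Rintegral_aff b' a0 i2.
have E t : vec (aff a b' t) = a *: vec t + b by rewrite vec_aff vb.
apply: ceq; rewrite /int_Rn /Cintegral /=.
  rewrite mul0r subr0 -e1; apply: eq_Rintegral => t _; by rewrite E.
rewrite mul0r addr0 -e2; apply: eq_Rintegral => t _; by rewrite E.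
Qed.

Lemma ccont_comp n m (g : 'rV[R]_n -> 'rV[R]_m) (f : 'rV[R]_m -> R[i]) :
  continuous g -> ccont f -> ccont (fun x => f (g x)).
Proof.
by move=> cg [h1 h2]; split => x;
  [exact: (cvg_comp _ _ (cg x) (h1 _))|exact: (cvg_comp _ _ (cg x) (h2 _))].
Qed.

Lemma continuous_addr n (b : 'rV[R]_n) : continuous (fun x : 'rV[R]_n => x + b).
Proof.
move=> x; have H := @cvgD _ _ _ (nbhs x) (nbhs_filter x) id (cst b) _ _ cvg_id (cvg_cst _).
exact: H.
Qed.

Lemma pw_shiftV n (x y : 'rV[R]_n) : (pw (x + y))^-1 <= 2 ^+ n * pw y * (pw x)^-1.
Proof.
have := @pw_subV R n x (- y) 1.
by rewrite opprK pwN !expr1 muln1 mulrA.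
Qed.

(** Translation invariance replaces boundary terms: the integral of [W (t + x)] over [t] does not
    depend on [x], and differentiating under the integral sign at [x = 0] gives the claim. *)
Lemma int_Rn_pderiv0 n (W : 'rV[R]_n -> R[i]) j C : 0 <= C -> smooth W ->
  L1dom W C -> L1dom (pderiv j W) C -> int_Rn (pderiv j W) = 0.
Proof.
move=> C0 sW W1 W2.
pose Phi (x : 'rV[R]_n) (t : n.-tuple T) := W (vec t + x).
pose dPhi (x : 'rV[R]_n) (t : n.-tuple T) := pderiv j W (vec t + x).
have dom f : L1dom f C -> locdom (mu n) (fun x (t : n.-tuple T) => f (vec t + x)).
  move=> fC x0.
  exists (fun t => C * 2 ^+ n * (4 ^+ n * pw x0) * (pw (vec t))^-1).
    exact: integrable_CpwV.
  move=> x /pw_loc px t; rewrite (le_trans (fC _))//.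
  rewrite (le_trans (ler_wpM2l C0 (pw_shiftV (vec t) x)))// -!mulrA.
  rewrite ler_wpM2l// ler_wpM2l ?exprn_ge0// [leRHS]mulrA ler_wpM2r//.
  by rewrite invr_ge0 ltW ?pw_gt0.
have mP x : Cmeas (Phi x).
  apply: (Cmeas_vec (f := fun y => W (y + x))).
  by apply: ccont_comp (smooth_ccont sW); exact: continuous_addr.
have dP (x : 'rV[R]_n) (t : n.-tuple T) :
    is_cder (Phi^~ t) x (delta_mx 0 j) (dPhi x t).
  have [h1 h2] := smooth_is_cder (vec t + x) j sW.
  have E : (fun s : R => vec t + (x + s *: delta_mx 0 j)) =
     (fun s : R => vec t + x + s *: delta_mx 0 j :> 'rV[R]_n).
    by apply/funext => s; rewrite addrA.
  split; apply/derive_line0.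
    rewrite (_ : (fun s : R => _) =
      (fun s : R => complex.Re (W (vec t + x + s *: delta_mx 0 j)))).
      by apply/(derive_line0 (fun y => complex.Re (W y))).
    by apply/funext => s; rewrite /Phi addrA.
  rewrite (_ : (fun s : R => _) =
    (fun s : R => complex.Im (W (vec t + x + s *: delta_mx 0 j)))).
    by apply/(derive_line0 (fun y => complex.Im (W y))).
  by apply/funext => s; rewrite /Phi addrA.
have := is_cder_Cintegral mP dP (dom _ W1) (dom _ W2) 0.
have -> : (fun y => Cintegral (mu n) (Phi y)) = fun=> int_Rn W.
  apply/funext => y; rewrite -[LHS]/(int_Rn (fun x => W (x + y))).
  have := int_Rn_aff y (oner_neq0 R) (smooth_ccont sW) W1.
  rewrite normr1 expr1n invr1 mul1r => <-.
  by congr int_Rn; apply/funext => x; rewrite scale1r.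
move=> /is_cder_cD; rewrite (is_cder_cD (is_cder_cst _ _ _)) => ->.
by rewrite /int_Rn; congr Cintegral; apply/funext => t; rewrite /dPhi addr0.
Qed.

Lemma integral_fin0 d (S : measurableType d) (m : {measure set S -> \bar R}) (g : S -> R) :
  m.-integrable setT (EFin \o g) -> \int[m]_s g s = 0 -> (\int[m]_s (g s)%:E = 0)%E.
Proof.
move=> ig g0; have := integrable_fin_num measurableT ig.
by move=> /fineK <-; congr EFin.
Qed.

(** Fubini, with the inner integral taken in whichever variable makes it vanish. *)
Lemma Rintegral_prod0 d1 d2 (S1 : measurableType d1) (S2 : measurableType d2)
  (m1 : {sigma_finite_measure set S1 -> \bar R})
  (m2 : {sigma_finite_measure set S2 -> \bar R}) (f : S1 * S2 -> R) :
  (m1 \x m2)%E.-integrable setT (EFin \o f) ->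
  ((forall s2, m1.-integrable setT (EFin \o (fun s1 => f (s1, s2))) /\
    \int[m1]_s f (s, s2) = 0) \/
   (forall s1, m2.-integrable setT (EFin \o (fun s2 => f (s1, s2))) /\
    \int[m2]_s f (s1, s) = 0)) ->
  \int[(m1 \x m2)%E]_p f p = 0.
Proof.
move=> fi H; rewrite /Rintegral.
suff -> : (\int[(m1 \x m2)%E]_p (f p)%:E = 0)%E by [].
case: H => H.
  rewrite -(integral21_prod_meas1 fi) /fubini_G.
  rewrite (eq_integral (cst 0%E)); first by rewrite integral_cst// mul0e.
  by move=> s2 _; apply: integral_fin0; [exact: (H s2).1|exact: (H s2).2].
rewrite -(integral12_prod_meas1 fi) /fubini_F.
rewrite (eq_integral (cst 0%E)); first by rewrite integral_cst// mul0e.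
by move=> s1 _; apply: integral_fin0; [exact: (H s1).1|exact: (H s1).2].
Qed.

Local Notation mu2 n := (mu n \x mu n)%E.

Lemma integrable_pwV2 n (C : R) : (mu2 n).-integrable setT
  (EFin \o (fun p => C * ((pw (vec p.1))^-1 * (pw (vec p.2))^-1))).
Proof.
apply: integrableZlE.
have i1 := integrable_pwV R n.
have mp : measurable_fun setT (fun t : n.-tuple T => (pw (vec t))^-1).
  by have := @measurable_pwV R n 1; under eq_fun do rewrite expr1.
have p0 (t : n.-tuple T) : 0 <= (pw (vec t))^-1 by rewrite invr_ge0 ltW ?pw_gt0.
have mf : measurable_fun setT (EFin \o (fun p : n.-tuple T * n.-tuple T =>
     (pw (vec p.1))^-1 * (pw (vec p.2))^-1)).
  apply/measurable_EFinP; apply: measurable_funM.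
    exact: (measurableT_comp mp measurable_fst).
  exact: (measurableT_comp mp measurable_snd).
have [_ K] := @integrable12ltyP _ _ _ _ R (mu n) (mu n) _ mf; apply: K.
pose I := (\int[mu n]_t ((pw (vec t))^-1)%:E)%E.
have Ioo : (I < +oo)%E.
  have /integrableP[_] := i1; apply: le_lt_trans.
  rewrite le_eqVlt; apply/orP; left; apply/eqP/eq_integral => t _.
  by rewrite /= ger0_norm.
have I0 : (0 <= I)%E by apply: integral_ge0 => t _; rewrite lee_fin.
have E t : (\int[mu n]_y `|(EFin \o (fun p : n.-tuple T * n.-tuple T =>
     ((pw (vec p.1))^-1 * (pw (vec p.2))^-1)%R)) (t, y)| = ((pw (vec t))^-1)%:E * I)%E.
  rewrite /I -ge0_integralZl.
  - by apply: eq_integral => s _; rewrite /= ger0_norm ?mulr_ge0// EFinM.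
  - by [].
  - exact/measurable_EFinP.
  - by move=> s _; rewrite lee_fin.
  - by rewrite lee_fin.
under eq_integral do rewrite E.
under eq_integral do rewrite muleC.
rewrite ge0_integralZl.
- by rewrite lte_mul_pinfty// ge0_fin_numE.
- by [].
- exact/measurable_EFinP.
- by move=> s _; rewrite lee_fin.
- exact: I0.
Qed.

Lemma int_R2n_pderiv_l n (W : 'rV[R]_n -> 'rV[R]_n -> R[i]) j C : 0 <= C ->
  (forall xi, smooth (W^~ xi)) ->
  (forall y xi, cmod (W y xi) <= C * ((pw y)^-1 * (pw xi)^-1)) ->
  (forall y xi, cmod (pderiv j (W^~ xi) y) <= C * ((pw y)^-1 * (pw xi)^-1)) ->
  Cmeas (fun p : n.-tuple T * n.-tuple T => pderiv j (W^~ (vec p.2)) (vec p.1)) ->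
  int_R2n (fun y xi => pderiv j (W^~ xi) y) = 0.
Proof.
move=> C0 sW W1 W2 mW.
have I0 xi : Cint (mu n) (fun t => pderiv j (W^~ xi) (vec t)) /\
   int_Rn (pderiv j (W^~ xi)) = 0.
  have C'0 : 0 <= C * (pw xi)^-1 by rewrite mulr_ge0// invr_ge0 ltW ?pw_gt0.
  have d1 : L1dom (W^~ xi) (C * (pw xi)^-1).
    by move=> y; rewrite (le_trans (W1 y xi))// [X in C * X]mulrC mulrA.
  have d2 : L1dom (pderiv j (W^~ xi)) (C * (pw xi)^-1).
    by move=> y; rewrite (le_trans (W2 y xi))// [X in C * X]mulrC mulrA.
  split; last exact: int_Rn_pderiv0 C'0 (sW xi) d1 d2.
  exact: L1dom_Cint (smooth_ccont (smooth_pderiv j (sW xi))) d2.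
have [i1 i2] := CintP mW (integrable_pwV2 n C) (fun p => W2 _ _).
apply: ceq; rewrite /int_R2n /Cintegral /=.
  apply: (Rintegral_prod0 i1); left => s2; have [[h1 _] h2] := I0 (vec s2).
  by split; [exact: h1|move: h2 => /(congr1 (@complex.Re R))].
apply: (Rintegral_prod0 i2); left => s2; have [[_ h1] h2] := I0 (vec s2).
by split; [exact: h1|move: h2 => /(congr1 (@complex.Im R))].
Qed.

Lemma int_R2n_pderiv_r n (W : 'rV[R]_n -> 'rV[R]_n -> R[i]) j C : 0 <= C ->
  (forall y, smooth (W y)) ->
  (forall y xi, cmod (W y xi) <= C * ((pw y)^-1 * (pw xi)^-1)) ->
  (forall y xi, cmod (pderiv j (W y) xi) <= C * ((pw y)^-1 * (pw xi)^-1)) ->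
  Cmeas (fun p : n.-tuple T * n.-tuple T => pderiv j (W (vec p.1)) (vec p.2)) ->
  int_R2n (fun y xi => pderiv j (W y) xi) = 0.
Proof.
move=> C0 sW W1 W2 mW.
have I0 y : Cint (mu n) (fun t => pderiv j (W y) (vec t)) /\
   int_Rn (pderiv j (W y)) = 0.
  have C'0 : 0 <= C * (pw y)^-1 by rewrite mulr_ge0// invr_ge0 ltW ?pw_gt0.
  have d1 : L1dom (W y) (C * (pw y)^-1).
    by move=> xi; rewrite (le_trans (W1 y xi))// mulrA.
  have d2 : L1dom (pderiv j (W y)) (C * (pw y)^-1).
    by move=> xi; rewrite (le_trans (W2 y xi))// mulrA.
  split; last exact: int_Rn_pderiv0 C'0 (sW y) d1 d2.
  exact: L1dom_Cint (smooth_ccont (smooth_pderiv j (sW y))) d2.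
have [i1 i2] := CintP mW (integrable_pwV2 n C) (fun p => W2 _ _).
apply: ceq; rewrite /int_R2n /Cintegral /=.
  apply: (Rintegral_prod0 i1); right => s1; have [[h1 _] h2] := I0 (vec s1).
  by split; [exact: h1|move: h2 => /(congr1 (@complex.Re R))].
apply: (Rintegral_prod0 i2); right => s1; have [[_ h1] h2] := I0 (vec s1).
by split; [exact: h1|move: h2 => /(congr1 (@complex.Im R))].
Qed.

End integration_on_Rn.

(** * Rapid decrease and Taylor expansion *)

Section multi_indices.
Variable R : realType.

(** The multi-index spelled out as a word in the variables, so that [mderiv] becomes an iterated
    [pderiv] along a sequence. *)
Definition mseq k N (j : 'I_k -> 'I_N) (alpha : {ffun 'I_k -> nat}) : seq 'I_N :=
  flatten [seq nseq (alpha i) (j i) | i <- enum 'I_k].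

Lemma mderivE k N (j : 'I_k -> 'I_N) alpha (f : 'rV[R]_N -> R[i]) :
  mderiv j alpha f = foldr (@pderiv R N) f (mseq j alpha).
Proof.
rewrite /mderiv /mseq; elim: (enum 'I_k) => [|i l IH]; first by [].
rewrite [LHS]/= [flatten _]/= foldr_cat -IH.
by elim: (alpha i) => [|m IHm]; [reflexivity|rewrite [LHS]/= IHm].
Qed.

Lemma count_mseq k N (j : 'I_k -> 'I_N) (alpha : {ffun 'I_k -> nat}) v :
  count_mem v (mseq j alpha) = (\sum_i (j i == v) * alpha i)%N.
Proof.
rewrite /mseq count_flatten sumnE !big_map -enumT big_enum /=.
by apply: eq_bigr => i _; rewrite count_nseq.
Qed.

Lemma mseq_perm N (s : seq 'I_N) : exists alpha, perm_eq s (mseq id alpha).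
Proof.
exists [ffun i => count_mem i s]; apply/allP => v _ /=; apply/eqP.
rewrite count_mseq (bigD1 v)//= eqxx mul1n ffunE big1 ?addn0// => i iv.
by rewrite (negbTE iv).
Qed.

Lemma mpow_pw N (x : 'rV[R]_N) alpha : `|mpow x alpha| <= pw x ^+ mlen alpha.
Proof.
rewrite /mpow normr_prod.
apply: (@le_trans _ _ (\prod_i pw x ^+ alpha i)).
  apply: prod_le => i; rewrite normr_ge0 normrX.
  by apply: lerXn2r; rewrite ?nnegrE ?(ltW (pw_gt0 _))// coord_le_pw.
by rewrite prodrXr.
Qed.

Section rapid.
Variables (I : Type) (N : nat) (w : I -> R).
Hypothesis w0 : forall i, 0 <= w i.
Implicit Type F : I -> 'rV[R]_N -> R[i].

(** With [w = 1] this is the Schwartz condition. With [w] a power of eps, required for every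
    exponent, it is the condition of [N_S]; see [schwartzP] and [N_SP]. *)
Definition rapid F := forall k L, bdn L F (fun i x => w i * pw x ^- k).

Lemma rapid_mpow F alpha beta : rapid F -> exists2 c : R, 0 <= c & forall i x,
  cmod ((mpow x alpha)%:C * mderiv id beta (F i) x) <= c * w i.
Proof.
move=> rF.
have [c c0 H] := bdn_foldr (leqnn _) (rF (mlen alpha) (size (mseq id beta))).
exists c => // i x; rewrite mderivE cmodM cmod_real.
apply: (le_trans (ler_pM (normr_ge0 _) (cmod_ge0 _) (mpow_pw x alpha) (H i x))).
rewrite le_eqVlt; apply/orP; left; apply/eqP; field.
by rewrite gt_eqF ?pwX_gt0.
Qed.

(** Control after multiplication by every monomial. Unlike a bound for one fixed monomial, this is
    stable under multiplication by [1 + x 0 j ^+ 2], hence by any power of [pw]. *)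
Let bmon (g : I -> 'rV[R]_N -> R) := forall alpha, exists2 c : R, 0 <= c &
  forall i x, `|mpow x alpha| * g i x <= c * w i.

Let bmon_sq g j : bmon g -> bmon (fun i x => (1 + x 0 j ^+ 2) * g i x).
Proof.
move=> H alpha; have [c c0 Hc] := H alpha.
have [d d0 Hd] := H [ffun l => alpha l + 2 * (l == j)]%N.
exists (c + d) => [|i x]; first exact: addr_ge0.
rewrite mulrDl mul1r mulrDr mulrDl lerD//.
apply: le_trans (Hd i x); rewrite mulrA.
rewrite (_ : mpow x [ffun _ => _] = mpow x alpha * x 0 j ^+ 2).
  by rewrite normrM normrX real_normK ?num_real.
rewrite /mpow; under eq_bigr do rewrite ffunE exprD.
rewrite big_split /=; congr (_ * _).
by rewrite (bigD1 j)//= eqxx muln1 big1 ?mulr1// => l lj; rewrite (negbTE lj).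
Qed.

Let bmon_pw g : bmon g -> bmon (fun i x => pw x * g i x).
Proof.
move=> H; rewrite /pw.
suff K (r : seq 'I_N) : bmon (fun i x => \prod_(j <- r) (1 + x 0 j ^+ 2) * g i x).
  exact: K.
elim: r => [|j r IH].
  move=> alpha; have [c c0 Hc] := H alpha; exists c => // i x.
  by rewrite big_nil mul1r.
move=> alpha; have [c c0 Hc] := bmon_sq j IH alpha; exists c => // i x.
by rewrite big_cons -[X in _ * X]mulrA; exact: Hc.
Qed.

Lemma mpow_rapid F : sfam F ->
  (forall alpha beta, exists c : R, forall i x,
    cmod ((mpow x alpha)%:C * mderiv id beta (F i) x) <= c * w i) -> rapid F.
Proof.
move=> sF H k L; apply: foldr_bdn => s _.
have [beta Hb] := mseq_perm s.
have B0 : bmon (fun i x => cmod (foldr (@pderiv R N) (F i) s x)).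
  move=> alpha; have [c Hc] := H alpha beta; exists (Num.max c 0).
    by rewrite le_max lexx orbT.
  move=> i x; rewrite -cmod_real -cmodM (foldr_pderiv_perm (sF i) Hb) -mderivE.
  by rewrite (le_trans (Hc i x))// ler_wpM2r// le_max lexx.
have Bk : bmon (fun i x => pw x ^+ k * cmod (foldr (@pderiv R N) (F i) s x)).
  elim: k => [|k IH]; first by under eq_fun do under eq_fun do rewrite expr0 mul1r.
  move=> alpha; have [c c0 Hc] := bmon_pw IH alpha; exists c => // i x.
  by rewrite exprS -[X in _ * X]mulrA.
have [c c0 Hc] := Bk [ffun=> 0%N].
exists c => // i x; have := Hc i x.
rewrite (_ : mpow x _ = 1); last by apply: big1 => l _; rewrite ffunE expr0.
rewrite normr1 mul1r mulrA => h.
by rewrite ler_pdivlMr ?pwX_gt0// mulrC.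
Qed.

End rapid.

Definition rapid1 N (f : 'rV[R]_N -> R[i]) := rapid (fun _ : unit => 1) (fun _ => f).

Lemma schwartzP N (f : 'rV[R]_N -> R[i]) : schwartz f <-> smooth f /\ rapid1 f.
Proof.
split=> [[sf H]|[sf rf]]; split; try exact: sf.
  apply: mpow_rapid => //; try (by move=> _; exact: sf).
  by move=> alpha beta; have [c Hc] := H alpha beta; exists c => _ x; rewrite mulr1.
move=> alpha beta; have [c c0 Hc] := rapid_mpow alpha beta rf; exists c => x.
by have := Hc tt x; rewrite mulr1.
Qed.

Lemma rapid1_bound N (f : 'rV[R]_N -> R[i]) s k : rapid1 f ->
  exists2 c : R, 0 <= c & forall x, cmod (foldr (@pderiv R N) f s x) <= c * pw x ^- k.
Proof.
move=> rf; have [c c0 Hc] := bdn_foldr (leqnn _) (rf k (size s)).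
by exists c => // x; have := Hc tt x; rewrite mul1r.
Qed.

End multi_indices.

(** * Taylor's formula for complex-valued functions *)

Section taylor.
Variables (R : realType) (n : nat).
Implicit Types (chi : 'rV[R]_n -> R[i]) (z y : 'rV[R]_n).

(** The operator z . grad: its k-th iterate at 0, divided by k!, is the k-th term of the Taylor
    expansion at 0 evaluated at [z]. *)
Definition dirop z chi : 'rV[R]_n -> R[i] :=
  fun y => \sum_i (z 0 i)%:C * pderiv i chi y.

Lemma smooth_dirop z chi : smooth chi -> smooth (dirop z chi).
Proof. by move=> s; apply: smooth_sum => i; apply/smoothZ/smooth_pderiv. Qed.

Lemma smooth_iter_dirop q z chi : smooth chi -> smooth (iter q (dirop z) chi).
Proof. by move=> s; elim: q => [|q IH]; [exact: s|exact: smooth_dirop]. Qed.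

Lemma pderiv_sum N (j : 'I_N) (J : Type) (r : seq J) (F : J -> 'rV[R]_N -> R[i]) :
  (forall i, smooth (F i)) ->
  pderiv j (fun x => \sum_(i <- r) F i x) = fun x => \sum_(i <- r) pderiv j (F i) x.
Proof.
move=> sF; elim: r => [|i r IH].
  rewrite (_ : (fun x => _) = fun=> 0); last by apply/funext => x; rewrite big_nil.
  by rewrite pderiv_cst; apply/funext => x; rewrite big_nil.
rewrite (_ : (fun x => _) = fun x => F i x + \sum_(i <- r) F i x); last first.
  by apply/funext => x; rewrite big_cons.
rewrite pderivD; [|exact: sF|by apply: smooth_sum].
by rewrite IH; apply/funext => x; rewrite big_cons.
Qed.

(** Extracts the innermost derivative, so that inductions on the order can replace [chi] by
    [pderiv i chi]. *)
Lemma iter_dirop q z chi : smooth chi -> iter q.+1 (dirop z) chi =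
  fun y => \sum_i (z 0 i)%:C * iter q (dirop z) (pderiv i chi) y.
Proof.
move=> s; elim: q => [|q IH]; first by [].
rewrite iterS IH /dirop; apply/funext => y.
have s1 i : smooth (fun y => (z 0 i)%:C * iter q (dirop z) (pderiv i chi) y).
  exact/smoothZ/smooth_iter_dirop/smooth_pderiv.
under eq_bigr do rewrite pderiv_sum//.
under eq_bigr do rewrite mulr_sumr.
rewrite exchange_big /=; apply: eq_bigr => i _.
rewrite mulr_sumr; apply: eq_bigr => j _.
rewrite pderivZ; last exact/smooth_iter_dirop/smooth_pderiv.
by rewrite mulrCA.
Qed.

Lemma cmod_sum (J : Type) (r : seq J) (F : J -> R[i]) :
  cmod (\sum_(i <- r) F i) <= \sum_(i <- r) cmod (F i).
Proof.
elim: r => [|i r IH]; first by rewrite !big_nil cmod0.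
by rewrite !big_cons (le_trans (cmodD _ _))// lerD2l.
Qed.

Lemma iter_dirop_bound q z chi (a B : R) y : 0 <= a -> smooth chi ->
  (forall i, `|z 0 i| <= a) ->
  (forall s, size s = q -> cmod (foldr (@pderiv R n) chi s y) <= B) ->
  cmod (iter q (dirop z) chi y) <= (n%:R * a) ^+ q * B.
Proof.
move=> a0 + za; elim: q chi => [|q IH] chi sc HB.
  by rewrite expr0 mul1r; exact: (HB [::]).
rewrite (iter_dirop q z sc) (le_trans (cmod_sum _ _))//.
apply: (@le_trans _ _ (\sum_(i < n) a * ((n%:R * a) ^+ q * B))).
  apply: ler_sum => i _; rewrite cmodM cmod_real ler_pM// ?cmod_ge0//.
  apply: IH => [|s sq]; first exact: smooth_pderiv.
  by have := HB (rcons s i); rewrite size_rcons sq -cats1 foldr_cat; exact.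
by rewrite sumr_const card_ord -[X in X <= _]mulr_natl exprS !mulrA.
Qed.

Definition cder1 (g : R -> R[i]) (t : R) (d : R[i]) :=
  is_derive t (1 : R) (fun s => complex.Re (g s)) (complex.Re d) /\
  is_derive t (1 : R) (fun s => complex.Im (g s)) (complex.Im d).

(** The mean value theorem in equality form fails for complex values; applying it to real and
    imaginary parts costs a factor 2. *)
Lemma cder1_bound (g dg : R -> R[i]) (K : R) : (forall t, cder1 g t (dg t)) ->
  (forall t, 0 <= t <= 1 -> cmod (dg t) <= K) ->
  forall t, 0 <= t <= 1 -> cmod (g t - g 0) <= 2 * K.
Proof.
move=> dgP HK t /andP[t0 t1].
have main (p dp : R -> R) : (forall s, is_derive s (1 : R) p (dp s)) ->
    (forall s, 0 <= s <= 1 -> `|dp s| <= K) -> `|p t - p 0| <= K.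
  move=> dpP HdK.
  have [|c] := @MVT_segment _ p dp _ _ t0 (fun s _ => dpP s).
    by apply: derivable_within_continuous => s _; have [] := dpP s.
  rewrite in_itv /= => /andP[c0 ct] ->; rewrite subr0 normrM (ger0_norm t0).
  have h := HdK c; rewrite c0 (le_trans ct)// in h.
  by rewrite (le_trans (ler_piMr _ t1))// h.
rewrite (le_trans (cmod_le _))// mulr_natl mulr2n lerD//.
  rewrite cReD cReN; apply: (main (fun s => complex.Re (g s)) (fun s => complex.Re (dg s))).
    by move=> s; exact: (dgP s).1.
  by move=> s /HK h; rewrite (le_trans (cmod_Re _)).
rewrite cImD cImN; apply: (main (fun s => complex.Im (g s)) (fun s => complex.Im (dg s))).
  by move=> s; exact: (dgP s).2.
by move=> s /HK h; rewrite (le_trans (cmod_Im _)).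
Qed.

Lemma cder1_line chi z t : smooth chi ->
  cder1 (fun s => chi (s *: z)) t (dirop z chi (t *: z)).
Proof.
move=> sc; have [h1 h2] := smooth_dir (0 + t *: z) z sc; rewrite add0r in h1 h2.
split.
  have := proj2 (derive_lineE (fun y => complex.Re (chi y)) 0 z t _).
  by rewrite add0r => /(_ _ h1); under eq_fun do rewrite add0r.
have := proj2 (derive_lineE (fun y => complex.Im (chi y)) 0 z t _).
by rewrite add0r => /(_ _ h2); under eq_fun do rewrite add0r.
Qed.

Lemma cder1B (g h : R -> R[i]) t dg dh : cder1 g t dg -> cder1 h t dh ->
  cder1 (fun s => g s - h s) t (dg - dh).
Proof.
move=> [g1 g2] [h1 h2]; split.
  rewrite (_ : (fun s => _) = (fun s => complex.Re (g s)) - (fun s => complex.Re (h s))).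
    by rewrite cReD cReN; exact: is_deriveB.
  by apply/funext => s; rewrite cReD cReN.
rewrite (_ : (fun s => _) = (fun s => complex.Im (g s)) - (fun s => complex.Im (h s))).
  by rewrite cImD cImN; exact: is_deriveB.
by apply/funext => s; rewrite cImD cImN.
Qed.

Lemma cder1_poly q (c : nat -> R[i]) t :
  cder1 (fun s => \sum_(k < q.+1) (s ^+ k / k`!%:R)%:C * c k) t
    (\sum_(k < q) (t ^+ k / k`!%:R)%:C * c k.+1).
Proof.
have RS m (F : 'I_m -> R[i]) : complex.Re (\sum_i F i) = \sum_i complex.Re (F i).
  by elim/big_rec2 : _ => // i y1 y2 _; rewrite cReD => ->.
have IS m (F : 'I_m -> R[i]) : complex.Im (\sum_i F i) = \sum_i complex.Im (F i).
  by elim/big_rec2 : _ => // i y1 y2 _; rewrite cImD => ->.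
have dmon k (b : R) : is_derive t (1 : R) (fun s => s ^+ k.+1 / k.+1`!%:R * b)
    (t ^+ k / k`!%:R * b).
  have H : is_derive t (1 : R) (fun s : R => s ^+ k.+1) (k.+1%:R * t ^+ k).
    by split; [exact: exprn_derivable|rewrite -derive1E exp_derive1].
  have := is_deriveZ (b / k.+1`!%:R) H.
  rewrite [X in is_derive _ _ X _](_ : _ = fun s => s ^+ k.+1 / k.+1`!%:R * b); last first.
    by apply/funext => s; rewrite -[LHS]/(b / k.+1`!%:R * s ^+ k.+1); ring.
  move=> K; apply: is_derive_eq K _; rewrite /GRing.scale/= factS natrM.
  have k1 : k.+1%:R != 0 :> R by rewrite pnatr_eq0.
  have k2 : k`!%:R != 0 :> R by rewrite pnatr_eq0 -lt0n fact_gt0.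
  by move: (k.+1%:R : R) (k`!%:R : R) (t ^+ k) k1 k2 => c1 e u c0 e0; field; rewrite c0 e0.
have main (p : R[i] -> R) : is_derive t (1 : R)
   (fun s => \sum_(k < q.+1) (s ^+ k / k`!%:R) * p (c k))
   (\sum_(k < q) (t ^+ k / k`!%:R) * p (c k.+1)).
  rewrite (_ : (fun s => _) = cst (p (c 0%N)) +
     \sum_(k < q) (fun s => s ^+ k.+1 / k.+1`!%:R * p (c k.+1))); last first.
    apply/funext => s; rewrite big_ord_recl expr0 fact0 divr1 mul1r.
    by rewrite fctE fct_sumE.
  rewrite -[X in is_derive _ _ _ X]add0r; have Hs : is_derive t (1 : R)
      (\sum_(k < q) (fun s => s ^+ k.+1 / k.+1`!%:R * p (c k.+1)))
      (\sum_(k < q) (t ^+ k / k`!%:R * p (c k.+1))).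
    by apply: is_derive_sum => k; exact: dmon.
  exact: is_deriveD.
split.
  rewrite (_ : (fun s => _) =
    (fun s => \sum_(k < q.+1) (s ^+ k / k`!%:R) * complex.Re (c k))); last first.
    by apply/funext => s; rewrite RS; apply: eq_bigr => k _; rewrite cReM /= mul0r subr0.
  rewrite RS; apply: is_derive_eq (main (@complex.Re R)) _.
  by apply: eq_bigr => k _; rewrite cReM /= mul0r subr0.
rewrite (_ : (fun s => _) =
  (fun s => \sum_(k < q.+1) (s ^+ k / k`!%:R) * complex.Im (c k))); last first.
  by apply/funext => s; rewrite IS; apply: eq_bigr => k _; rewrite cImM /= mul0r addr0.
rewrite IS; apply: is_derive_eq (main (@complex.Im R)) _.
by apply: eq_bigr => k _; rewrite cImM /= mul0r addr0.
Qed.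

(** The derivative in [t] of the remainder of order [q.+1] for [chi] is the remainder of order [q]
    for [dirop z chi], and the former vanishes at [t = 0]. Each use of [cder1_bound] contributes one
    factor of [2 ^+ q]. *)
Lemma taylor_bound z q chi (K : R) : smooth chi ->
  (forall t, 0 <= t <= 1 -> cmod (iter q (dirop z) chi (t *: z)) <= K) ->
  forall t, 0 <= t <= 1 ->
  cmod (chi (t *: z) - \sum_(k < q) (t ^+ k / k`!%:R)%:C * iter k (dirop z) chi 0)
    <= 2 ^+ q * K.
Proof.
elim: q chi => [|q IH] chi sc HK t t01.
  by rewrite big_ord0 subr0 expr0 mul1r; exact: HK.
pose g (t : R) := chi (t *: z) -
  \sum_(k < q.+1) (t ^+ k / k`!%:R)%:C * iter k (dirop z) chi 0.
pose dg (t : R) := dirop z chi (t *: z) -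
  \sum_(k < q) (t ^+ k / k`!%:R)%:C * iter k.+1 (dirop z) chi 0.
have g0 : g 0 = 0.
  rewrite /g big_ord_recl expr0 fact0 divr1 mul1r scale0r big1 ?addr0 ?subrr// => k _.
  by rewrite exprS !mul0r.
have dgP s : cder1 g s (dg s).
  exact: cder1B (cder1_line z s sc) (cder1_poly q (fun k => iter k (dirop z) chi 0) s).
have dgK s : 0 <= s <= 1 -> cmod (dg s) <= 2 ^+ q * K.
  move=> s01; rewrite /dg.
  under eq_bigr do rewrite iterSr.
  apply: (IH _ (smooth_dirop z sc) _ _ s01).
  by move=> r r01; rewrite -iterSr; exact: HK.
have := cder1_bound dgP dgK t01.
by rewrite g0 subr0 exprS -mulrA.
Qed.

End taylor.

(** * Consequences of the vanishing moments *)

Section moments.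
Variables (R : realType) (n : nat) (phi : 'rV[R]_n -> R[i]).
Hypotheses (sphi : smooth phi) (rphi : rapid1 phi).
Hypothesis mphi : forall alpha : {ffun 'I_n -> nat}, alpha != [ffun=> 0%N] ->
  int_Rn (fun x => (mpow x alpha)%:C * phi x) = 0.
Local Notation T := (measurableTypeR R).
Local Notation mu := (lebesgue_tuple R n).

(** Continuity and polynomial growth are what makes the product with the rapidly decreasing [phi]
    integrable. *)
Definition slow (g : 'rV[R]_n -> R[i]) := ccont g /\
  exists2 B : R, 0 <= B & exists M, forall z, cmod (g z) <= B * pw z ^+ M.

Lemma pw_absorb (B C : R) M k (x : 'rV[R]_n) :
  (B * pw x ^+ M) * (C * pw x ^- (M + k)) = B * C * pw x ^- k.
Proof.
rewrite mulrACA; congr (_ * _); rewrite exprD invfM mulrA mulfV ?mul1r//.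
by rewrite gt_eqF ?pwX_gt0.
Qed.

Lemma slow_L1 g : slow g -> exists2 C : R, 0 <= C & L1dom (fun z => g z * phi z) C.
Proof.
move=> [_ [B B0 [M HB]]].
have [C C0 HC] := rapid1_bound [::] (M + 1) rphi.
exists (B * C) => [|z]; first exact: mulr_ge0.
rewrite cmodM -[X in _ * X^-1]expr1 -(pw_absorb _ _ M).
by apply: ler_pM (HB z) (HC z); exact: cmod_ge0.
Qed.

Lemma slow_Cint g : slow g -> Cint mu (fun t => g (vec t) * phi (vec t)).
Proof.
move=> sg; have [C C0 HC] := slow_L1 sg.
exact: (L1dom_Cint (ccontM sg.1 (smooth_ccont sphi)) HC).
Qed.

Lemma slowD g h : slow g -> slow h -> slow (fun z => g z + h z).
Proof.
move=> [cg [B B0 [M HB]]] [ch [D D0 [L HD]]]; split; first exact: ccontD.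
exists (B + D); first exact: addr_ge0.
exists (M + L)%N => z; rewrite (le_trans (cmodD _ _))// mulrDl lerD//.
  by rewrite (le_trans (HB z))// ler_wpM2l// pwX_mono ?leq_addr.
by rewrite (le_trans (HD z))// ler_wpM2l// pwX_mono ?leq_addl.
Qed.

Lemma slow_cst c : slow (fun=> c).
Proof.
split; first exact: ccont_cst.
by exists (cmod c); [exact: cmod_ge0|exists 0%N => z; rewrite expr0 mulr1].
Qed.

Lemma slow_mono c alpha : slow (fun z => c * (mpow z alpha)%:C).
Proof.
split.
  have : smooth (fun z : 'rV[R]_n => c * (mpow z alpha)%:C).
    apply/smoothZ; rewrite /mpow.
    suff H (r : seq 'I_n) : smooth (fun z : 'rV[R]_n => (\prod_(i <- r) z 0 i ^+ alpha i)%:C).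
      exact: H.
    elim: r => [|i r IH].
      rewrite (_ : (fun z => _) = fun=> 1); first exact: smooth_cst.
      by apply/funext => z; rewrite big_nil.
    rewrite (_ : (fun z => _) = fun z : 'rV[R]_n =>
       (z 0 i ^+ alpha i)%:C * (\prod_(i <- r) z 0 i ^+ alpha i)%:C); last first.
      by apply/funext => z; rewrite big_cons rmorphM.
    apply: smoothM IH; elim: (alpha i) => [|m IHm].
      rewrite (_ : (fun z => _) = fun=> 1); first exact: smooth_cst.
      by apply/funext => z; rewrite expr0.
    rewrite (_ : (fun z => _) = fun z : 'rV[R]_n => (z 0 i)%:C * (z 0 i ^+ m)%:C); last first.
      by apply/funext => z; rewrite exprS rmorphM.
    by apply: smoothM IHm; exact: smooth_coord.
  by move=> h; exact: smooth_ccont h.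
exists (cmod c); first exact: cmod_ge0.
by exists (mlen alpha) => z; rewrite cmodM cmod_real ler_wpM2l ?cmod_ge0// mpow_pw.
Qed.

(** Polynomials without constant term, which integrate to 0 against [phi] by the moment conditions.
    The inductive form reduces this to monomials. *)
Inductive poly0 : ('rV[R]_n -> R[i]) -> Prop :=
| poly0_mono c alpha : alpha != [ffun=> 0%N] -> poly0 (fun z => c * (mpow z alpha)%:C)
| poly0_0 : poly0 (fun=> 0)
| poly0D p q : poly0 p -> poly0 q -> poly0 (fun z => p z + q z).

Lemma poly0_slow p : poly0 p -> slow p.
Proof. by elim => [c alpha _||p1 p2 _ h1 _ h2]; [exact: slow_mono|exact: slow_cst|exact: slowD]. Qed.

Lemma poly0_moment p : poly0 p -> int_Rn (fun z => p z * phi z) = 0.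
Proof.
elim => [c alpha a0||p1 p2 q1 h1 q2 h2].
- have sm : slow (fun z => (mpow z alpha)%:C).
    have := slow_mono 1 alpha; congr slow; apply/funext => z; exact: mul1r.
  have := CintegralZ c (slow_Cint sm).
  rewrite -[X in _ = _ * X]/(int_Rn (fun z => (mpow z alpha)%:C * phi z)) mphi// mulr0.
  by move=> <-; congr Cintegral; apply/funext => t; rewrite mulrA.
- have := CintegralZ 0 (slow_Cint (slow_cst 0)); rewrite mul0r; apply: etrans.
  by congr Cintegral; apply/funext => t; rewrite !mul0r.
- have := CintegralD (slow_Cint (poly0_slow q1)) (slow_Cint (poly0_slow q2)).
  rewrite -[X in _ = X + _]/(int_Rn (fun z => p1 z * phi z)) h1 add0r.
  rewrite -[X in _ = X]/(int_Rn (fun z => p2 z * phi z)) h2 => <-.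
  by congr Cintegral; apply/funext => t; rewrite mulrDl.
Qed.

Lemma poly0_scale (e : R) p : poly0 p -> poly0 (fun z => p (e *: z)).
Proof.
elim => [c alpha a0||p1 p2 q1 h1 q2 h2]; [|exact: poly0_0|exact: poly0D].
have := poly0_mono (c * (\prod_i e ^+ alpha i)%:C) a0; congr poly0.
apply/funext => z; rewrite -mulrA -rmorphM; congr (_ * _%:C).
by rewrite /mpow -big_split; apply: eq_bigr => i _; rewrite mxE exprMn.
Qed.

Lemma poly0Z c p : poly0 p -> poly0 (fun z => c * p z).
Proof.
elim => [d alpha a0||p1 p2 q1 h1 q2 h2].
- by have := poly0_mono (c * d) a0; congr poly0; apply/funext => z; rewrite mulrA.
- by have := poly0_0; congr poly0; apply/funext => z; rewrite mulr0.
- by have := poly0D h1 h2; congr poly0; apply/funext => z; rewrite mulrDr.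
Qed.

Lemma poly0_sum (J : Type) (r : seq J) (p : J -> 'rV[R]_n -> R[i]) :
  (forall j, poly0 (p j)) -> poly0 (fun z => \sum_(j <- r) p j z).
Proof.
move=> H; elim: r => [|j r IH].
  by have := poly0_0; congr poly0; apply/funext => z; rewrite big_nil.
by have := poly0D (H j) IH; congr poly0; apply/funext => z; rewrite big_cons.
Qed.

(** The extra monomial makes the induction work: each application of [dirop z] releases a factor
    [z 0 i], which is collected in [alpha]. *)
Lemma poly0_iter_dirop k chi alpha : smooth chi ->
  (alpha != [ffun=> 0%N]) || (0 < k)%N ->
  poly0 (fun z => (mpow z alpha)%:C * iter k (dirop z) chi 0).
Proof.
elim: k chi alpha => [|k IH] chi alpha sc.
  rewrite ltnn orbF => a0; have := poly0_mono (chi 0) a0.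
  by congr poly0; apply/funext => z; rewrite mulrC.
move=> _.
pose ad i : {ffun 'I_n -> nat} := [ffun l => alpha l + (l == i)]%N.
have ad0 i : ad i != [ffun=> 0%N].
  by apply/eqP => /ffunP/(_ i); rewrite !ffunE eqxx addn1.
have : poly0 (fun z => \sum_i (mpow z (ad i))%:C * iter k (dirop z) (pderiv i chi) 0).
  by apply: poly0_sum => i; apply: IH; [exact: smooth_pderiv|rewrite ad0].
congr poly0; apply/funext => z; rewrite iter_dirop// mulr_sumr; apply: eq_bigr => i _.
rewrite mulrA; congr (_ * _); rewrite -rmorphM; congr (_%:C).
rewrite /mpow; under eq_bigr do rewrite ffunE exprD.
rewrite big_split /=; congr (_ * _).
by rewrite (bigD1 i)//= eqxx expr1 big1 ?mulr1// => l lj; rewrite (negbTE lj).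
Qed.

(** The non-constant Taylor terms integrate to 0, so only the remainder is left. [K] depends on
    neither [chi] nor [e]: the lemma will be applied to functions [chi] depending on a parameter. *)
Lemma moment_bound q M : exists2 K : R, 0 <= K & forall chi (B e : R), smooth chi ->
  slow chi -> 0 <= B -> 0 < e <= 1 ->
  (forall s z, size s = q.+1 -> cmod (foldr (@pderiv R n) chi s z) <= B * pw z ^+ M) ->
  cmod (int_Rn (fun z => chi (e *: z) * phi z) - chi 0 * int_Rn phi) <= K * e ^+ q.+1 * B.
Proof.
(* Of these powers, [q.+1] absorb the factor from the Taylor remainder, [M] the growth of the
   derivatives, and the last one leaves an integrable weight. *)
have [C C0 HC] := rapid1_bound [::] (q.+1 + M + 1) rphi.
pose I := \int[mu]_t (pw (vec t))^-1.
have I0 : 0 <= I by apply: Rintegral_ge0 => t _; rewrite invr_ge0 ltW ?pw_gt0.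
(* The leading 2 is that of [Cintegral_le], [2 ^+ q.+1] that of [taylor_bound], and [n%:R ^+ q.+1]
   counts the terms of the iterated [dirop]. *)
exists (2 * (2 ^+ q.+1 * n%:R ^+ q.+1 * C * I)).
  by rewrite !mulr_ge0// ?exprn_ge0.
move=> chi B e sc slc B0 /andP[e0 e1] HB.
pose p (w : 'rV[R]_n) : R[i] := \sum_(k < q) (k.+1`!%:R^-1)%:C * iter k.+1 (dirop w) chi 0.
have pp : poly0 p.
  apply: poly0_sum => k; apply: poly0Z.
  have := @poly0_iter_dirop k.+1 chi [ffun=> 0%N] sc (orbT _); congr poly0.
  apply/funext => z; rewrite [mpow _ _](_ : _ = 1) ?mul1r//.
  by apply: big1 => i _; rewrite ffunE expr0.
have remainder z : cmod (chi (e *: z) - chi 0 - p (e *: z)) <=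
    2 ^+ q.+1 * ((n%:R * (e * pw z)) ^+ q.+1 * (B * pw z ^+ M)).
  have nt t : 0 <= t <= 1 -> `|t * e| <= 1.
    move=> /andP[t0 t1]; rewrite ger0_norm ?mulr_ge0 ?(ltW e0)//.
    by rewrite mulr_ile1 ?(ltW e0).
  have := @taylor_bound R n (e *: z) q.+1 chi
    ((n%:R * (e * pw z)) ^+ q.+1 * (B * pw z ^+ M)) sc _ 1 _.
  rewrite big_ord_recl scale1r expr0 fact0 divr1 mul1r opprD addrA.
  rewrite (_ : \sum_(k < q) _ = p (e *: z)); last first.
    by apply: eq_bigr => k _; rewrite expr1n mul1r.
  apply; last by rewrite ler01 lexx.
  move=> t t01; apply: iter_dirop_bound => //.
  - by rewrite mulr_ge0 ?(ltW e0) ?(ltW (pw_gt0 _)).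
  - by move=> i; rewrite mxE normrM (gtr0_norm e0) ler_wpM2l ?(ltW e0)// coord_le_pw.
  - move=> s ss; rewrite (le_trans (HB _ _ ss))// ler_wpM2l//.
    rewrite scalerA; apply: lerXn2r; rewrite ?nnegrE ?(ltW (pw_gt0 _))//.
    exact/pw_scale/nt.
have slce : slow (fun z => chi (e *: z)).
  have [cc [B1 B10 [M1 H1]]] := slc; split.
    rewrite (_ : (fun z => _) = fun z : 'rV[R]_n => chi (z *m e%:M + 0)); last first.
      by apply/funext => z; rewrite addr0 mul_mx_scalar.
    exact: ccont_comp (@affine_continuous _ _ _ _ _) cc.
  exists B1 => //; exists M1 => z; rewrite (le_trans (H1 _))// ler_wpM2l//.
  apply: lerXn2r; rewrite ?nnegrE ?(ltW (pw_gt0 _))//.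
  by apply: pw_scale; rewrite gtr0_norm.
have sp := poly0_slow (poly0_scale e pp).
have slN g : slow g -> slow (fun z => - g z).
  move=> [cg [B1 B10 [M1 H1]]]; split.
    have := ccontM (@ccont_cst R n (-1)) cg; congr ccont; apply/funext => z; exact: mulN1r.
  by exists B1 => //; exists M1 => z; rewrite cmodN.
have E : int_Rn (fun z => chi (e *: z) * phi z) - chi 0 * int_Rn phi =
    int_Rn (fun z => (chi (e *: z) - chi 0 - p (e *: z)) * phi z).
  have e1' := CintegralD (slow_Cint slce) (slow_Cint (slN _ (slow_cst (chi 0)))).
  have e2 := CintegralD (slow_Cint (slowD slce (slN _ (slow_cst (chi 0))))) (slow_Cint (slN _ sp)).
  have e3 : Cintegral mu (fun t => - p (e *: vec t) * phi (vec t)) = 0.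
    have := poly0_moment (poly0_scale e (poly0Z (-1) pp)) => <-.
    by rewrite /int_Rn; congr Cintegral; apply/funext => t; rewrite mulN1r.
  have e4 : Cintegral mu (fun t => - chi 0 * phi (vec t)) = - (chi 0 * int_Rn phi).
    rewrite CintegralZ ?mulNr//.
    have := slow_Cint (slow_cst 1); congr Cint; apply/funext => t; exact: mul1r.
  rewrite /int_Rn; symmetry.
  transitivity (Cintegral mu (fun t => (chi (e *: vec t) - chi 0) * phi (vec t) +
     - p (e *: vec t) * phi (vec t))).
    by congr Cintegral; apply/funext => t; rewrite -mulrDl.
  rewrite e2 e3 addr0.
  transitivity (Cintegral mu (fun t => chi (e *: vec t) * phi (vec t) +
     - chi 0 * phi (vec t))).
    by congr Cintegral; apply/funext => t; rewrite -mulrDl.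
  by rewrite e1' e4.
rewrite E.
pose D := 2 ^+ q.+1 * n%:R ^+ q.+1 * C * (e ^+ q.+1 * B).
have dom : L1dom (fun z => (chi (e *: z) - chi 0 - p (e *: z)) * phi z) D.
  move=> z; rewrite cmodM.
  apply: (le_trans (ler_pM (cmod_ge0 _) (cmod_ge0 _) (remainder z) (HC z))).
  have := pw_absorb (2 ^+ q.+1 * n%:R ^+ q.+1 * e ^+ q.+1 * B) C (q.+1 + M) 1 z.
  rewrite expr1 => h; rewrite le_eqVlt; apply/orP; left; apply/eqP.
  rewrite (_ : D * _ = 2 ^+ q.+1 * n%:R ^+ q.+1 * e ^+ q.+1 * B * C * (pw z)^-1).
    rewrite -h; congr (_ * _); rewrite !exprMn exprD.
    by move: (2 ^+ q.+1) (n%:R ^+ q.+1) (e ^+ q.+1) (pw z ^+ q.+1) => x1 x2 x3 x4; ring.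
  by rewrite /D; move: (2 ^+ q.+1) (n%:R ^+ q.+1) (e ^+ q.+1) => x1 x2 x3; ring.
have mF : Cmeas (fun t : n.-tuple T => (chi (e *: vec t) - chi 0 - p (e *: vec t)) * phi (vec t)).
  apply: (Cmeas_vec (f := fun z => (chi (e *: z) - chi 0 - p (e *: z)) * phi z)).
  apply: ccontM (smooth_ccont sphi).
  exact: (slowD (slowD slce (slN _ (slow_cst (chi 0)))) (slN _ sp)).1.
apply: (le_trans (Cintegral_le mF (integrable_CpwV n D) (fun t => dom (vec t)))).
rewrite RintegralZl//; last exact: integrable_pwV.
rewrite -/I /D le_eqVlt; apply/orP; left; apply/eqP.
by move: (2 ^+ q.+1) (n%:R ^+ q.+1) (e ^+ q.+1) => x1 x2 x3; ring.
Qed.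

End moments.

(** * Mollification *)

Section transform.
Variables (R : realType) (n : nat) (phi : 'rV[R]_n -> R[i]).
Hypotheses (sphi : smooth phi) (rphi : rapid1 phi).
Local Notation T := (measurableTypeR R).
Local Notation mu := (lebesgue_tuple R n).
Variable Psi : seq 'I_n -> 'rV[R]_n -> 'rV[R]_n -> R[i].
(* [Psi s] is the derivative [s] in [x] of the kernel [Psi [::]]. *)
Hypothesis Psi_der : forall s z x i,
  is_cder (Psi s ^~ z) x (delta_mx 0 i) (Psi (i :: s) x z).
Hypothesis Psi_cont : forall s z, ccont (Psi s ^~ z).
Hypothesis Psi_smooth : forall s x, smooth (Psi s x).
Hypothesis Psi_slow : forall s, exists2 C : R, 0 <= C & exists M, forall x z,
  cmod (Psi s x z) <= C * pw x ^+ M * pw z ^+ M.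

(** A family closed under differentiation proves smoothness and identifies all iterated derivatives
    at once. Thus integrals only ever need to be differentiated once, for an arbitrary [s]. *)
Lemma foldr_unique (g : seq 'I_n -> 'rV[R]_n -> R[i]) :
  (forall s, ccont (g s)) ->
  (forall s x i, is_cder (g s) x (delta_mx 0 i) (g (i :: s) x)) ->
  smooth (g [::]) /\ forall s, foldr (@pderiv R n) (g [::]) s = g s.
Proof.
move=> gc gd.
have E i s : pderiv i (g s) = g (i :: s).
  by apply/funext => x; rewrite pderivE (is_cder_cD (gd s x i)).
split; last by elim=> [|i s IH]; [by []|rewrite /= IH E].
apply: (@smooth_coind _ _ (fun h => exists s, h = g s)); last by exists [::].
move=> _ [s ->]; split; last by move=> i; exists (i :: s).
by split; [exact: gc|move=> x i; exact: is_cder_cder (gd s x i)].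
Qed.

Definition transf (e : R) s x := int_Rn (fun z => Psi s x (e *: z) * phi z).

Lemma slice_slow e s x : `|e| <= 1 -> slow (fun z => Psi s x (e *: z)).
Proof.
move=> e1; split.
  rewrite (_ : (fun z => _) = fun z : 'rV[R]_n => Psi s x (z *m e%:M + 0)); last first.
    by apply/funext => z; rewrite addr0 mul_mx_scalar.
  exact: ccont_comp (@affine_continuous _ _ _ _ _) (smooth_ccont (Psi_smooth s x)).
have [C C0 [M H]] := Psi_slow s.
exists (C * pw x ^+ M); first by rewrite mulr_ge0 ?pwX_ge0.
exists M => z; rewrite (le_trans (H _ _))// ler_wpM2l ?mulr_ge0 ?pwX_ge0//.
by apply: lerXn2r; rewrite ?nnegrE ?(ltW (pw_gt0 _))// pw_scale.
Qed.

Lemma transf_locdom e s : `|e| <= 1 ->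
  locdom mu (fun x (t : n.-tuple T) => Psi s x (e *: vec t) * phi (vec t)).
Proof.
move=> e1 x0; have [C C0 [M H]] := Psi_slow s.
have [D D0 HD] := rapid1_bound [::] (M + 1) rphi.
exists (fun t => C * (4 ^+ n * pw x0) ^+ M * D * (pw (vec t))^-1).
  exact: integrable_CpwV.
move=> x /pw_loc px t; rewrite cmodM -[X in _ * X^-1]expr1 -(pw_absorb _ _ M).
apply: ler_pM (cmod_ge0 _) (cmod_ge0 _) _ (HD _).
rewrite (le_trans (H _ _))// ler_pM ?mulr_ge0 ?pwX_ge0//.
  rewrite ler_wpM2l//; apply: lerXn2r; rewrite ?nnegrE ?(ltW (pw_gt0 _))//.
  by rewrite mulr_ge0 ?exprn_ge0// ltW ?pw_gt0.
by apply: lerXn2r; rewrite ?nnegrE ?(ltW (pw_gt0 _))// pw_scale.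
Qed.

Lemma transf_meas e s x : `|e| <= 1 ->
  Cmeas (fun t : n.-tuple T => Psi s x (e *: vec t) * phi (vec t)).
Proof.
move=> e1; apply: (Cmeas_vec (f := fun z => Psi s x (e *: z) * phi z)).
exact: ccontM (slice_slow s x e1).1 (smooth_ccont sphi).
Qed.

Lemma transf_foldr e : `|e| <= 1 ->
  smooth (transf e [::]) /\ forall s, foldr (@pderiv R n) (transf e [::]) s = transf e s.
Proof.
move=> e1; apply: foldr_unique => [s|s x i].
  apply: ccont_Cintegral; [|move=> t|exact: transf_locdom].
    by move=> x; exact: transf_meas.
  exact: (ccontM (Psi_cont s (e *: vec t)) (@ccont_cst R n (phi (vec t)))).
apply: (@is_cder_Cintegral _ _ _ mu _ (fun x t => Psi s x (e *: vec t) * phi (vec t))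
  (fun x t => Psi (i :: s) x (e *: vec t) * phi (vec t))).
- by move=> y; exact: transf_meas.
- move=> y t.
  have := is_cderM (Psi_der s (e *: vec t) y i) (is_cder_cst (phi (vec t)) y (delta_mx 0 i)).
  by rewrite mulr0 addr0.
- exact: transf_locdom.
- exact: transf_locdom.
Qed.

Lemma transf0_foldr : smooth (Psi [::] ^~ 0) /\
  forall s, foldr (@pderiv R n) (Psi [::] ^~ 0) s = Psi s ^~ 0.
Proof.
by apply: (@foldr_unique (fun s => Psi s ^~ 0)) => [s|s x i]; [exact: Psi_cont|exact: Psi_der].
Qed.

Hypothesis int_phi : int_Rn phi = 1.
Hypothesis mphi : forall alpha : {ffun 'I_n -> nat}, alpha != [ffun=> 0%N] ->
  int_Rn (fun x => (mpow x alpha)%:C * phi x) = 0.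

(** [W] records the behaviour in the outer variable: a negative power of [pw] for the convolution, a
    positive one for the Fourier transform of the mollifier. *)
Lemma transf_moment q (W : 'rV[R]_n -> R) (I : Type) (e : I -> R) :
  (forall x, 0 <= W x) -> (forall i, 0 < e i <= 1) ->
  (forall s, exists2 C : R, 0 <= C & exists M, forall r x z, size r = q.+1 ->
    cmod (foldr (@pderiv R n) (Psi s x) r z) <= C * W x * pw z ^+ M) ->
  forall L, bdn L (fun i x => transf (e i) [::] x - Psi [::] x 0)
    (fun i x => e i ^+ q.+1 * W x).
Proof.
move=> W0 e01 HB L; apply: foldr_bdn => s _.
have e1 i : `|e i| <= 1 by have /andP[h1 h2] := e01 i; rewrite gtr0_norm.
have [C C0 [M HM]] := HB s.
have [K K0 HK] := moment_bound sphi rphi mphi q M.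
exists (K * C); first exact: mulr_ge0.
move=> i x; have [s1 f1] := transf_foldr (e1 i); have [s2 f2] := transf0_foldr.
have -> : (fun x => transf (e i) [::] x - Psi [::] x 0) =
    (fun x => transf (e i) [::] x + (-1) * Psi [::] x 0).
  by apply/funext => y; rewrite mulN1r.
rewrite foldr_pderivD; [|exact: s1|exact: smoothZ].
rewrite foldr_pderivZ; last exact: s2.
rewrite f1 f2 mulN1r.
have slc : slow (Psi s x).
  have := slice_slow s x (_ : `|1| <= 1); rewrite normr1 => /(_ (lexx _)).
  by congr slow; apply/funext => z; rewrite scale1r.
have := HK (Psi s x) (C * W x) (e i) (Psi_smooth s x) slc (mulr_ge0 C0 (W0 x)) (e01 i)
   (fun r z sr => HM r x z sr).
rewrite int_phi mulr1 => h; rewrite (le_trans h)// le_eqVlt; apply/orP; left; apply/eqP.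
by move: (e i ^+ q.+1) => u; ring.
Qed.

End transform.

Section shifts.
Variables (R : realType) (n : nat).
Implicit Types (f g : 'rV[R]_n -> R[i]).

Lemma is_cder_shift f (b x : 'rV[R]_n) i : smooth f ->
  is_cder (fun x => f (x + b)) x (delta_mx 0 i) (pderiv i f (x + b)).
Proof.
move=> sf; have [h1 h2] := smooth_is_cder (x + b) i sf.
split; apply/derive_line0.
  rewrite (_ : (fun s : R => _) =
    (fun s : R => complex.Re (f (x + b + s *: delta_mx 0 i)))).
    by apply/(derive_line0 (fun y => complex.Re (f y))).
  by apply/funext => s; rewrite addrAC.
rewrite (_ : (fun s : R => _) =
  (fun s : R => complex.Im (f (x + b + s *: delta_mx 0 i)))).
  by apply/(derive_line0 (fun y => complex.Im (f y))).
by apply/funext => s; rewrite addrAC.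
Qed.

Lemma reflectE f (x : 'rV[R]_n) : (fun z => f (x - z)) = (fun z => f (z *m (-1)%:M + x)).
Proof. by apply/funext => z; rewrite mul_mx_scalar scaleN1r addrC. Qed.

Lemma smooth_reflect f x : smooth f -> smooth (fun z => f (x - z)).
Proof. by move=> sf; rewrite reflectE; exact: smooth_affine. Qed.

Lemma foldr_reflect f x r : smooth f -> foldr (@pderiv R n) (fun z => f (x - z)) r =
  fun z => (-1) ^+ size r * foldr (@pderiv R n) f r (x - z).
Proof.
move=> sf; elim: r => [|i r IH]; first by apply/funext => z; rewrite expr0 mul1r.
rewrite /= IH; apply/funext => z.
have sr : smooth (fun z => foldr (@pderiv R n) f r (x - z)).
  by apply: smooth_reflect; exact: smooth_foldr.
rewrite (pderivZ _ _ sr) exprSr -mulrA; congr (_ * _).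
rewrite reflectE pderiv_affine; last exact: smooth_foldr.
rewrite (bigD1 i)//= big1 ?addr0; last first.
  by move=> j ji; rewrite !mxE eq_sym (negbTE ji) mulr0n mul0r.
rewrite mxE eqxx mulr1n mul_mx_scalar scaleN1r [- z + x]addrC.
by rewrite rmorphN rmorph1.
Qed.

End shifts.

(** There are finitely many [r] of length [q]; the sum of their constants makes the bound uniform in
    [r]. *)
Lemma rapid1_bound_size (R : realType) n (f : 'rV[R]_n -> R[i]) s q k : rapid1 f ->
  exists2 C : R, 0 <= C & forall r x, size r = q ->
    cmod (foldr (@pderiv R n) (foldr (@pderiv R n) f s) r x) <= C * pw x ^- k.
Proof.
move=> rf.
have /choice[C HC] : forall r : q.-tuple 'I_n, exists C : R, 0 <= C /\ forall x,
    cmod (foldr (@pderiv R n) (foldr (@pderiv R n) f s) r x) <= C * pw x ^- k.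
  move=> r; have [C C0 HC] := rapid1_bound (r ++ s) k rf; exists C; split=> // x.
  by rewrite -foldr_cat.
exists (\sum_r C r); first by apply: sumr_ge0 => r _; exact: (HC r).1.
move=> r x sr; have := (HC (tcast sr (in_tuple r))).2 x; rewrite val_tcast /= => h.
rewrite (le_trans h)// ler_wpM2r ?pwXV_ge0// (bigD1 (tcast sr (in_tuple r)))//= lerDl.
by apply: sumr_ge0 => r' _; exact: (HC r').1.
Qed.

(** The range of eps as an index type, so that constants of families over it are uniform in eps. *)
Definition unit_itv (R : realType) := {e : R | 0 < e <= 1}.

Section convolution.
Variables (R : realType) (n : nat) (phi : 'rV[R]_n -> R[i]).
Hypothesis hphi : mollifier phi.

Let sphi : smooth phi. Proof. by case: hphi => /schwartzP[]. Qed.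
Let rphi : rapid1 phi. Proof. by case: hphi => /schwartzP[]. Qed.
Let iphi : int_Rn phi = 1. Proof. by case: hphi. Qed.
Let mphi (alpha : {ffun 'I_n -> nat}) : alpha != [ffun=> 0%N] ->
  int_Rn (fun x => (mpow x alpha)%:C * phi x) = 0.
Proof.
move=> a0; case: hphi => _ _; apply; apply: contra_neq a0 => ->.
by apply/ffunP => i; rewrite !ffunE.
Qed.

Lemma moll_bound (e : R) : 0 < e <= 1 -> exists2 C : R, 0 <= C &
  L1dom (moll phi e) C.
Proof.
move=> /andP[e0 e1]; have [C C0 HC] := rapid1_bound [::] 1 rphi.
exists (e ^- n * C); first by rewrite mulr_ge0// invr_ge0 exprn_ge0 ?ltW.
move=> x; rewrite /moll cmodM cmod_real ger0_norm ?invr_ge0 ?exprn_ge0 ?(ltW e0)//.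
rewrite -mulrA ler_wpM2l ?invr_ge0 ?exprn_ge0 ?(ltW e0)//.
apply: (le_trans (HC _)); rewrite expr1 ler_wpM2l//.
rewrite lef_pV2 ?posrE ?pw_gt0//.
rewrite -{1}[x](scalerKV (lt0r_neq0 e0)).
by apply: pw_scale; rewrite gtr0_norm.
Qed.

Lemma ccont_moll (e : R) : ccont (moll phi e).
Proof.
apply: (@ccontM R n (fun=> (e ^- n)%:C) (fun x => phi (e^-1 *: x))).
  exact: ccont_cst.
rewrite (_ : (fun z => _) = fun z : 'rV[R]_n => phi (z *m (e^-1)%:M + 0)); last first.
  by apply/funext => z; rewrite addr0 mul_mx_scalar.
exact: ccont_comp (@affine_continuous _ _ _ _ _) (smooth_ccont sphi).
Qed.

Section with_f.
Variable f : 'rV[R]_n -> R[i].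
Hypotheses (sf : smooth f) (rf : rapid1 f).

Let Psi s x z := foldr (@pderiv R n) f s (x - z).

Let Psi_smooth s x : smooth (Psi s x).
Proof. by apply: smooth_reflect; exact: smooth_foldr. Qed.

Let Psi_der s z x i : is_cder (Psi s ^~ z) x (delta_mx 0 i) (Psi (i :: s) x z).
Proof. by apply: is_cder_shift; exact: smooth_foldr. Qed.

Let Psi_cont s z : ccont (Psi s ^~ z).
Proof. exact: ccont_comp (@continuous_addr _ _ _) (smooth_ccont (smooth_foldr s sf)). Qed.

Let Psi_slow s : exists2 C : R, 0 <= C & exists M, forall x z,
  cmod (Psi s x z) <= C * pw x ^+ M * pw z ^+ M.
Proof.
have [C C0 HC] := rapid1_bound s 0 rf; exists C => //; exists 0%N => x z.
by rewrite !expr0 !mulr1 (le_trans (HC _))// expr0 invr1 mulr1.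
Qed.

(** The substitution y = x - e z; its Jacobian cancels the factor [e ^- n] in [moll]. *)
Lemma conv_transf (e : R) x : 0 < e <= 1 ->
  distr f (fun y => moll phi e (x - y)) = transf phi Psi e [::] x.
Proof.
move=> /[dup] e01 /andP[e0 e1].
have [C C0 HC] := moll_bound e01; have [D D0 HD] := rapid1_bound [::] 1 rf.
pose h y := f y * moll phi e (x - y).
have ch : ccont h.
  apply: (ccontM (smooth_ccont sf)); rewrite reflectE.
  exact: ccont_comp (@affine_continuous _ _ _ _ _) (ccont_moll e).
have dh : L1dom h (D * C).
  move=> y; rewrite cmodM [leRHS]mulrAC.
  apply: ler_pM (cmod_ge0 _) (cmod_ge0 _) _ _.
    by have := HD y; rewrite /= expr1.
  by rewrite (le_trans (HC _))// ler_piMr// invf_le1 ?pw_gt0 ?pw_ge1.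
have ne0 : - e != 0 by rewrite oppr_eq0 gt_eqF.
have := int_Rn_aff x ne0 ch dh.
rewrite normrN gtr0_norm// => E.
have en : (e ^- n)%:C != 0 :> R[i].
  by rewrite fmorph_eq0 invr_eq0 expf_neq0 ?gt_eqF.
apply: (mulfI en); rewrite -[LHS]E /transf.
have sl := slice_slow Psi_smooth Psi_slow [::] x (_ : `|e| <= 1).
rewrite gtr0_norm// in sl.
rewrite -CintegralZ; last exact: (slow_Cint sphi rphi (sl e1)).
rewrite /int_Rn; congr Cintegral; apply/funext => t.
have A : x - (- e *: vec t + x) = e *: vec t by rewrite opprD scaleNr opprK addrC subrK.
have B : - e *: vec t + x = x - e *: vec t by rewrite scaleNr addrC.
by rewrite /h /moll A B scalerK ?gt_eqF// mulrCA.
Qed.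

Lemma conv_rapid q : rapid (fun i : unit_itv R => val i ^+ q)
  (fun i x => distr f (fun y => moll phi (val i) (x - y)) - f x).
Proof.
move=> k L.
(* Peetre's inequality turns decay in [x - z] into decay in [x], at the price of a factor
   [pw z ^+ k] that [phi] will absorb. *)
have HB s : exists2 C : R, 0 <= C & exists M, forall r x z, size r = q.+1 ->
    cmod (foldr (@pderiv R n) (Psi s x) r z) <= C * pw x ^- k * pw z ^+ M.
  have [C C0 HC'] := rapid1_bound_size s q.+1 k rf.
  exists (C * 2 ^+ (n * k)); first by rewrite mulr_ge0// exprn_ge0.
  exists k => r x z sr; rewrite foldr_reflect; last exact: smooth_foldr.
  rewrite cmodM (_ : cmod _ = 1); last first.
    elim: (size r) => [|m IH]; first by rewrite expr0 cmod1.
    by rewrite exprS cmodM IH cmodN cmod1 mulr1.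
  rewrite mul1r (le_trans (HC' r _ sr))// -!mulrA ler_wpM2l//.
  by rewrite (le_trans (pw_subV x z k))// ler_wpM2l ?exprn_ge0// mulrC.
have e01 (i : unit_itv R) : 0 < val i <= 1 by case: i.
have := transf_moment sphi rphi Psi_der Psi_cont Psi_smooth Psi_slow iphi mphi
  (fun x => pwXV_ge0 x k) e01 HB L.
have -> : (fun (i : unit_itv R) x => transf phi Psi (val i) [::] x - Psi [::] x 0) =
  (fun i x => distr f (fun y => moll phi (val i) (x - y)) - f x).
  by apply/funext => i; apply/funext => x; rewrite conv_transf// /Psi /= subr0.
apply: (@bdn_weight _ _ _ _ _ _ _ 1) => // i x; have /andP[i0 i1] := e01 i.
by rewrite mul1r ler_wpM2r ?pwXV_ge0// exprS ler_piMl// exprn_ge0// ltW.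
Qed.

Lemma conv_smooth (e : R) : 0 < e <= 1 ->
  smooth (fun x => distr f (fun y => moll phi e (x - y))).
Proof.
move=> /[dup] e01 /andP[e0 e1].
have ne1 : `|e| <= 1 by rewrite gtr0_norm.
have [h _] := transf_foldr sphi rphi Psi_der Psi_cont Psi_smooth Psi_slow ne1.
rewrite (_ : (fun x => _) = transf phi Psi e [::]); first exact: h.
by apply/funext => x; rewrite conv_transf.
Qed.

End with_f.
End convolution.

(** * Plane waves and their derivatives *)

Section plane_wave.
Variables (R : realType) (n : nat).
Implicit Types (x y z : 'rV[R]_n).

Lemma dotC x y : dot x y = dot y x.
Proof. by apply: eq_bigr => i _; rewrite mulrC. Qed.

Lemma dotDr x y z : dot x (y + z) = dot x y + dot x z.
Proof. by rewrite /dot -big_split; apply: eq_bigr => i _; rewrite mxE mulrDr. Qed.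

Lemma dotZr (c : R) x y : dot x (c *: y) = c * dot x y.
Proof. by rewrite /dot mulr_sumr; apply: eq_bigr => i _; rewrite mxE mulrCA. Qed.

Lemma dot_delta x i : dot x (delta_mx 0 i) = x 0 i.
Proof.
rewrite /dot (bigD1 i)//= big1 ?addr0; last first.
  by move=> j ji; rewrite mxE (negbTE ji) andbF mulr0.
by rewrite mxE !eqxx mulr1.
Qed.

Lemma is_derive_dot z y i : is_derive y (delta_mx 0 i) (fun y => - dot z y) (- z 0 i).
Proof.
apply/derive_line0.
rewrite (_ : (fun s : R => _) = (fun s : R => - dot z y + s * (- z 0 i))); last first.
  by apply/funext => s; rewrite dotDr dotZr dot_delta opprD mulrN.
apply: is_derive_eq.
by rewrite ?add0r /GRing.scale/= ?mulr1 ?mulr0 ?add0r ?addr0 mul1r.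
Qed.

Lemma is_cder_wave z y i : is_cder (fun y => expi (- dot z y)) y (delta_mx 0 i)
  (- 'i * (z 0 i)%:C * expi (- dot z y)).
Proof.
apply: is_cder_eq; first exact: is_cder_expi (is_derive_dot z y i).
rewrite rmorphN.
by ring.
Qed.

(** The factor by which the derivatives [s] in [y] multiply the plane wave with phase
    [- dot z y]. *)
Definition wave s z : R[i] := \prod_(i <- s) (- 'i * (z 0 i)%:C).

Lemma cmod_i : cmod ('i : R[i]) = 1.
Proof. by rewrite /cmod /= expr0n expr1n add0r sqrtr1. Qed.

Lemma wave_bound s z : cmod (wave s z) <= pw z ^+ size s.
Proof.
rewrite /wave; elim: s => [|i s IH]; first by rewrite big_nil cmod1 expr0.
rewrite big_cons cmodM exprS ler_pM ?cmod_ge0//.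
by rewrite cmodM cmodN cmod_i mul1r cmod_real coord_le_pw.
Qed.

Lemma smooth_wave s : smooth (wave s).
Proof.
elim: s => [|i s IH].
  rewrite (_ : wave [::] = fun=> 1); first exact: smooth_cst.
  by apply/funext => z; rewrite /wave big_nil.
rewrite (_ : wave (i :: s) = fun z => - 'i * (z 0 i)%:C * wave s z); last first.
  by apply/funext => z; rewrite /wave big_cons.
by apply: smoothM IH; apply/smoothZ/smooth_coord.
Qed.

Lemma smooth_dot (c : R) y : smooth (fun z => (c * dot z y)%:C).
Proof.
rewrite (_ : (fun z => _) = fun z => \sum_i (c * y 0 i)%:C * (z 0 i)%:C); last first.
  apply/funext => z; rewrite /dot mulr_sumr rmorph_sum; apply: eq_bigr => i _.
  by rewrite -rmorphM; congr (_%:C); ring.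
by apply: smooth_sum => i; apply/smoothZ/smooth_coord.
Qed.

Lemma smooth_expi_dot y : smooth (fun z => expi (- dot z y)).
Proof.
apply: smooth_expi; rewrite (_ : (fun z => _) = fun z => (-1 * dot z y)%:C).
  exact: smooth_dot.
by apply/funext => z; rewrite mulN1r.
Qed.

Lemma foldr_expi_dot y s : foldr (@pderiv R n) (fun z => expi (- dot z y)) s =
  fun z => wave s y * expi (- dot z y).
Proof.
elim: s => [|i s IH] /=; first by apply/funext => z; rewrite /wave big_nil mul1r.
rewrite IH (pderivZ _ _ (smooth_expi_dot y)); apply/funext => z.
rewrite /wave big_cons -/(wave s y) pderivE.
rewrite (_ : (fun z => expi (- dot z y)) = fun z => expi (- dot y z)); last first.
  by apply/funext => u; rewrite dotC.
by rewrite (is_cder_cD (is_cder_wave y z i)) dotC mulrCA mulrA.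
Qed.

Lemma bdn_wave (I : Type) L s : bdn L (fun (_ : I) => wave s) (fun _ z => pw z ^+ size s).
Proof.
have p0 k (i : I) z : 0 <= pw z ^+ k by exact: pwX_ge0.
elim: s => [|i s IH].
  have : bdn L (fun (_ : I) (_ : 'rV[R]_n) => 1 : R[i]) (fun _ z => pw z ^+ 0).
    by apply: (@bdn_cst _ _ _ _ _ _ 1) => // k z; rewrite cmod1 expr0 mulr1.
  by congr bdn; apply/funext => k; apply/funext => z; rewrite /wave big_nil.
have Hc : bdn L (fun (_ : I) z => (z 0 i)%:C : R[i]) (fun _ z => pw z).
  have b0 : bd0 (fun (_ : I) z => (z 0 i)%:C : R[i]) (fun _ z => pw z).
    by exists 1 => // k z; rewrite cmod_real mul1r coord_le_pw.
  case: L {IH} => [|L]; split => //; move=> j.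
  have : bdn L (fun (_ : I) (_ : 'rV[R]_n) => ((delta_mx 0 j : 'rV[R]_n) 0 i)%:C)
      (fun _ z => pw z).
    apply: (@bdn_cst _ _ _ _ _ _ 1) => // k z; last by rewrite ltW ?pw_gt0.
    rewrite cmod_real mul1r (le_trans _ (pw_ge1 z))// mxE.
    by case: (_ && _); rewrite ?normr1 ?normr0.
  congr bdn; apply/funext => k; apply/funext => z.
  by rewrite pderivE (is_cder_cD (is_cder_coord _ _ _)).
have HZ : bdn L (fun (_ : I) z => - 'i * (z 0 i)%:C : R[i]) (fun _ z => pw z).
  have ci (k : I) : cmod (- 'i : R[i]) <= 1 by rewrite cmodN cmod_i.
  exact: (bdnZ ler01 ci (fun _ => smooth_coord _ i) Hc).
have := bdnM (fun _ => smoothZ _ (smooth_coord _ i)) (fun _ => smooth_wave s) HZ IH.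
congr bdn; apply/funext => k; apply/funext => z; first by rewrite /wave big_cons.
by rewrite exprS.
Qed.

Lemma wave_expi_bound s q : exists2 C : R, 0 <= C & forall r y z, size r = q ->
  cmod (foldr (@pderiv R n) (fun z => wave s z * expi (- dot z y)) r z) <=
    C * pw y ^+ q * pw z ^+ size s.
Proof.
(* Here [y] serves as the index of the family, so the dependence on [y] appears in the weight. *)
have He : bdn q (fun y z => expi (- dot z y)) (fun y z => pw y ^+ q).
  apply: foldr_bdn => r rq; exists 1 => // y z; rewrite foldr_expi_dot.
  by rewrite cmodM cmod_expi mulr1 mul1r (le_trans (wave_bound _ _))// pwX_mono.
have H := bdnM (fun _ => smooth_wave s) smooth_expi_dot (bdn_wave _ q s) He.
have /choice[C HC] : forall r : q.-tuple 'I_n, exists C : R, 0 <= C /\ forall y z,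
    cmod (foldr (@pderiv R n) (fun z => wave s z * expi (- dot z y)) r z) <=
    C * (pw z ^+ size s * pw y ^+ q).
  move=> r; have rq : (size r <= q)%N by rewrite size_tuple.
  by have [C C0 HC] := bdn_foldr rq H; exists C.
exists (\sum_r C r); first by apply: sumr_ge0 => r _; exact: (HC r).1.
move=> r y z sr; have := (HC (tcast sr (in_tuple r))).2 y z; rewrite val_tcast /= => h.
rewrite (le_trans h)// -mulrA [X in _ <= _ * X]mulrC ler_wpM2r ?mulr_ge0 ?pwX_ge0//.
rewrite (bigD1 (tcast sr (in_tuple r)))//= lerDl.
by apply: sumr_ge0 => r' _; exact: (HC r').1.
Qed.

End plane_wave.

Section mollifier_transform.
Variables (R : realType) (n : nat) (phi : 'rV[R]_n -> R[i]).
Hypothesis hphi : mollifier phi.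

Let sphi : smooth phi. Proof. by case: hphi => /schwartzP[]. Qed.
Let rphi : rapid1 phi. Proof. by case: hphi => /schwartzP[]. Qed.
Let iphi : int_Rn phi = 1. Proof. by case: hphi. Qed.
Let mphi (alpha : {ffun 'I_n -> nat}) : alpha != [ffun=> 0%N] ->
  int_Rn (fun x => (mpow x alpha)%:C * phi x) = 0.
Proof.
move=> a0; case: hphi => _ _; apply; apply: contra_neq a0 => ->.
by apply/ffunP => i; rewrite !ffunE.
Qed.

Let Psi s (y z : 'rV[R]_n) := wave s z * expi (- dot z y).

Let Psi_smooth s y : smooth (Psi s y).
Proof. by apply: smoothM; [exact: smooth_wave|exact: smooth_expi_dot]. Qed.

Let Psi_der s z y i : is_cder (Psi s ^~ z) y (delta_mx 0 i) (Psi (i :: s) y z).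
Proof.
have := is_cderM (is_cder_cst (wave s z) y (delta_mx 0 i)) (is_cder_wave z y i).
by move=> h; apply: is_cder_eq h _; rewrite mul0r add0r /Psi /wave big_cons mulrCA mulrA.
Qed.

Let Psi_cont s z : ccont (Psi s ^~ z).
Proof.
apply: (@ccontM R n (fun=> wave s z) (fun y => expi (- dot z y))); first exact: ccont_cst.
rewrite (_ : (fun y => _) = fun y => expi (- dot y z)).
  exact: smooth_ccont (smooth_expi_dot z).
by apply/funext => y; rewrite dotC.
Qed.

Let Psi_slow s : exists2 C : R, 0 <= C & exists M, forall x z,
  cmod (Psi s x z) <= C * pw x ^+ M * pw z ^+ M.
Proof.
exists 1 => //; exists (size s) => x z.
rewrite cmodM cmod_expi mulr1 mul1r (le_trans (wave_bound _ _))//.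
by rewrite ler_peMl ?pwX_ge0// pwX_ge1.
Qed.

Lemma fourier_transf (e : R) y : 0 < e <= 1 ->
  fourier (moll phi e) y = transf phi Psi e [::] y.
Proof.
move=> /[dup] e01 /andP[e0 e1].
have [C C0 HC] := moll_bound hphi e01.
pose h x := expi (- dot x y) * moll phi e x.
have ch : ccont h by exact: ccontM (smooth_ccont (smooth_expi_dot y)) (ccont_moll hphi e).
have dh : L1dom h C by move=> x; rewrite cmodM cmod_expi mul1r; exact: HC.
have := int_Rn_aff 0 (lt0r_neq0 e0) ch dh.
rewrite gtr0_norm// => E.
have en : (e ^- n)%:C != 0 :> R[i].
  by rewrite fmorph_eq0 invr_eq0 expf_neq0 ?gt_eqF.
apply: (mulfI en); rewrite -[LHS]E /transf.
have sl := slice_slow Psi_smooth Psi_slow [::] y (_ : `|e| <= 1).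
rewrite gtr0_norm// in sl.
rewrite -CintegralZ; last exact: (slow_Cint sphi rphi (sl e1)).
rewrite /int_Rn; congr Cintegral; apply/funext => t.
rewrite addr0 /h /moll scalerK ?gt_eqF// mulrCA; congr (_ * (_ * _)).
by rewrite /Psi /wave big_nil mul1r.
Qed.

Lemma fourier_smooth (e : R) : 0 < e <= 1 -> smooth (fourier (moll phi e)).
Proof.
move=> /[dup] e01 /andP[e0 e1].
have ne1 : `|e| <= 1 by rewrite gtr0_norm.
have [h _] := transf_foldr sphi rphi Psi_der Psi_cont Psi_smooth Psi_slow ne1.
rewrite (_ : fourier (moll phi e) = transf phi Psi e [::]); first exact: h.
by apply/funext => x; rewrite fourier_transf.
Qed.

(** Each derivative of the kernel in the integration variable can bring down a component of [y]:
    every power of eps gained is paid for by a power of [pw y]. *)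
Lemma fourier_bound q L : bdn L
  (fun (i : unit_itv R) y => fourier (moll phi (val i)) y - 1)
  (fun i y => val i ^+ q.+1 * pw y ^+ q.+1).
Proof.
have HB s : exists2 C : R, 0 <= C & exists M, forall r y z, size r = q.+1 ->
    cmod (foldr (@pderiv R n) (Psi s y) r z) <= C * pw y ^+ q.+1 * pw z ^+ M.
  by have [C C0 HC] := wave_expi_bound R s q.+1; exists C => //; exists (size s).
have e01 (i : unit_itv R) : 0 < val i <= 1 by case: i.
have := transf_moment sphi rphi Psi_der Psi_cont Psi_smooth Psi_slow iphi mphi
  (fun x => pwX_ge0 x q.+1) e01 HB L.
congr bdn; apply/funext => i; apply/funext => y.
rewrite fourier_transf//; congr (_ - _).
rewrite /Psi /wave big_nil mul1r (_ : dot _ _ = 0); last first.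
  by apply: big1 => j _; rewrite mxE mul0r.
by rewrite oppr0 /expi cos0 sin0.
Qed.

End mollifier_transform.

(** * Oscillatory integrals *)

Section three_groups.
Variables (R : realType) (n : nat).
Local Notation V := 'rV[R]_n.
Local Notation V3 := 'rV[R]_(n + n + n).
Local Notation T := (measurableTypeR R).
Local Notation mu2 := (lebesgue_tuple R n \x lebesgue_tuple R n)%E.
Implicit Types (x y xi : V) (F G H : V3 -> R[i]).

Definition px (p : V3) : V := lsubmx (lsubmx p).
Definition py (p : V3) : V := rsubmx (lsubmx p).
Definition pxi (p : V3) : V := rsubmx p.

Lemma px_pt3 x y xi : px (pt3 x y xi) = x.
Proof. by rewrite /px /pt3 !row_mxKl. Qed.

Lemma py_pt3 x y xi : py (pt3 x y xi) = y.
Proof. by rewrite /py /pt3 row_mxKl row_mxKr. Qed.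

Lemma pxi_pt3 x y xi : pxi (pt3 x y xi) = xi.
Proof. by rewrite /pxi /pt3 row_mxKr. Qed.

Lemma pt3K (p : V3) : pt3 (px p) (py p) (pxi p) = p.
Proof. by rewrite /pt3 !hsubmxK. Qed.

Lemma coord_x (p : V3) i : p 0 (var_x i) = px p 0 i.
Proof. by rewrite !mxE. Qed.

Lemma coord_y (p : V3) i : p 0 (var_y i) = py p 0 i.
Proof. by rewrite !mxE. Qed.

Lemma coord_xi (p : V3) i : p 0 (var_xi i) = pxi p 0 i.
Proof. by rewrite !mxE. Qed.

Lemma pt3D x y xi x' y' xi' :
  pt3 (x + x') (y + y') (xi + xi') = pt3 x y xi + pt3 x' y' xi'.
Proof. by rewrite /pt3 !add_row_mx. Qed.

Lemma pt3Z (t : R) x y xi : pt3 (t *: x) (t *: y) (t *: xi) = t *: pt3 x y xi.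
Proof. by rewrite /pt3 !scale_row_mx. Qed.

Lemma delta_var_x i : (delta_mx 0 (var_x i) : V3) = pt3 (delta_mx 0 i) 0 0.
Proof. by rewrite /pt3 /var_x !delta_mx_lshift. Qed.

Lemma delta_var_y i : (delta_mx 0 (var_y i) : V3) = pt3 0 (delta_mx 0 i) 0.
Proof. by rewrite /pt3 /var_y delta_mx_lshift delta_mx_rshift. Qed.

Lemma delta_var_xi i : (delta_mx 0 (var_xi i) : V3) = pt3 0 0 (delta_mx 0 i).
Proof. by rewrite /pt3 /var_xi delta_mx_rshift row_mx0. Qed.

Lemma is_cder_slice (g : V -> V3) F v z (w : V3) d :
  (forall t : R, g (z + t *: v) = g z + t *: w) ->
  is_cder F (g z) w d -> is_cder (fun z => F (g z)) z v d.
Proof.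
move=> gE [hR hI].
by split; apply/derive_line0; under eq_fun do rewrite gE; apply/derive_line0.
Qed.

Lemma is_cder_slice_x F x y xi i d : is_cder F (pt3 x y xi) (delta_mx 0 (var_x i)) d ->
  is_cder (fun x => F (pt3 x y xi)) x (delta_mx 0 i) d.
Proof.
apply: (@is_cder_slice (fun x => pt3 x y xi)) => t.
by rewrite delta_var_x -pt3Z -pt3D !scaler0 !addr0.
Qed.

Lemma is_cder_slice_y F x y xi i d : is_cder F (pt3 x y xi) (delta_mx 0 (var_y i)) d ->
  is_cder (fun y => F (pt3 x y xi)) y (delta_mx 0 i) d.
Proof.
apply: (@is_cder_slice (fun y => pt3 x y xi)) => t.
by rewrite delta_var_y -pt3Z -pt3D !scaler0 !addr0.
Qed.

Lemma is_cder_slice_xi F x y xi i d : is_cder F (pt3 x y xi) (delta_mx 0 (var_xi i)) d ->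
  is_cder (fun xi => F (pt3 x y xi)) xi (delta_mx 0 i) d.
Proof.
apply: (@is_cder_slice (fun xi => pt3 x y xi)) => t.
by rewrite delta_var_xi -pt3Z -pt3D !scaler0 !addr0.
Qed.

Lemma smooth_slice_y F x xi : smooth F -> smooth (fun y => F (pt3 x y xi)).
Proof.
move=> sF; have := smooth_affine (row_mx (row_mx 0 1%:M) 0) (pt3 x 0 xi) sF.
congr smooth; apply/funext => y; congr F.
by rewrite /pt3 !mul_mx_row !mulmx0 mulmx1 !add_row_mx !add0r addr0.
Qed.

Lemma smooth_slice_xi F x y : smooth F -> smooth (fun xi => F (pt3 x y xi)).
Proof.
move=> sF; have := smooth_affine (row_mx (row_mx 0 0) 1%:M) (pt3 x y 0) sF.
congr smooth; apply/funext => xi; congr F.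
by rewrite /pt3 !mul_mx_row !mulmx0 mulmx1 !add_row_mx !add0r addr0.
Qed.

Lemma Cmeas_pt3 F x : ccont F ->
  Cmeas (fun p : n.-tuple T * n.-tuple T => F (pt3 x (vec p.1) (vec p.2))).
Proof.
apply: (@Cmeas_cont _ _ _ _ (fun p : n.-tuple T * n.-tuple T => pt3 x (vec p.1) (vec p.2))).
move=> i; case: (split_ordP i) => [j ->|j ->].
  case: (split_ordP j) => [k ->|k ->].
    rewrite (_ : (fun _ => _) = fun=> x 0 k); first exact: measurable_cst.
    by apply/funext => p; rewrite !row_mxEl.
  rewrite (_ : (fun _ => _) = fun p : n.-tuple T * n.-tuple T => vec p.1 0 k).
    exact: measurableT_comp (measurable_vec k) measurable_fst.
  by apply/funext => p; rewrite row_mxEl row_mxEr.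
rewrite (_ : (fun _ => _) = fun p : n.-tuple T * n.-tuple T => vec p.2 0 j).
  exact: measurableT_comp (measurable_vec j) measurable_snd.
by apply/funext => p; rewrite row_mxEr.
Qed.

Definition int3 F x := int_R2n (fun y xi => F (pt3 x y xi)).

Definition dom3 F (C : R) x := forall y xi,
  cmod (F (pt3 x y xi)) <= C * ((pw y)^-1 * (pw xi)^-1).

Lemma dom3_Cint F C x : ccont F -> dom3 F C x ->
  Cint mu2 (fun p : n.-tuple T * n.-tuple T => F (pt3 x (vec p.1) (vec p.2))).
Proof.
move=> cF dF; apply: (CintP (Cmeas_pt3 x cF) (integrable_pwV2 n C)) => p.
exact: dF.
Qed.

Lemma int3_le F C x : ccont F -> dom3 F C x -> cmod (int3 F x) <=
  2 * \int[mu2]_p (C * ((pw (vec p.1))^-1 * (pw (vec p.2))^-1)).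
Proof.
move=> cF dF; apply: (Cintegral_le (Cmeas_pt3 x cF) (integrable_pwV2 n C)) => p.
exact: dF.
Qed.

Lemma int3D F G C D x : ccont F -> ccont G -> dom3 F C x -> dom3 G D x ->
  int3 (fun p => F p + G p) x = int3 F x + int3 G x.
Proof.
by move=> cF cG dF dG; apply: CintegralD; [exact: dom3_Cint dF|exact: dom3_Cint dG].
Qed.

Lemma int3Z c F C x : ccont F -> dom3 F C x ->
  int3 (fun p => c * F p) x = c * int3 F x.
Proof. by move=> cF dF; apply: CintegralZ; exact: dom3_Cint dF. Qed.

Lemma dom3_le F C D x : C <= D -> dom3 F C x -> dom3 F D x.
Proof.
move=> CD dF y xi; rewrite (le_trans (dF _ _))// ler_wpM2r//.
by rewrite mulr_ge0// invr_ge0 ltW// pw_gt0.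
Qed.

Lemma int3_pderiv_y F x i C D : smooth F -> dom3 F C x -> dom3 (pderiv (var_y i) F) D x ->
  int3 (pderiv (var_y i) F) x = 0.
Proof.
move=> sF dF dG; pose W y xi := F (pt3 x y xi).
have E : forall xi y, pderiv i (W^~ xi) y = pderiv (var_y i) F (pt3 x y xi).
  move=> xi y; rewrite pderivE; apply/is_cder_cD/is_cder_slice_y.
  exact: smooth_is_cder.
rewrite (_ : int3 _ x = int_R2n (fun y xi => pderiv i (W^~ xi) y)); last first.
  by rewrite /int3; congr int_R2n; apply/funext => y; apply/funext => xi; rewrite E.
have C0 : C <= `|C| + `|D| by rewrite (le_trans (ler_norm _))// lerDl.
have D0 : D <= `|C| + `|D| by rewrite (le_trans (ler_norm _))// lerDr.
apply: (@int_R2n_pderiv_l _ _ _ _ (`|C| + `|D|)).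
- exact: addr_ge0.
- by move=> xi; exact: smooth_slice_y.
- exact: dom3_le C0 dF.
- by move=> y xi; rewrite E; exact: dom3_le D0 dG y xi.
- under eq_fun do rewrite E.
  exact/Cmeas_pt3/smooth_ccont/smooth_pderiv.
Qed.

Lemma int3_pderiv_xi F x i C D : smooth F -> dom3 F C x ->
  dom3 (pderiv (var_xi i) F) D x -> int3 (pderiv (var_xi i) F) x = 0.
Proof.
move=> sF dF dG; pose W y xi := F (pt3 x y xi).
have E : forall xi y, pderiv i (W y) xi = pderiv (var_xi i) F (pt3 x y xi).
  move=> xi y; rewrite pderivE; apply/is_cder_cD/is_cder_slice_xi.
  exact: smooth_is_cder.
rewrite (_ : int3 _ x = int_R2n (fun y xi => pderiv i (W y) xi)); last first.
  by rewrite /int3; congr int_R2n; apply/funext => y; apply/funext => xi; rewrite E.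
have C0 : C <= `|C| + `|D| by rewrite (le_trans (ler_norm _))// lerDl.
have D0 : D <= `|C| + `|D| by rewrite (le_trans (ler_norm _))// lerDr.
apply: (@int_R2n_pderiv_r _ _ _ _ (`|C| + `|D|)).
- exact: addr_ge0.
- by move=> xi; exact: smooth_slice_xi.
- exact: dom3_le C0 dF.
- by move=> y xi; rewrite E; exact: dom3_le D0 dG y xi.
- under eq_fun do rewrite E.
  exact/Cmeas_pt3/smooth_ccont/smooth_pderiv.
Qed.

Lemma locdom_pt3 F C M : 0 <= C -> (forall x, dom3 F (C * pw x ^+ M) x) ->
  locdom mu2 (fun x p => F (pt3 x (vec p.1) (vec p.2))).
Proof.
move=> C0 dF x0.
exists (fun p => (C * (4 ^+ n * pw x0) ^+ M) * ((pw (vec p.1))^-1 * (pw (vec p.2))^-1)).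
  exact: integrable_pwV2.
move=> x /pw_loc xx0 p; apply: dom3_le (dF x) _ _.
rewrite ler_wpM2l//; apply: lerXn2r; rewrite ?nnegrE ?(ltW (pw_gt0 _))//.
by rewrite mulr_ge0 ?exprn_ge0// ltW ?pw_gt0.
Qed.

Lemma int3_ccont F C M : smooth F -> 0 <= C -> (forall x, dom3 F (C * pw x ^+ M) x) ->
  ccont (int3 F).
Proof.
move=> sF C0 dF.
apply: (@ccont_Cintegral _ _ _ mu2 _ (fun x p => F (pt3 x (vec p.1) (vec p.2)))).
- by move=> x; exact/Cmeas_pt3/smooth_ccont.
- move=> p; have := smooth_ccont (smooth_affine (row_mx (row_mx 1%:M 0) 0)
    (pt3 0 (vec p.1) (vec p.2)) sF).
  congr ccont; apply/funext => x; congr F.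
  by rewrite /pt3 !mul_mx_row !mulmx0 mulmx1 !add_row_mx !add0r addr0.
- exact: locdom_pt3 dF.
Qed.

Lemma is_cder_int3 F C D M x i : smooth F -> 0 <= C -> 0 <= D ->
  (forall x, dom3 F (C * pw x ^+ M) x) ->
  (forall x, dom3 (pderiv (var_x i) F) (D * pw x ^+ M) x) ->
  is_cder (int3 F) x (delta_mx 0 i) (int3 (pderiv (var_x i) F) x).
Proof.
move=> sF C0 D0 dF dG.
apply: (@is_cder_Cintegral _ _ _ mu2 _ (fun x p => F (pt3 x (vec p.1) (vec p.2)))
  (fun x p => pderiv (var_x i) F (pt3 x (vec p.1) (vec p.2)))).
- by move=> y; exact/Cmeas_pt3/smooth_ccont.
- by move=> y p; apply: is_cder_slice_x; exact: smooth_is_cder.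
- exact: locdom_pt3 dF.
- exact: locdom_pt3 dG.
Qed.

End three_groups.

(** * The phase function and its derivatives *)

Section phase.
Variables (R : realType) (n : nat).
Local Notation V3 := 'rV[R]_(n + n + n).

Definition phase (p : V3) : R[i] := expi (dot (px p - py p) (pxi p)).

Lemma rowB N (x y : 'rV[R]_N) i : (x - y) 0 i = x 0 i - y 0 i.
Proof. by rewrite !mxE. Qed.

Lemma cmod_phase p : cmod (phase p) = 1.
Proof. exact: cmod_expi. Qed.

Lemma smooth_phase : smooth phase.
Proof.
apply: smooth_expi.
rewrite (_ : (fun p => _) = fun p : V3 => \sum_i
   ((p 0 (var_x i))%:C + (-1) * (p 0 (var_y i))%:C) * (p 0 (var_xi i))%:C); last first.
  apply/funext => p; rewrite rmorph_sum; apply: eq_bigr => i _.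
  by rewrite coord_x coord_y coord_xi mulN1r -rmorphB -rmorphM rowB.
apply: smooth_sum => i; apply: smoothM; last exact: smooth_coord.
by apply: smoothD; [exact: smooth_coord|apply/smoothZ/smooth_coord].
Qed.

Lemma is_derive_lin N (q : 'rV[R]_N -> R) p v d :
  (forall t : R, q (p + t *: v) = q p + t * d) -> is_derive p v q d.
Proof.
move=> H; apply/derive_line0; under eq_fun do rewrite H.
apply: is_derive_eq.
by rewrite ?add0r /GRing.scale/= ?mulr1 ?mulr0 ?add0r ?addr0 mul1r.
Qed.

Lemma phase_line (p q : V3) (t : R) :
  dot (px (p + t *: q) - py (p + t *: q)) (pxi (p + t *: q)) =
  dot (px p - py p + t *: (px q - py q)) (pxi p + t *: pxi q).
Proof.
have -> : p + t *: q = pt3 (px p + t *: px q) (py p + t *: py q) (pxi p + t *: pxi q).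
  by rewrite pt3D pt3Z !pt3K.
rewrite px_pt3 py_pt3 pxi_pt3.
by rewrite opprD addrACA scalerBr.
Qed.

Lemma pderiv_phase_x i : pderiv (var_x i) phase =
  fun p => 'i * (pxi p 0 i)%:C * phase p.
Proof.
apply/funext => p; rewrite pderivE; apply/is_cder_cD/is_cder_expi/is_derive_lin => t.
rewrite phase_line delta_var_x px_pt3 py_pt3 pxi_pt3 !(subr0, scaler0, addr0).
by rewrite dotC dotDr dotZr dot_delta dotC.
Qed.

Lemma pderiv_phase_y i : pderiv (var_y i) phase =
  fun p => - ('i * (pxi p 0 i)%:C * phase p).
Proof.
apply/funext => p; rewrite pderivE; apply/is_cder_cD.
apply: (@is_cder_eq _ _ _ _ _ ('i * (- pxi p 0 i)%:C * phase p)).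
  apply/is_cder_expi/is_derive_lin => t.
  rewrite phase_line delta_var_y px_pt3 py_pt3 pxi_pt3 !(sub0r, scaler0, addr0).
  by rewrite dotC dotDr -(scaleN1r (delta_mx 0 i)) !dotZr dot_delta dotC mulN1r.
by rewrite rmorphN mulrN mulNr.
Qed.

Lemma pderiv_phase_xi i : pderiv (var_xi i) phase =
  fun p => 'i * ((px p 0 i)%:C - (py p 0 i)%:C) * phase p.
Proof.
apply/funext => p; rewrite pderivE -rmorphB; apply/is_cder_cD/is_cder_expi/is_derive_lin => t.
rewrite phase_line delta_var_xi px_pt3 py_pt3 pxi_pt3 !(subr0, scaler0, addr0).
by rewrite dotDr dotZr dot_delta rowB.
Qed.

End phase.

(** * Operators with amplitudes decaying in y and xi *)

Section oscillatory_operator.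
Variables (R : realType) (n : nat) (I : Type) (w : I -> R) (M : nat).
Hypothesis w0 : forall i, 0 <= w i.
Local Notation V3 := 'rV[R]_(n + n + n).
Implicit Types (U : 'rV[R]_n -> R) (G F : I -> V3 -> R[i]).

Definition wt U k (i : I) (p : V3) :=
  w i * (pw (px p) ^+ M * (pw (py p) ^- k * U (pxi p))).

(* Amplitudes that, with all derivatives, decrease rapidly in [y], grow at most
   like [pw x ^+ M] in [x] and are [O(U)] in [xi]. *)
Definition amp U G := sfam G /\ forall k L, bdn L G (wt U k).

Lemma amp_pderiv U G c : amp U G -> amp U (fun i => pderiv c (G i)).
Proof.
move=> [sG bG]; split; first by move=> i; exact: smooth_pderiv.
by move=> k L; have [_ /(_ c)] := bG k L.+1.
Qed.

Lemma ampD U G F : amp U G -> amp U F -> amp U (fun i p => G i p + F i p).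
Proof.
move=> [sG bG] [sF bF]; split; first by move=> i; exact: smoothD.
by move=> k L; exact: bdnD.
Qed.

Lemma ampZ U G c : amp U G -> amp U (fun i p => c * G i p).
Proof.
move=> [sG bG]; split; first by move=> i; exact: smoothZ.
by move=> k L; apply: (bdnZ (cmod_ge0 c)).
Qed.

Lemma bdn_coord (J : Type) N L (c : 'I_N) : bdn L (fun (_ : J) (z : 'rV[R]_N) => (z 0 c)%:C)
  (fun _ z => 1 + z 0 c ^+ 2).
Proof.
case: L => [|L]; split=> //.
- exists 1 => // k z; rewrite cmod_real mul1r.
  by rewrite -(real_normK (num_real _)); nra.
- exists 1 => // k z; rewrite cmod_real mul1r.
  by rewrite -(real_normK (num_real _)); nra.
- move=> j.
  have : bdn L (fun (_ : J) (_ : 'rV[R]_N) => ((delta_mx 0 j : 'rV[R]_N) 0 c)%:C)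
      (fun _ z => 1 + z 0 c ^+ 2).
    apply: (@bdn_cst _ _ _ _ _ _ 1) => // k z; last exact: sq1_ge0.
    rewrite cmod_real mul1r mxE.
    have := sqr_ge0 (z 0 c).
    by case: (_ && _); rewrite ?normr1 ?normr0; lra.
  congr bdn; apply/funext => k; apply/funext => z.
  by rewrite pderivE (is_cder_cD (is_cder_coord _ _ _)).
Qed.

Lemma sq1_pwV N (z : 'rV[R]_N) j k : (1 + z 0 j ^+ 2) * pw z ^- k.+1 <= pw z ^- k.
Proof.
rewrite (exprS (pw _)) invfM mulrA ler_piMl ?pwXV_ge0// ler_pdivrMr ?pw_gt0// mul1r.
exact: sq1_le_pw.
Qed.

Lemma coord_pwV N (z : 'rV[R]_N) j k : `|z 0 j| * pw z ^- k.+1 <= pw z ^- k.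
Proof.
rewrite (le_trans _ (sq1_pwV z j k))// ler_wpM2r ?pwXV_ge0//.
by rewrite -(real_normK (num_real _)); nra.
Qed.

Lemma amp_y U G j : (forall xi, 0 <= U xi) -> amp U G ->
  amp U (fun i p => (p 0 (var_y j))%:C * G i p).
Proof.
move=> U0 [sG bG]; split.
  by move=> i; apply: smoothM; [exact: smooth_coord|exact: sG].
move=> k L.
have := bdnM (fun _ => smooth_coord _ (var_y j)) sG (bdn_coord I L (var_y j)) (bG k.+1 L).
apply: (bdn_weight ler01) => i p; rewrite mul1r coord_y /wt.
rewrite mulrCA ler_wpM2l// mulrCA ler_wpM2l ?pwX_ge0// mulrA ler_wpM2r//.
exact: sq1_pwV.
Qed.

Definition osc G i : 'rV[R]_n -> R[i] := int3 (fun p => phase p * G i p).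

(** Of the two powers of decay in [xi], one gives integrability and the other absorbs the factor
    [xi_j] that appears when the phase is differentiated in [x] or [y]. *)
Let u2 (xi : 'rV[R]_n) := pw xi ^- 2.

Let u2_ge0 xi : 0 <= u2 xi. Proof. exact: pwXV_ge0. Qed.

Let amp2_dom G k : amp u2 G -> exists2 C : R, 0 <= C & forall i x y xi,
  cmod (G i (pt3 x y xi)) <= C * w i * pw x ^+ M * (pw y ^- k * pw xi ^- 2).
Proof.
move=> [_ /(_ k 0)[[C C0 HC] _]]; exists C => // i x y xi.
by have := HC i (pt3 x y xi); rewrite /wt px_pt3 py_pt3 pxi_pt3 !mulrA.
Qed.

Let pw2_le N (z : 'rV[R]_N) : pw z ^- 2 <= (pw z)^-1.
Proof. by have := pwXV_mono z (isT : (1 <= 2)%N); rewrite expr1. Qed.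

Let pwV_ge0 N (z : 'rV[R]_N) : 0 <= (pw z)^-1.
Proof. by rewrite invr_ge0 ltW ?pw_gt0. Qed.

Let dom_ge0 (C : R) i (x : 'rV[R]_n) : 0 <= C -> 0 <= C * w i * pw x ^+ M.
Proof. by move=> C0; rewrite !mulr_ge0 ?pwX_ge0. Qed.

Lemma phase_dom G : amp u2 G -> exists2 C : R, 0 <= C & forall i x,
  dom3 (fun p => phase p * G i p) (C * w i * pw x ^+ M) x.
Proof.
move=> /(amp2_dom 1)[C C0 HC]; exists C => // i x y xi.
rewrite cmodM cmod_phase mul1r (le_trans (HC _ _ _ _))// expr1.
by rewrite ler_wpM2l ?dom_ge0// ler_wpM2l ?pw2_le ?pwV_ge0.
Qed.

Lemma phase_smooth G i : amp u2 G -> smooth (fun p => phase p * G i p).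
Proof. by move=> [sG _]; apply: smoothM; [exact: smooth_phase|exact: sG]. Qed.

Let xi_dom G j : amp u2 G -> exists2 C : R, 0 <= C & forall i x,
  dom3 (fun p => 'i * (pxi p 0 j)%:C * phase p * G i p) (C * w i * pw x ^+ M) x.
Proof.
move=> /(amp2_dom 1)[C C0 HC]; exists C => // i x y xi.
rewrite !cmodM cmod_phase cmod_i mul1r mulr1 cmod_real pxi_pt3.
rewrite (le_trans (ler_wpM2l _ (HC _ _ _ _)))// expr1.
rewrite mulrCA ler_wpM2l ?dom_ge0// mulrCA ler_wpM2l ?pwV_ge0//.
by have := coord_pwV xi j 1; rewrite expr1.
Qed.

Lemma dom3D (F F' : V3 -> R[i]) (C D : R) (x : 'rV[R]_n) : dom3 F C x -> dom3 F' D x ->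
  dom3 (fun p => F p + F' p) (C + D) x.
Proof.
move=> hF hF' y xi; rewrite (le_trans (cmodD _ _))// mulrDl.
by apply: lerD; [exact: hF|exact: hF'].
Qed.

Lemma dom3Z c (F : V3 -> R[i]) (C : R) (x : 'rV[R]_n) : dom3 F C x ->
  dom3 (fun p => c * F p) (cmod c * C) x.
Proof. by move=> hF y xi; rewrite cmodM -mulrA ler_wpM2l ?cmod_ge0//; exact: hF. Qed.

Let dx_dom G j : amp u2 G -> exists2 C : R, 0 <= C & forall i x,
  dom3 (pderiv (var_x j) (fun p => phase p * G i p)) (C * w i * pw x ^+ M) x.
Proof.
move=> aG; have [C C0 HC] := xi_dom j aG.
have [D D0 HD] := phase_dom (amp_pderiv (var_x j) aG).
exists (C + D); first exact: addr_ge0.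
move=> i x; rewrite 2!mulrDl pderivM; [|exact: smooth_phase|exact: aG.1].
by rewrite pderiv_phase_x; apply: dom3D; [exact: HC|exact: HD].
Qed.

Let dy_dom G j : amp u2 G -> exists2 C : R, 0 <= C & forall i x,
  dom3 (pderiv (var_y j) (fun p => phase p * G i p)) (C * w i * pw x ^+ M) x.
Proof.
move=> aG; have [C C0 HC] := xi_dom j aG.
have [D D0 HD] := phase_dom (amp_pderiv (var_y j) aG).
exists (C + D); first exact: addr_ge0.
move=> i x; rewrite 2!mulrDl pderivM; [|exact: smooth_phase|exact: aG.1].
rewrite pderiv_phase_y; apply: dom3D; last exact: HD.
by move=> y xi; rewrite mulNr cmodN; exact: HC.
Qed.

(* [d/dx_j] falls on the phase as [- d/dy_j], which is then integrated by parts. *)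
Definition osc_dx j G i (p : V3) := pderiv (var_x j) (G i) p + pderiv (var_y j) (G i) p.

Lemma amp_dx U G j : amp U G -> amp U (osc_dx j G).
Proof. by move=> aG; apply: ampD; exact: amp_pderiv. Qed.

Lemma is_cder_osc G i j x : amp u2 G ->
  is_cder (osc G i) x (delta_mx 0 j) (osc (osc_dx j G) i x).
Proof.
move=> aG; have [C C0 HC] := phase_dom aG.
have [D D0 HD] := dx_dom j aG; have [B B0 HB] := dy_dom j aG.
have sF := phase_smooth i aG.
have -> : osc (osc_dx j G) i x = int3 (pderiv (var_x j) (fun p => phase p * G i p)) x.
  rewrite -[RHS]addr0 -(int3_pderiv_y (F := fun p => phase p * G i p) sF (HC i x) (HB i x)).
  rewrite -(int3D _ _ (HD i x) (HB i x)); try exact/smooth_ccont/smooth_pderiv.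
  rewrite /osc; congr int3; apply/funext => p.
  rewrite !pderivM; try exact: smooth_phase; try exact: aG.1.
  by rewrite pderiv_phase_x pderiv_phase_y /osc_dx; ring.
apply: (is_cder_int3 (C := C * w i) (D := D * w i) (M := M)) => //; exact: mulr_ge0.
Qed.

(* [x_j phase = (y_j - i d/dxi_j) phase], and [d/dxi_j] is integrated by parts. *)
Definition osc_x j G i (p : V3) := (p 0 (var_y j))%:C * G i p + 'i * pderiv (var_xi j) (G i) p.

Lemma amp_x G j : amp u2 G -> amp u2 (osc_x j G).
Proof. by move=> aG; apply: ampD; [exact: amp_y|exact/ampZ/amp_pderiv]. Qed.

Lemma osc_coord G i j (x : 'rV[R]_n) : amp u2 G -> (x 0 j)%:C * osc G i x = osc (osc_x j G) i x.
Proof.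
move=> aG; pose F p := phase p * G i p.
have sF : smooth F := phase_smooth i aG.
have [C C0 HC] := phase_dom aG; have [D D0 HD] := phase_dom (amp_y j u2_ge0 aG).
have [B B0 HB] := phase_dom (amp_pderiv (var_xi j) aG).
have dF p : pderiv (var_xi j) F p = 'i * (px p 0 j)%:C * F p +
    ((- 'i) * (phase p * ((p 0 (var_y j))%:C * G i p)) + phase p * pderiv (var_xi j) (G i) p).
  rewrite pderivM; [|exact: smooth_phase|exact: aG.1].
  by rewrite pderiv_phase_xi coord_y /F; ring.
have dom_dF : dom3 (pderiv (var_xi j) F) (cmod ('i * (x 0 j)%:C) * (C * w i * pw x ^+ M) +
    (cmod (- 'i) * (D * w i * pw x ^+ M) + B * w i * pw x ^+ M)) x.
  move=> y xi; rewrite dF px_pt3.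
  have := dom3D (dom3Z ('i * (x 0 j)%:C) (HC i x)) (dom3D (dom3Z (- 'i) (HD i x)) (HB i x)).
  exact.
have c1 : ccont F by exact: smooth_ccont.
have c2 := smooth_ccont (smooth_pderiv (var_xi j) sF).
have I0 := int3_pderiv_xi sF (HC i x) dom_dF.
(* Adds ['i] times the vanishing integral of [pderiv (var_xi j) F]; in the sum the terms containing
   [x_j] cancel since ['i * 'i = -1]. *)
rewrite -(int3Z _ c1 (HC i x)) -[LHS]addr0 -[X in _ + X](mulr0 'i) -I0.
rewrite -(int3Z _ c2 dom_dF) -(int3D _ _ (dom3Z _ (HC i x)) (dom3Z _ dom_dF)).
- rewrite /int3; congr int_R2n; apply/funext => y; apply/funext => xi.
  rewrite dF px_pt3 /osc_x /F.
  have i2 : 'i * 'i = -1 :> R[i] by rewrite -expr2 sqr_i.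
  have E (X Y Z : R[i]) : X + 'i * ('i * X + (- 'i * Y + Z)) =
    X + ('i * 'i) * X - ('i * 'i) * Y + 'i * Z by ring.
  rewrite -[X in _ + 'i * (X + _)]mulrA E i2; ring.
- by apply: ccontM c1; exact: ccont_cst.
- by apply: ccontM c2; exact: ccont_cst.
Qed.

Lemma osc_bd0 G : amp u2 G -> bd0 (osc G) (fun i x => w i * pw x ^+ M).
Proof.
move=> aG; have [C C0 HC] := phase_dom aG.
pose g (p : n.-tuple (measurableTypeR R) * n.-tuple (measurableTypeR R)) : R :=
  1 * ((pw (vec p.1))^-1 * (pw (vec p.2))^-1).
pose J := \int[(lebesgue_tuple R n \x lebesgue_tuple R n)%E]_p g p.
exists (C * `|2 * J|); first exact: mulr_ge0.
move=> i x; have := int3_le (smooth_ccont (phase_smooth i aG)) (HC i x).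
rewrite -/(osc G i x) => h; rewrite (le_trans h)//.
under eq_Rintegral do rewrite -[X in _ * X]mul1r.
rewrite RintegralZl//; last exact: integrable_pwV2.
rewrite -/g -/J (_ : 2 * _ = C * (w i * pw x ^+ M) * (2 * J)); last by ring.
by rewrite [leRHS]mulrAC ler_wpM2l ?ler_norm// mulr_ge0// mulr_ge0 ?pwX_ge0.
Qed.

Lemma oscD G F i x : amp u2 G -> amp u2 F ->
  osc (fun i p => G i p + F i p) i x = osc G i x + osc F i x.
Proof.
move=> aG aF; have [C C0 HC] := phase_dom aG; have [D D0 HD] := phase_dom aF.
rewrite -(int3D _ _ (HC i x) (HD i x)); try exact/smooth_ccont/phase_smooth.
by rewrite /osc; congr (int3 _ x); apply/funext => p; rewrite mulrDr.
Qed.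

(** The amplitude that represents multiplication of [osc G] by [1 + x 0 j ^+ 2]. Running over all
    coordinates produces the factor [pw x]. *)
Definition osc_sq j G i p := G i p + osc_x j (osc_x j G) i p.

Lemma amp_sq G j : amp u2 G -> amp u2 (osc_sq j G).
Proof. by move=> aG; apply: ampD => //; do 2 apply: amp_x. Qed.

Lemma osc_prod l G : amp u2 G -> exists2 F, amp u2 F & forall i (x : 'rV[R]_n),
  (\prod_(j <- l) (1 + x 0 j ^+ 2))%:C * osc G i x = osc F i x.
Proof.
elim: l G => [|j l IH] G aG.
  by exists G => // i x; rewrite big_nil mul1r.
have [F aF HF] := IH _ (amp_sq j aG); exists F => // i x.
rewrite big_cons -HF oscD//; last by do 2 apply: amp_x.
rewrite -(osc_coord _ _ _ (amp_x j aG)) -(osc_coord _ _ _ aG) mulrC rmorphM rmorphD rmorphXn.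
by rewrite /=; ring.
Qed.

Lemma osc_pw k G : amp u2 G -> exists2 F, amp u2 F & forall i (x : 'rV[R]_n),
  (pw x ^+ k)%:C * osc G i x = osc F i x.
Proof.
elim: k G => [|k IH] G aG; first by exists G => // i x; rewrite expr0 mul1r.
have [F aF HF] := osc_prod (index_enum 'I_n) aG.
have [H aH HH] := IH F aF; exists H => // i x.
by rewrite -HH -HF mulrA -rmorphM exprSr.
Qed.

Lemma smooth_osc G i : amp u2 G -> smooth (osc G i).
Proof.
move=> aG; apply: (@smooth_coind _ _ (fun f => exists2 H, amp u2 H & f = osc H i)).
  move=> _ [H aH ->]; split.
    split; last by move=> x j; apply: is_cder_cder; exact: is_cder_osc.
    have [C C0 HC] := phase_dom aH.
    apply: (int3_ccont (C := C * w i) (M := M) _ _ (HC i)); first exact: phase_smooth.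
    exact: mulr_ge0.
  move=> j; exists (osc_dx j H); first exact: amp_dx.
  by apply/funext => x; rewrite pderivE (is_cder_cD (is_cder_osc i j x aH)).
by exists G.
Qed.

(** [osc_bd0] still allows growth of order [M] in [x]. Multiplying by [pw x ^+ (M + k)], which only
    changes the amplitude, compensates it and leaves decay of order [k]; derivatives in [x] also
    only change the amplitude. *)
Lemma osc_rapid G : amp u2 G -> rapid w (osc G).
Proof.
move=> aG k L; elim: L G aG => [|L IH] G aG.
  split=> //; have [F aF HF] := osc_pw (M + k) aG.
  have [C C0 HC] := osc_bd0 aF; exists C => // i x.
  have := HC i x; rewrite -HF cmodM cmod_real ger0_norm ?pwX_ge0// exprD => h.
  have p0 := pwX_gt0 x M; have pk0 := pwX_gt0 x k.
  rewrite mulrA ler_pdivlMr// -(ler_pM2l p0).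
  have -> : pw x ^+ M * (cmod (osc G i x) * pw x ^+ k) =
    pw x ^+ M * pw x ^+ k * cmod (osc G i x) by ring.
  by rewrite (le_trans h)// mulrA mulrC.
split; first exact: bdn0 (IH G aG).
move=> j; have := IH _ (amp_dx j aG); congr bdn.
apply/funext => i; apply/funext => x.
by rewrite pderivE (is_cder_cD (is_cder_osc i j x aG)).
Qed.

End oscillatory_operator.

Section inverse_symbol.
Variables (R : realType).

(** The function 1 / (1 + i z_c), written with a real denominator that never vanishes. *)
Definition rinv N (c : 'I_N) (z : 'rV[R]_N) : R[i] :=
  (1 - 'i * (z 0 c)%:C) * ((1 + z 0 c ^+ 2)^-1)%:C.

Lemma sq_i : 'i * 'i = -1 :> R[i].
Proof. by rewrite -expr2 sqr_i. Qed.

Lemma sq1_gt0 (a : R) : 0 < 1 + a ^+ 2.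
Proof. by have := sqr_ge0 a; lra. Qed.

Lemma sq1V (a : R) : ((1 + a ^+ 2)^-1)%:C * (1 + a%:C ^+ 2) = 1 :> R[i].
Proof.
have -> : 1 + a%:C ^+ 2 = (1 + a ^+ 2)%:C :> R[i] by rewrite rmorphD rmorphXn rmorph1.
by rewrite -rmorphM mulVf ?rmorph1// gt_eqF ?sq1_gt0.
Qed.

Lemma rinvK N (c : 'I_N) z : rinv c z * (1 + 'i * (z 0 c)%:C) = 1.
Proof.
rewrite -[RHS](sq1V (z 0 c)) /rinv; set s := (_^-1)%:C; set a := (z 0 c)%:C.
have -> : (1 - 'i * a) * s * (1 + 'i * a) = s * (1 - 'i * 'i * a ^+ 2) by ring.
by rewrite sq_i mulN1r opprK.
Qed.

Lemma cmod_rinv_sq N (c : 'I_N) z : cmod (rinv c z) ^+ 2 = (1 + z 0 c ^+ 2)^-1.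
Proof.
have := congr1 (fun u => cmod u ^+ 2) (rinvK c z); rewrite cmodM cmod1 expr1n exprMn.
have -> : cmod (1 + 'i * (z 0 c)%:C) ^+ 2 = 1 + z 0 c ^+ 2.
  rewrite /cmod /= sqr_sqrtr; last by rewrite addr_ge0 ?sqr_ge0.
  by rewrite !(mul0r, mul1r, mulr0, subr0, addr0, add0r) expr1n.
by move=> /(canRL (mulfK (lt0r_neq0 (sq1_gt0 _)))); rewrite mul1r.
Qed.

Lemma cmod_rinv_le1 N (c : 'I_N) z : cmod (rinv c z) <= 1.
Proof.
rewrite -(@expr_le1 _ 2)// ?cmod_ge0// cmod_rinv_sq invf_le1 ?sq1_gt0//.
by have := sqr_ge0 (z 0 c); lra.
Qed.

Lemma is_cderX N (f : 'rV[R]_N -> R[i]) x v d m : is_cder f x v d ->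
  is_cder (fun y => f y ^+ m.+1) x v (m.+1%:R * f x ^+ m * d).
Proof.
move=> h; elim: m => [|m IH].
  by apply: is_cder_eq; [exact: h|rewrite expr0 mulr1 mul1r].
rewrite (_ : (fun y => _) = fun y => f y * f y ^+ m.+1); last first.
  by apply/funext => y; rewrite exprS.
apply: is_cder_eq; first exact: is_cderM h IH.
by rewrite -(natr1 m.+1) exprS; ring.
Qed.

Lemma is_cder_rinv N (c : 'I_N) z v :
  is_cder (rinv c) z v (- 'i * (v 0 c)%:C * rinv c z ^+ 2).
Proof.
have h1 : is_cder (fun z : 'rV[R]_N => 1 - 'i * (z 0 c)%:C) z v (- 'i * (v 0 c)%:C).
  have := is_cderD (is_cder_cst 1 z v)
    (is_cderM (is_cder_cst (- 'i) z v) (is_cder_coord c z v)).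
  rewrite mul0r !add0r; congr is_cder.
  by apply/funext => y; rewrite mulNr.
have h2 : is_derive z v (fun z : 'rV[R]_N => (1 + z 0 c ^+ 2)^-1)
    (- (1 + z 0 c ^+ 2) ^- 2 * (2 * z 0 c) * v 0 c).
  apply: (@is_derive_comp1 _ _ (fun t : R => (1 + t ^+ 2)^-1) (fun z : 'rV[R]_N => z 0 c)).
    by have [] := is_cder_coord c z v.
  have n0 : 1 + (z 0 c) ^+ 2 != 0 by rewrite gt_eqF// sq1_gt0.
  apply: is_derive_eq.
  rewrite /GRing.scale /=; ring.
apply: is_cder_eq; first exact: is_cderM h1 (is_cder_real h2).
rewrite /rinv; set s := _^-1; have hs := sq1V (z 0 c); rewrite -/s in hs.
(* [ring] is not aware of ['i * 'i = -1] or [s * (1 + a ^+ 2) = 1]; the identity isolates both as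
   factors, which the final rewriting annihilates. *)
have key (i a e t : R[i]) : - i * e * t + (1 - i * a) * (- t ^+ 2 * (2 * a) * e) =
    - i * e * ((1 - i * a) * t) ^+ 2 + i * e * t * (t * (1 + a ^+ 2) - 1)
    + (i * i + 1) * (- 2 * a * e * t ^+ 2 + i * a ^+ 2 * e * t ^+ 2) by ring.
rewrite -exprVn -/s !rmorphM rmorphN rmorphXn rmorph_nat.
by rewrite key hs sq_i subrr addNr mulr0 mul0r !addr0.
Qed.

Lemma is_cder_rinvX N (c : 'I_N) z v m : is_cder (fun z => rinv c z ^+ m.+1) z v
  (m.+1%:R * (- 'i * (v 0 c)%:C) * rinv c z ^+ m.+2).
Proof.
apply: is_cder_eq; first exact: is_cderX (is_cder_rinv c z v).
by rewrite !exprS; ring.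
Qed.

(** Every derivative of [rinv c] is a constant times a power of [rinv c]; this is the constant. *)
Fixpoint rinv_coef N (c : 'I_N) (s : seq 'I_N) : R[i] :=
  if s is j :: s then
    rinv_coef c s * ((size s).+1%:R * (- 'i * ((delta_mx 0 j : 'rV[R]_N) 0 c)%:C))
  else 1.

Lemma rinv_foldr N (c : 'I_N) : smooth (rinv c) /\ forall s, foldr (@pderiv R N) (rinv c) s =
    fun z => rinv_coef c s * rinv c z ^+ (size s).+1.
Proof.
have cr : ccont (rinv c).
  apply: (@ccontM R N (fun z => 1 - 'i * (z 0 c)%:C) (fun z => ((1 + z 0 c ^+ 2)^-1)%:C)).
    apply: smooth_ccont; rewrite (_ : (fun z => _) = fun z : 'rV[R]_N => 1 + - 'i * (z 0 c)%:C).
      by apply: smoothD; [exact: smooth_cst|apply/smoothZ/smooth_coord].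
    by apply/funext => z; rewrite mulNr.
  apply: ccont_real => z.
  have h : (fun z : 'rV[R]_N => z 0 c) @ z --> z 0 c by exact: coord_continuous.
  have h1 : (fun z : 'rV[R]_N => 1 + z 0 c * z 0 c) @ z --> 1 + z 0 c * z 0 c.
    have H := cvgD (cvg_cst (1 : R)) (cvgM h h); exact: H.
  have n0 : 1 + z 0 c * z 0 c != 0 by rewrite -expr2 gt_eqF ?sq1_gt0.
  exact: (cvgV n0 h1).
have := @foldr_unique R N (fun s z => rinv_coef c s * rinv c z ^+ (size s).+1).
rewrite /= (_ : (fun z => _) = rinv c); last first.
  by apply/funext => z; rewrite mul1r expr1.
apply.
- move=> s; apply: (@ccontM R N (fun=> rinv_coef c s) _); first exact: ccont_cst.
  elim: (size s) => [|m IH]; first by under eq_fun do rewrite expr1.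
  under eq_fun do rewrite exprS.
  exact: ccontM cr IH.
- move=> s z i; have := is_cderM (is_cder_cst (rinv_coef c s) z (delta_mx 0 i))
    (is_cder_rinvX c z (delta_mx 0 i) (size s)).
  move=> h; apply: is_cder_eq h _; by rewrite mul0r add0r /= !mulrA.
Qed.

Lemma smooth_rinv N (c : 'I_N) : smooth (rinv c).
Proof. exact: (rinv_foldr c).1. Qed.

(** Derivatives are multiples of powers of [rinv c] of exponent at least 1, and its modulus is at
    most 1; so [rinv c] itself bounds them all, and no decay is lost by differentiating. *)
Lemma bdn_rinv (I : Type) N (c : 'I_N) L :
  bdn L (fun _ : I => rinv c) (fun _ z => cmod (rinv c z)).
Proof.
apply: foldr_bdn => s _; exists (cmod (rinv_coef c s)); first exact: cmod_ge0.
move=> i z; rewrite (rinv_foldr c).2 cmodM ler_wpM2l ?cmod_ge0//.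
elim: (size s) => [|m IH]; first by rewrite expr1.
by rewrite exprS cmodM (le_trans _ IH)// ler_piMl ?cmod_ge0 ?cmod_rinv_le1.
Qed.

End inverse_symbol.

(** * Gaining decay in xi by integrating by parts in y *)

Section integration_by_parts.
Variables (R : realType) (n : nat).
Local Notation V3 := 'rV[R]_(n + n + n).
Implicit Types (H : V3 -> R[i]).

(* Since [(1 - d/dy_j) phase = (1 + i xi_j) phase], the transpose of
   [(1 + i xi_j)^-1 (1 - d/dy_j)] leaves oscillatory integrals unchanged while
   gaining decay in [xi]. *)
Definition regop j H : V3 -> R[i] :=
  fun p => rinv (var_xi j) p * (H p + pderiv (var_y j) H p).

Lemma rinv_xi j (p : V3) : rinv (var_xi j) p = rinv j (pxi p).
Proof. by rewrite /rinv coord_xi. Qed.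

Lemma smooth_regop j H : smooth H -> smooth (regop j H).
Proof.
move=> sH; apply: smoothM; first exact: smooth_rinv.
exact: (smoothD sH (smooth_pderiv _ sH)).
Qed.

Lemma smooth_foldr_regop l H : smooth H -> smooth (foldr regop H l).
Proof. by move=> sH; elim: l => [|j l IH]; [exact: sH|exact: (smooth_regop j IH)]. Qed.

(** [regop] differentiates once, which uses up one order of convergence. *)
Lemma cvn_regop L j (F : nat -> V3 -> R[i]) G : sfam F -> smooth G ->
  cvn L.+1 F G -> cvn L (fun k => regop j (F k)) (regop j G).
Proof.
move=> sF sG FG; apply: cvnM.
- by move=> k; exact: smooth_rinv.
- by move=> k; apply: smoothD; [exact: sF|exact/smooth_pderiv/sF].
- exact: smooth_rinv.
- by apply: smoothD; [exact: sG|exact/smooth_pderiv/sG].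
- exact: cvn_cst.
- apply: cvnD; [exact: sF| |exact: sG|exact: smooth_pderiv|exact: cvnW|].
    by move=> k; exact/smooth_pderiv/sF.
  by have [_ /(_ (var_y j))] := FG.
Qed.

Lemma cvn_foldr_regop l (F : nat -> V3 -> R[i]) G L : sfam F -> smooth G ->
  cvn (L + size l) F G -> cvn L (fun k => foldr regop (F k) l) (foldr regop G l).
Proof.
move=> sF sG; elim: l L => [|j l IH] L /=; first by rewrite addn0.
rewrite addnS -addSn => /IH h; apply: cvn_regop h.
  by move=> k; exact: (smooth_foldr_regop l (sF k)).
exact: (smooth_foldr_regop l sG).
Qed.

Section fix_family.
Variables (I : Type) (w : I -> R) (M : nat).
Hypothesis w0 : forall i, 0 <= w i.
Implicit Types (U : 'rV[R]_n -> R) (G : I -> V3 -> R[i]).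

Lemma amp_le U U' G : (forall xi, U xi <= U' xi) -> amp w M U G -> amp w M U' G.
Proof.
move=> UU' [sG bG]; split=> // k L; apply: (bdn_weight ler01 _ (bG k L)) => i p.
by rewrite mul1r !ler_wpM2l ?pwX_ge0 ?pwXV_ge0.
Qed.

Lemma amp_regop U G j : amp w M U G ->
  amp w M (fun xi => U xi * cmod (rinv j xi)) (fun i => regop j (G i)).
Proof.
move=> aG; split; first by move=> i; apply: smooth_regop; exact: aG.1.
move=> k L; have [sH bH] := ampD aG (amp_pderiv (var_y j) aG).
have := bdnM (fun _ => smooth_rinv R (var_xi j)) sH (bdn_rinv R I (var_xi j) L) (bH k L).
apply: (bdn_weight ler01) => i p; rewrite mul1r rinv_xi /wt.
by rewrite le_eqVlt; apply/orP; left; apply/eqP; ring.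
Qed.

Lemma amp_foldr_regop U G l : amp w M U G ->
  amp w M (fun xi => U xi * \prod_(j <- l) cmod (rinv j xi)) (fun i => foldr regop (G i) l).
Proof.
move=> aG; elim: l => [|j l IH] /=.
  by apply: amp_le aG => xi; rewrite big_nil mulr1.
apply: amp_le (amp_regop j IH) => xi.
by rewrite big_cons mulrAC -mulrA.
Qed.

Local Notation u2 := (fun xi : 'rV[R]_n => pw xi ^- 2).

Lemma amp2_regop G j : amp w M u2 G -> amp w M u2 (fun i => regop j (G i)).
Proof.
move=> aG; apply: amp_le (amp_regop j aG) => xi.
by rewrite ler_piMr ?pwXV_ge0 ?cmod_rinv_le1.
Qed.

(** The two integrands differ by the [y_j]-derivative of [phase * rinv * G], whose integral is 0;
    [rinv] depends only on [xi] and is not differentiated. *)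
Lemma osc_regop G j i x : amp w M u2 G -> osc G i x = osc (fun i => regop j (G i)) i x.
Proof.
move=> aG; have aB := amp2_regop j aG.
have [C C0 HC] := phase_dom w0 aG; have [D D0 HD] := phase_dom w0 aB.
pose F p := phase p * (rinv (var_xi j) p * G i p).
have sr : smooth (rinv (var_xi j) : V3 -> R[i]) := smooth_rinv R _.
have sF : smooth F.
  by apply: smoothM; [exact: smooth_phase|exact: (smoothM sr (aG.1 i))].
have rG := @rinvK R _ (var_xi j).
have dF p : pderiv (var_y j) F p = phase p * regop j (G i) p + -1 * (phase p * G i p).
  rewrite pderivM; [|exact: smooth_phase|exact: (smoothM sr (aG.1 i))].
  rewrite (pderivM _ sr (aG.1 i)).
  have -> : pderiv (var_y j) (rinv (var_xi j)) p = 0 :> R[i].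
    rewrite pderivE (is_cder_cD (is_cder_rinv _ _ _)) mxE /var_xi /var_y eq_rlshift andbF.
    by rewrite mulr0 mul0r.
  rewrite pderiv_phase_y.
  have := rG p; rewrite coord_xi /regop; set r := rinv _ _ => h.
  have -> : phase p * G i p = (r * (1 + 'i * (pxi p 0 j)%:C)) * (phase p * G i p).
    by rewrite h mul1r.
  rewrite mul0r add0r; ring.
have dom_dF : dom3 (pderiv (var_y j) F)
    (D * w i * pw x ^+ M + cmod (-1) * (C * w i * pw x ^+ M)) x.
  by move=> y xi; rewrite dF; exact: (dom3D (HD i x) (dom3Z (-1) (HC i x))).
have domF : dom3 F (C * w i * pw x ^+ M) x.
  move=> y xi; rewrite (le_trans _ (HC i x y xi))// /F 2!(cmodM (phase _)) (cmodM (rinv _ _)) mulrCA.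
  by rewrite ler_piMl ?cmod_rinv_le1 ?mulr_ge0 ?cmod_ge0.
have := int3_pderiv_y sF domF dom_dF.
have -> : pderiv (var_y j) F =
    fun p => phase p * regop j (G i) p + -1 * (phase p * G i p) by apply/funext.
have cG := smooth_ccont (phase_smooth i aG); have cB := smooth_ccont (phase_smooth i aB).
rewrite (int3D cB (ccontM (@ccont_cst R _ (-1)) cG) (HD i x) (dom3Z (-1) (HC i x))).
rewrite (int3Z _ cG (HC i x)) mulN1r => /eqP.
by rewrite subr_eq0 => /eqP/esym.
Qed.

Lemma osc_foldr_regop G l i x : amp w M u2 G ->
  osc G i x = osc (fun i => foldr regop (G i) l) i x.
Proof.
move=> aG; suff [] : amp w M u2 (fun i => foldr regop (G i) l) /\
  osc G i x = osc (fun i => foldr regop (G i) l) i x by [].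
elim: l => [//|j l [aH ->]] /=; split; first exact: amp2_regop.
exact: osc_regop.
Qed.

End fix_family.

(** Each round lists every coordinate twice: the squared modulus of [rinv j] is
    [(1 + xi_j ^+ 2)^-1], so one round gains exactly one power of [pw xi]. *)
Definition regidx K := flatten (nseq K (enum 'I_n ++ enum 'I_n)).

Lemma regidx_prod K (xi : 'rV[R]_n) :
  \prod_(j <- regidx K) cmod (rinv j xi) = pw xi ^- K.
Proof.
rewrite /regidx; elim: K => [|K IH]; first by rewrite big_nil expr0 invr1.
rewrite /= 2!big_cat/= IH -big_split/= exprS invfM; congr (_ * _).
rewrite /pw -prodfV big_enum/=; apply: eq_bigr => j _.
by rewrite -expr2 cmod_rinv_sq.
Qed.

End integration_by_parts.

(** * The cutoffs psi(hy, h xi) *)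

Section cutoff.
Variables (R : realType) (n : nat).
Local Notation V3 := 'rV[R]_(n + n + n).
Implicit Types (psi : 'rV[R]_(n + n) -> R[i]).

Definition cutoff psi (h : R) (p : V3) := psi (row_mx (h *: py p) (h *: pxi p)).

Definition projyxi : 'M[R]_(n + n + n, n + n) :=
  col_mx (col_mx 0 (row_mx 1%:M 0)) (row_mx 0 1%:M).

Lemma cutoffE psi h : cutoff psi h = fun p => psi (p *m (h *: projyxi) + 0).
Proof.
apply/funext => p; rewrite /cutoff addr0 -scale_row_mx -scalemxAr; congr (psi (h *: _)).
rewrite -{3}(pt3K p) /pt3 /projyxi !mul_row_col mulmx0 add0r !mul_mx_row.
by rewrite !mulmx0 !mulmx1 add_row_mx add0r addr0.
Qed.

Lemma smooth_cutoff psi h : smooth psi -> smooth (cutoff psi h).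
Proof. by rewrite cutoffE; exact: smooth_affine. Qed.

Lemma cvn_ccst N L (c : nat -> R[i]) l : ccvg c l ->
  cvn L (fun k (_ : 'rV[R]_N) => c k) (fun=> l).
Proof.
elim: L c l => [|L IH] c l cl; split=> // j.
have := IH (fun=> 0) 0 (ccvg_cst 0); congr cvn; last by rewrite pderiv_cst.
by apply/funext => k; rewrite pderiv_cst.
Qed.

Lemma cvn_sum N L (J : Type) (r : seq J) (F : J -> nat -> 'rV[R]_N -> R[i]) G :
  (forall j, sfam (F j)) -> (forall j, smooth (G j)) -> (forall j, cvn L (F j) (G j)) ->
  cvn L (fun k x => \sum_(j <- r) F j k x) (fun x => \sum_(j <- r) G j x).
Proof.
move=> sF sG FG; elim: r => [|j r IH].
  have := @cvn_cst R N L (fun=> 0); congr cvn; last by apply/funext => x; rewrite big_nil.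
  by apply/funext => k; apply/funext => x; rewrite big_nil.
have := cvnD (sF j) (fun k => smooth_sum r (fun j => sF j k)) (sG j) (smooth_sum r sG) (FG j) IH.
congr cvn; last by apply/funext => x; rewrite big_cons.
by apply/funext => k; apply/funext => x; rewrite big_cons.
Qed.

Lemma scalemxE N L (a : R) (A : 'M[R]_(N, L)) i j : (a *: A) i j = a * A i j.
Proof. by rewrite mxE. Qed.

(** Every differentiation of the cutoff releases a factor [u k], which tends to 0; so all
    derivatives converge to those of the constant [psi 0]. *)
Lemma cvn_cutoff L psi (u : nat -> R) : smooth psi -> u @ \oo --> 0 ->
  cvn L (fun k => cutoff psi (u k)) (fun=> psi 0).
Proof.
move=> spsi u0; elim: L psi spsi => [|L IH] psi spsi.
  split=> // p; rewrite /ccvg; under eq_fun do rewrite /cutoff -scale_row_mx.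
  under [X in _ /\ (X @ _ --> _)]eq_fun do rewrite /cutoff -scale_row_mx.
  have h : (fun k => u k *: row_mx (py p) (pxi p)) @ \oo --> (0 : 'rV[R]_(n + n)).
    apply: rV_cvg => j; rewrite [X in _ --> X]mxE.
    under eq_fun do rewrite mxE.
    have H := cvgM u0 (cvg_cst (row_mx (py p) (pxi p) 0 j)).
    by rewrite mul0r in H; exact: H.
  have [c1 c2] := smooth_ccont spsi.
  by split; [exact: (cvg_comp _ _ h (c1 0))|exact: (cvg_comp _ _ h (c2 0))].
split; first exact: cvn0 (IH psi spsi).
move=> c; rewrite pderiv_cst.
have uC b : ccvg (fun k => (u k * b)%:C) 0.
  split => /=; last exact: cvg_cst.
  by have H := cvgM u0 (cvg_cst b); rewrite mul0r in H; exact: H.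
have := @cvn_sum _ L _ (index_enum 'I_(n + n))
  (fun j k p => (u k * projyxi c j)%:C * cutoff (pderiv j psi) (u k) p)
  (fun j p => 0 * pderiv j psi 0).
rewrite (_ : (fun k p => _) = fun k => pderiv c (cutoff psi (u k))); last first.
  apply/funext => k; rewrite cutoffE (pderiv_affine _ _ _ spsi); apply/funext => p.
  by apply: eq_bigr => j _; rewrite cutoffE scalemxE.
rewrite (_ : (fun p : V3 => \sum_(j <- _) 0 * pderiv j psi 0) = fun=> 0); last first.
  by apply/funext => p; rewrite big1// => j _; rewrite mul0r.
apply.
- by move=> j k; apply/smoothZ/smooth_cutoff/smooth_pderiv.
- by move=> j; apply/smooth_cst.
- move=> j; apply: cvnM.
  + by move=> k; exact: smooth_cst.
  + by move=> k; apply/smooth_cutoff/smooth_pderiv.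
  + exact: smooth_cst.
  + exact: smooth_cst.
  + exact: cvn_ccst.
  + by apply/IH/smooth_pderiv.
Qed.

Lemma mx_entry_bound N L (A : 'M[R]_(N, L)) : exists2 c : R, 0 <= c &
  forall i j, `|A i j| <= c.
Proof.
exists (\sum_i \sum_j `|A i j|).
  by apply: sumr_ge0 => i _; apply: sumr_ge0.
move=> i j; rewrite (bigD1 i)//= (bigD1 j)//= -addrA lerDl addr_ge0//.
  by apply: sumr_ge0.
by apply: sumr_ge0 => k _; apply: sumr_ge0.
Qed.

Lemma bdn_cutoff (J : Type) L psi (u : J -> R) (c : R) k : (forall j, `|u j| <= c) ->
  0 <= c -> smooth psi -> rapid1 psi ->
  bdn L (fun j => cutoff psi (u j))
    (fun j p => pw (row_mx (u j *: py p) (u j *: pxi p)) ^- k).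
Proof.
move=> uc c0 spsi rpsi; have [B B0 HB] := mx_entry_bound projyxi.
have rp := bdn_reindex (fun _ : J => tt) (rpsi k L).
have hA j i l : `|(u j *: projyxi) i l| <= c * B by rewrite scalemxE normrM ler_pM.
have hW (j : J) (q : 'rV[R]_(n + n)) : 0 <= 1 * pw q ^- k by rewrite mul1r pwXV_ge0.
have := bdn_affine (fun=> 0) (mulr_ge0 c0 B0) hA hW (fun _ => spsi) rp.
congr bdn; apply/funext => j; first by rewrite cutoffE.
apply/funext => p; rewrite mul1r; congr (_ ^- _).
by have := congr1 (fun f => f p) (cutoffE (fun q => (pw q)%:C) (u j)) => -[].
Qed.

End cutoff.

(** * Existence and value of the oscillatory integral *)

Section oscillatory_limit.
Variables (R : realType) (n : nat).
Local Notation V3 := 'rV[R]_(n + n + n).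
Local Notation mu2 := (lebesgue_tuple R n \x lebesgue_tuple R n)%E.
Implicit Types (psi : 'rV[R]_(n + n) -> R[i]) (g : V3 -> R[i]).

Lemma pw_unscale N (h : R) (x : 'rV[R]_N) : h != 0 ->
  pw x <= (1 + h ^- 2) ^+ N * pw (h *: x).
Proof.
move=> h0; rewrite /pw -[X in _ ^+ X]card_ord -prodr_const -big_split/=.
apply: prod_le => i; rewrite sq1_ge0 /= mxE.
have h2 : 0 < h ^- 2 by rewrite invr_gt0 exprn_even_gt0.
have -> : (1 + h ^- 2) * (1 + (h * x 0 i) ^+ 2) =
    1 + x 0 i ^+ 2 + (h ^- 2 + (h * x 0 i) ^+ 2) by field.
by rewrite lerDl addr_ge0 ?sqr_ge0 ?ltW.
Qed.

Section fix_g.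
Variables (g : V3 -> R[i]) (M K : nat).
Hypothesis ag : amp (fun _ : unit => 1 : R) M (fun xi => pw xi ^+ K) (fun _ => g).

Let one_ge0 (J : Type) (j : J) : 0 <= (1 : R). Proof. exact: ler01. Qed.

(** For fixed [h] the decay of [psi] beats the growth of [g] in [xi], which justifies integrating by
    parts. The constant blows up as [h] tends to 0, so this bound cannot be used in the limit. *)
Lemma amp_cutoff psi (h : R) : smooth psi -> rapid1 psi -> 0 < h ->
  amp (fun _ : unit => 1) M (fun xi => pw xi ^- 2) (fun _ p => g p * cutoff psi h p).
Proof.
move=> spsi rpsi h0; split; first by move=> _; apply: smoothM (ag.1 tt) (smooth_cutoff h spsi).
move=> k L.
have hh : forall j : unit, `|h| <= h by move=> _; rewrite gtr0_norm.
have := bdnM ag.1 (fun _ => smooth_cutoff h spsi) (ag.2 k L)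
  (bdn_cutoff (u := fun _ : unit => h) L (K + 2) hh (ltW h0) spsi rpsi).
pose c : R := ((1 + h ^- 2) ^+ n) ^+ (K + 2).
have c0 : 0 <= c by rewrite !exprn_ge0// addr_ge0// invr_ge0 sqr_ge0.
apply: (bdn_weight c0) => i p; rewrite /wt !mul1r.
have q0 := pw_gt0 (pxi p); have hq0 := pw_gt0 (row_mx (h *: py p) (h *: pxi p)).
have le1 : pw (row_mx (h *: py p) (h *: pxi p)) ^- (K + 2) <= c * pw (pxi p) ^- (K + 2).
  rewrite ler_pdivlMr ?exprn_gt0// mulrC ler_pdivrMr ?exprn_gt0// /c -exprMn.
  have A0 : 0 <= (1 + h ^- 2) ^+ n by rewrite exprn_ge0// addr_ge0// invr_ge0 sqr_ge0.
  apply: lerXn2r; rewrite ?nnegrE; [exact: ltW|exact: mulr_ge0 A0 (ltW hq0)|].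
  rewrite (le_trans (pw_unscale (pxi p) (lt0r_neq0 h0)))//.
  rewrite ler_wpM2l ?exprn_ge0 ?addr_ge0 ?invr_ge0 ?sqr_ge0// pw_row_mx.
  by rewrite ler_peMl ?pw_ge1// ltW ?pw_gt0.
rewrite [leRHS]mulrCA [X in _ <= _ * X]mulrCA -!mulrA ler_wpM2l ?pwX_ge0// ler_wpM2l ?pwXV_ge0//.
rewrite (le_trans (ler_wpM2l (pwX_ge0 _ _) le1))// mulrCA ler_wpM2l//.
by rewrite exprD invfM mulrA divff ?mul1r// gt_eqF ?exprn_gt0.
Qed.

(** Uniform along the sequence: the cutoffs are merely used as bounded functions, and the growth
    [pw xi ^+ K] remains. *)
Lemma amp_cutoffs psi (u : nat -> R) (c : R) : smooth psi -> rapid1 psi -> 0 <= c ->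
  (forall k, `|u k| <= c) ->
  amp (fun _ : nat => 1) M (fun xi => pw xi ^+ K) (fun k p => g p * cutoff psi (u k) p).
Proof.
move=> spsi rpsi c0 uc; split; first by move=> k; apply: smoothM (ag.1 tt) (smooth_cutoff (u k) spsi).
move=> k L.
have := bdnM (fun _ => ag.1 tt) (fun k => smooth_cutoff (u k) spsi)
  (bdn_reindex (fun _ : nat => tt) (ag.2 k L)) (bdn_cutoff L 0 uc c0 spsi rpsi).
apply: (bdn_weight ler01) => i p.
by rewrite expr0 invr1 mulr1 mul1r /wt.
Qed.

(** For each [k], [amp_cutoff] permits [K + 2] rounds of integration by parts. After them
    [amp_cutoffs] yields decay of order 2 uniformly in [k], and dominated convergence applies. *)
Lemma osc_limit psi (u : nat -> R) x : smooth psi -> rapid1 psi -> psi 0 = 1 ->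
  (forall k, 0 < u k) -> u @ \oo --> 0 ->
  ccvg (fun k => int3 (fun p => phase p * (g p * cutoff psi (u k) p)) x)
    (osc (fun _ : unit => foldr (@regop R n) g (regidx n (K + 2))) tt x).
Proof.
move=> spsi rpsi psi0 u_gt0 u0.
set l := regidx n _.
(* A convergent sequence is bounded: all but finitely many terms by 1, the others by the sum of
   their moduli. *)
have [c uc] : exists c : R, forall k, `|u k| <= c.
  have /(cvgrPdist_le _ _).1 /(_ 1 ltr01)[N _ HN] := u0.
  exists (1 + \sum_(i < N) `|u i|) => k; case: (leqP N k) => [/HN|kN].
    by rewrite sub0r normrN => h; rewrite (le_trans h)// lerDl sumr_ge0.
  by rewrite (bigD1 (Ordinal kN))//= addrCA lerDl addr_ge0// sumr_ge0.
have c0 : 0 <= c by exact: le_trans (uc 0%N).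
have aN := amp_cutoffs spsi rpsi c0 uc.
pose F k := foldr (@regop R n) (fun p => g p * cutoff psi (u k) p) l.
pose G := foldr (@regop R n) g l.
have E k : int3 (fun p => phase p * (g p * cutoff psi (u k) p)) x =
    int3 (fun p => phase p * F k p) x.
  exact: (osc_foldr_regop (@one_ge0 _) l tt x (amp_cutoff spsi rpsi (u_gt0 k))).
under eq_fun do rewrite E.
have aF : amp (fun _ : nat => 1) M (fun xi => pw xi ^- 2) F.
  apply: amp_le (amp_foldr_regop (@one_ge0 _) l aN); first exact: one_ge0.
  move=> xi; rewrite regidx_prod exprD invfM mulrA divff ?mul1r// gt_eqF ?pwX_gt0//.
have [C C0 HC] := phase_dom (@one_ge0 _) aF.
have sG : smooth G by exact: (smooth_foldr_regop l (ag.1 tt)).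
apply: (@Cintegral_cvg _ _ _ mu2 _ _
  (fun p => (C * 1 * pw x ^+ M) * ((pw (vec p.1))^-1 * (pw (vec p.2))^-1))).
- by move=> k; exact: (Cmeas_pt3 x (smooth_ccont (phase_smooth k aF))).
- exact: (Cmeas_pt3 x (ccontM (smooth_ccont (@smooth_phase R n)) (smooth_ccont sG))).
- move=> p; apply: ccvgM; first exact: ccvg_cst.
  apply: (cvn0 (L := 0)); apply: (@cvn_foldr_regop _ _ l).
  + by move=> k; exact: smoothM (ag.1 tt) (smooth_cutoff (u k) spsi).
  + exact: ag.1.
  + have := cvnM (fun _ => ag.1 tt) (fun k => smooth_cutoff (u k) spsi) (ag.1 tt)
      (@smooth_cst R _ (psi 0)) (@cvn_cst R _ (0 + size l) g) (cvn_cutoff (0 + size l) spsi u0).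
    congr cvn; apply/funext => q; by rewrite psi0 mulr1.
- exact: integrable_pwV2.
- by move=> k p; exact: HC.
Qed.

Lemma is_oscint_osc x : is_oscint
  (fun y xi => expi (dot (x - y) xi) * g (pt3 x y xi))
  (osc (fun _ : unit => foldr (@regop R n) g (regidx n (K + 2))) tt x).
Proof.
move=> psi /schwartzP[spsi rpsi] psi0 J.
have -> : J = fun h => int3 (fun p => phase p * (g p * cutoff psi h p)) x.
  apply/funext => h; rewrite /J /int3; congr int_R2n; apply/funext => y; apply/funext => xi.
  by rewrite /phase /cutoff px_pt3 py_pt3 pxi_pt3 mulrA.
split; apply/cvg_at_rightP => u [u_gt0 u0].
- exact: (osc_limit x spsi rpsi psi0 u_gt0 u0).1.
- exact: (osc_limit x spsi rpsi psi0 u_gt0 u0).2.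
Qed.

End fix_g.
(* Without such a test function, [is_oscint F] would hold of every value. *)
Lemma schwartz_at0 (phi : 'rV[R]_n -> R[i]) : schwartz phi -> int_Rn phi = 1 ->
  exists2 psi : 'rV[R]_(n + n) -> R[i], schwartz psi & psi 0 = 1.
Proof.
move=> /schwartzP[sphi rphi] iphi.
(* A mollifier cannot vanish identically, since its integral is 1. *)
have [x0 phi0] : exists x0, phi x0 != 0.
  apply: contrapT => nE; have phi0 : phi = fun=> 0.
    by apply/funext => x; apply/eqP; apply: contrapT => /negP px; apply: nE; exists x.
  have d0 : L1dom (fun _ : 'rV[R]_n => 0 : R[i]) 0 by move=> x; rewrite cmod0 mul0r.
  have := CintegralZ 0 (L1dom_Cint (@ccont_cst R n 0) d0).
  rewrite !mul0r (_ : (fun t => _) = fun t => phi (vec t)); last first.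
    by apply/funext => t; rewrite phi0.
  rewrite -/(int_Rn phi) iphi => /eqP; by rewrite oner_eq0.
pose A : 'M[R]_(n + n, n) := col_mx 1%:M 0.
pose B : 'M[R]_(n + n, n) := col_mx 0 1%:M.
have AE q : q *m A = lsubmx q.
  by rewrite -{1}(hsubmxK q) mul_row_col mulmx1 mulmx0 addr0.
have BE q : q *m B = rsubmx q.
  by rewrite -{1}(hsubmxK q) mul_row_col mulmx1 mulmx0 add0r.
pose F (D : 'M[R]_(n + n, n)) q := phi (q *m D + x0).
have sF D : smooth (F D) by exact: smooth_affine.
have bF (D : 'M[R]_(n + n, n)) k L :
    bdn L (fun _ : unit => F D) (fun _ q => pw (q *m D) ^- k).
  have [c c0 hc] := mx_entry_bound D.
  have W0 (i : unit) (x : 'rV[R]_n) : 0 <= 1 * pw x ^- k by rewrite mul1r pwXV_ge0.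
  have := bdn_affine (fun=> x0) c0 (fun _ : unit => hc) W0 (fun _ => sphi) (rphi k L).
  have C0 : 0 <= 2 ^+ (n * k) * pw (- x0) ^+ k by rewrite mulr_ge0 ?pwX_ge0 ?exprn_ge0.
  apply: (bdn_weight C0) => i q; rewrite mul1r -mulrA -[x0 in leLHS]opprK.
  exact: pw_subV.
(* [psi] is the tensor square of [phi] translated to the point [x0] where it does not vanish,
   normalised at the origin. *)
pose c := (phi x0)^-1 * (phi x0)^-1.
exists (fun q => c * (F A q * F B q)); last first.
  by rewrite /F !mul0mx !add0r /c mulrACA !mulVf// mulr1.
apply/schwartzP; split; first exact: (smoothZ c (smoothM (sF A) (sF B))).
move=> k L; apply: (bdnZ (cmod_ge0 c)) => //.
  by move=> _; exact: (smoothM (sF A) (sF B)).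
have := bdnM (fun _ => sF A) (fun _ => sF B) (bF A k L) (bF B k L).
congr bdn; apply/funext => i; apply/funext => q.
by rewrite AE BE mul1r -{3}(hsubmxK q) pw_row_mx exprMn invfM.
Qed.

Lemma is_oscint_unique (F : 'rV[R]_n -> 'rV[R]_n -> R[i]) L L' (psi : 'rV[R]_(n + n) -> R[i]) : schwartz psi -> psi 0 = 1 ->
  is_oscint F L -> is_oscint F L' -> L = L'.
Proof.
move=> spsi psi0 /(_ psi spsi psi0)/=[h1 h2] /(_ psi spsi psi0)/=[h1' h2'].
by apply: ceq; [exact: cvg_unique h1 h1'|exact: cvg_unique h2 h2'].
Qed.

(** [phi] enters only to supply a test function, which makes the limit unique and hence selected by
    [xget]. *)
Lemma oscintE (phi : 'rV[R]_n -> R[i]) g M K x : schwartz phi -> int_Rn phi = 1 ->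
  amp (fun _ : unit => 1 : R) M (fun xi => pw xi ^+ K) (fun _ => g) ->
  oscint (fun y xi => expi (dot (x - y) xi) * g (pt3 x y xi)) =
  osc (fun _ : unit => foldr (@regop R n) g (regidx n (K + 2))) tt x.
Proof.
move=> sphi iphi ag; have [psi spsi psi0] := schwartz_at0 sphi iphi.
apply: xget_unique; first exact: is_oscint_osc ag x.
by move=> L HL; exact: (is_oscint_unique spsi psi0 HL (is_oscint_osc ag x)).
Qed.

End oscillatory_limit.

(** * The pseudo-differential operator *)

Section amplitude_bound.
Variables (R : realType) (n : nat).
Local Notation V3 := 'rV[R]_(n + n + n).

(** A real power of either sign: for [m >= 0] the upper bound on [t] is used, for [m < 0] the lower
    one, which makes [t] to the power [m] bounded. *)
Lemma powR_growth (m lo hi : R) : 0 < lo -> exists C : R, exists N : nat, 0 <= C /\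
  forall t J, 1 <= J -> lo <= t -> t <= hi * J -> t `^ m <= C * J ^+ N.
Proof.
move=> lo0; pose h1 := Num.max 1 hi; pose N := Num.bound `|m|.
have h1_ge1 : 1 <= h1 by rewrite le_max lexx.
have mN : `|m| <= N%:R by rewrite ltW// archi_boundP.
exists (h1 ^+ N + lo `^ m), N; split; first by rewrite addr_ge0 ?exprn_ge0 ?powR_ge0// (le_trans ler01).
move=> t J J1 lot tJ; have J0 : 0 <= J by rewrite (le_trans ler01).
have JN : 1 <= J ^+ N by rewrite exprn_ege1.
rewrite mulrDl; case: (leP 0 m) => m0.
  apply: ler_wpDr; first by rewrite mulr_ge0 ?powR_ge0// (le_trans ler01).
  have h1J : 1 <= h1 * J by rewrite mulr_ege1.
  apply: (@le_trans _ _ ((h1 * J) `^ m)).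
    apply: ge0_ler_powR; rewrite ?nnegrE//.
    - by rewrite (le_trans (ltW lo0)).
    - by rewrite (le_trans ler01).
    - by rewrite (le_trans tJ)// ler_wpM2r// le_max lexx orbT.
  rewrite -exprMn -powR_mulrn; last by rewrite (le_trans ler01).
  by apply: ler_powR => //; rewrite (le_trans (ler_norm m)).
apply: ler_wpDl; first by rewrite mulr_ge0 ?exprn_ge0// ?(le_trans ler01).
apply: (@le_trans _ _ (lo `^ m)); last by rewrite ler_peMr ?powR_ge0.
rewrite -[m]opprK (powRN t) (powRN lo) lef_pV2 ?posrE ?powR_gt0//; last exact: (lt_le_trans lo0 lot).
apply: ge0_ler_powR; rewrite ?nnegrE ?oppr_ge0//; [exact: ltW|exact: ltW|].
by rewrite (le_trans (ltW lo0)).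
Qed.

(** Sorts the variables into the order in which [classical_amplitude] takes its derivatives. *)
Lemma perm_groups (s : seq 'I_(n + n + n)) : exists alpha beta gamma : {ffun 'I_n -> nat},
  perm_eq s (mseq (@var_xi n) alpha ++ mseq (@var_x n) beta ++ mseq (@var_y n) gamma).
Proof.
exists [ffun i => count_mem (var_xi i) s], [ffun i => count_mem (var_x i) s],
  [ffun i => count_mem (var_y i) s].
have xy (i k : 'I_n) : (var_x i == var_y k) = false by rewrite (inj_eq (@lshift_inj _ _)) eq_lrshift.
have xz (i k : 'I_n) : (var_x i == var_xi k) = false by rewrite eq_lrshift.
have yz (i k : 'I_n) : (var_y i == var_xi k) = false by rewrite eq_lrshift.
have xx (i k : 'I_n) : (var_x i == var_x k) = (i == k) by rewrite !(inj_eq (@lshift_inj _ _)).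
have yy (i k : 'I_n) : (var_y i == var_y k) = (i == k).
  by rewrite (inj_eq (@lshift_inj _ _)) (inj_eq (@rshift_inj _ _)).
have zz (i k : 'I_n) : (var_xi i == var_xi k) = (i == k) by rewrite (inj_eq (@rshift_inj _ _)).
have one (F : 'I_n -> nat) k : (\sum_i (i == k) * F i = F k)%N.
  rewrite (bigD1 k)//= eqxx mul1n big1 ?addn0// => i ik.
  by rewrite (negbTE ik).
have zero (F : 'I_n -> nat) : (\sum_i false * F i = 0)%N by rewrite big1.
apply/allP => v _ /=; apply/eqP; rewrite !count_cat !count_mseq.
have [k [|[|]]] : exists k, v = var_x k \/ v = var_y k \/ v = var_xi k.
- case: (split_ordP v) => [j ->|k ->]; last by exists k; right; right.
  case: (split_ordP j) => [k ->|k ->]; exists k; [by left|by right; left].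
- move=> ->; under eq_bigr do rewrite eq_sym xz.
  under [X in (_ + (X + _))%N]eq_bigr do rewrite xx.
  under [X in (_ + (_ + X))%N]eq_bigr do rewrite eq_sym xy.
  by rewrite !zero one ffunE addn0.
- move=> ->; under eq_bigr do rewrite eq_sym yz.
  under [X in (_ + (X + _))%N]eq_bigr do rewrite xy.
  under [X in (_ + (_ + X))%N]eq_bigr do rewrite yy.
  by rewrite !zero one ffunE.
- move=> ->; under eq_bigr do rewrite zz.
  under [X in (_ + (X + _))%N]eq_bigr do rewrite xz.
  under [X in (_ + (_ + X))%N]eq_bigr do rewrite yz.
  by rewrite !zero one ffunE !addn0.
Qed.

(** The last factor of the estimate is at most 1 and the first two have exponents independent of the
    derivative; hence a single [M] serves every order [L]. *)
Lemma amplitude_bound (a : V3 -> R[i]) : classical_amplitude a ->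
  smooth a /\ exists M : nat, forall L,
    bdn L (fun _ : unit => a) (fun _ p => (pw (px p) * pw (py p) * pw (pxi p)) ^+ M).
Proof.
move=> [sa [Lam [m [rho [m' [[_ [[mu [mu0 [[c c0 Lam_ge] [c' c'0 Lam_le]] _]] _]] /andP[rho0 _] Ha]]]]]].
split=> //.
have jb0 N (z : 'rV[R]_N) : 0 < jb z by rewrite (lt_le_trans ltr01)// jb_ge1.
(* The exponent [mu] is positive and [jb] is at least 1, so the weight function stays away from 0,
   as negative [m] requires. *)
have Lam_lo z : c^-1 <= Lam z.
  rewrite -[c^-1]mul1r ler_pdivrMr// mulrC (le_trans _ (Lam_ge z _))//.
  by rewrite -[leLHS](powRr0 (jb z)) ler_powR ?jb_ge1// ltW.
have Lam0 z : 0 < Lam z by rewrite (lt_le_trans _ (Lam_lo z))// invr_gt0.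
have [C1 [N1 [C10 H1]]] := @powR_growth m c^-1 c' ltac:(by rewrite invr_gt0).
have [C2 [N2 [C20 H2]]] := powR_growth m' 1 ltr01.
pose P p : R := pw (px p) * pw (py p) * pw (pxi p).
exists (N1 + N2)%N => L; apply: foldr_bdn => s _.
have [alpha [beta [gamma sp]]] := perm_groups s.
have [C C0 HC] := Ha alpha beta gamma.
exists (C * (C1 * (C2 * (2 ^+ n) ^+ N2))).
  by rewrite !mulr_ge0 ?exprn_ge0// ltW.
move=> _ p; rewrite (foldr_pderiv_perm sa sp) !foldr_cat -!mderivE -(pt3K p).
move: (px p) (py p) (pxi p) => x y xi; rewrite px_pt3 py_pt3 pxi_pt3.
rewrite (le_trans (HC x y xi))//.
(* The base is at least 1 and the exponent is nonpositive because [rho > 0]. *)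
have last_le : (1 + Lam (row_mx x xi) * jb (x - y) `^ (- m'))
    `^ (- (rho * (mlen (alpha + beta + gamma)%R)%:R)) <= 1.
  rewrite -[leRHS](powRr0 (1 + Lam (row_mx x xi) * jb (x - y) `^ (- m'))).
  apply: ler_powR; first by rewrite lerDl mulr_ge0 ?powR_ge0// ltW.
  by rewrite oppr_le0 mulr_ge0// ltW.
have b1 : Lam (row_mx x xi) `^ m <= C1 * (pw x * pw xi) ^+ N1.
  have := H1 _ (jb (row_mx x xi)) (jb_ge1 _) (Lam_lo _) (Lam_le _ I).
  move=> h; rewrite (le_trans h)// ler_wpM2l//; apply: lerXn2r; rewrite ?nnegrE.
  - exact: ltW.
  - by rewrite mulr_ge0 ?ltW ?pw_gt0.
  - by rewrite -pw_row_mx jb_le_pw.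
have b2 : jb (x - y) `^ m' <= C2 * (2 ^+ n * (pw x * pw y)) ^+ N2.
  have := H2 (jb (x - y)) (jb (x - y)) (jb_ge1 _) (jb_ge1 _).
  rewrite mul1r => /(_ (lexx _)) h; rewrite (le_trans h)// ler_wpM2l//.
  apply: lerXn2r; rewrite ?nnegrE.
  - exact: ltW.
  - by rewrite !mulr_ge0 ?exprn_ge0// ltW// pw_gt0.
  - by rewrite (le_trans (jb_le_pw _))// pw_sub.
have x1 := pw_ge1 x; have y1 := pw_ge1 y; have xi1 := pw_ge1 xi.
have x0 := pw_gt0 x; have y0 := pw_gt0 y; have xi0 := pw_gt0 xi.
apply: (@le_trans _ _ (C * (C1 * (pw x * pw xi) ^+ N1) * (C2 * (2 ^+ n * (pw x * pw y)) ^+ N2) * 1)).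
  apply: ler_pM; rewrite ?powR_ge0//.
    by rewrite !mulr_ge0 ?powR_ge0// ltW.
  apply: ler_pM; rewrite ?powR_ge0//.
    by rewrite mulr_ge0 ?powR_ge0// ltW.
  by rewrite ler_wpM2l// ltW.
rewrite mulr1 exprD.
have xy0 := mulr_gt0 x0 y0; have xyxi0 := mulr_gt0 xy0 xi0.
have e1 : (pw x * pw xi) ^+ N1 <= (pw x * pw y * pw xi) ^+ N1.
  apply: lerXn2r; rewrite ?nnegrE; [exact: mulr_ge0 (ltW x0) (ltW xi0)|exact: ltW|].
  by rewrite (ler_wpM2r (ltW xi0))// (ler_peMr (ltW x0)).
have e2 : (pw x * pw y) ^+ N2 <= (pw x * pw y * pw xi) ^+ N2.
  apply: lerXn2r; rewrite ?nnegrE; [exact: ltW|exact: ltW|].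
  by rewrite (ler_peMr (ltW xy0)).
rewrite [X in C2 * X]exprMn.
have -> : C * (C1 * (pw x * pw xi) ^+ N1) * (C2 * ((2 ^+ n) ^+ N2 * (pw x * pw y) ^+ N2)) =
   C * (C1 * (C2 * (2 ^+ n) ^+ N2)) * ((pw x * pw xi) ^+ N1 * (pw x * pw y) ^+ N2) by ring.
apply: ler_wpM2l; first by rewrite !mulr_ge0 ?exprn_ge0// ltW.
by apply: ler_pM e1 e2; rewrite exprn_ge0// ltW// mulr_gt0.
Qed.

End amplitude_bound.

(** * The operator on rapidly decreasing families *)

Section operator.
Variables (R : realType) (n : nat) (a : 'rV[R]_(n + n + n) -> R[i]) (M : nat).
Local Notation V := 'rV[R]_n.
Local Notation V3 := 'rV[R]_(n + n + n).
Hypothesis sa : smooth a.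
Hypothesis ba : forall L, bdn L (fun _ : unit => a)
  (fun _ p => (pw (px p) * pw (py p) * pw (pxi p)) ^+ M).

Definition prody : 'M[R]_(n + n + n, n) := col_mx (col_mx 0 1%:M) 0.

Lemma pyE p : py p = p *m prody + 0.
Proof.
by rewrite addr0 -{2}(pt3K p) /pt3 !mul_row_col !mulmx0 mulmx1 add0r addr0.
Qed.

Lemma smooth_py (f : V -> R[i]) : smooth f -> smooth (fun p => f (py p)).
Proof.
move=> sf; have := smooth_affine prody 0 sf; congr smooth.
by apply/funext => p; rewrite pyE.
Qed.

Definition integrand (f : V -> R[i]) p := a p * f (py p).

Lemma smooth_integrand f : smooth f -> smooth (integrand f).
Proof. by move=> sf; exact: (smoothM sa (smooth_py sf)). Qed.

(** Decay of [u] of order [M + k] absorbs the growth of [a] in [y] and leaves order [k]; the growth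
    of [a] in [x] and [xi] remains. *)
Lemma amp_integrand (I : Type) (w : I -> R) (u : I -> V -> R[i]) :
  (forall i, 0 <= w i) -> sfam u -> rapid w u ->
  amp w M (fun xi => pw xi ^+ M) (fun i => integrand (u i)).
Proof.
move=> w0 su ru; split; first by move=> i; exact: smooth_integrand.
move=> k L; have [c c0 hc] := mx_entry_bound prody.
have W0 i (x : V) : 0 <= w i * pw x ^- (M + k) by rewrite mulr_ge0 ?pwXV_ge0.
have bu := bdn_affine (fun=> 0) c0 (fun _ : I => hc) W0 su (ru (M + k)%N L).
have bu' : bdn L (fun i p => u i (py p)) (fun i p => w i * pw (py p) ^- (M + k)).
  move: bu; congr bdn; apply/funext => i; apply/funext => p; by rewrite pyE.
have := bdnM (fun _ => sa) (fun i => smooth_py (su i)) (bdn_reindex (fun _ : I => tt) (ba L)) bu'.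
apply: (bdn_weight ler01) => i p; rewrite mul1r /wt exprD invfM !exprMn.
have y0 : pw (py p) ^+ M != 0 by rewrite gt_eqF ?pwX_gt0.
rewrite le_eqVlt; apply/orP; left; apply/eqP; field.
by rewrite y0 gt_eqF ?pwX_gt0.
Qed.

(* The absolutely convergent form of the oscillatory integral. *)
Definition psop (f : V -> R[i]) : V -> R[i] :=
  osc (fun _ : unit => foldr (@regop R n) (integrand f) (regidx n (M + 2))) tt.

Lemma amp_psop (I : Type) (w : I -> R) (u : I -> V -> R[i]) :
  (forall i, 0 <= w i) -> sfam u -> rapid w u -> amp w M (fun xi => pw xi ^- 2)
    (fun i => foldr (@regop R n) (integrand (u i)) (regidx n (M + 2))).
Proof.
move=> w0 su ru; apply: amp_le (amp_foldr_regop w0 _ (amp_integrand w0 su ru)) => //.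
by move=> xi; rewrite regidx_prod exprD invfM mulrA divff ?mul1r// gt_eqF ?pwX_gt0.
Qed.

(** The size [w i] passes unchanged from input to output. With [w = 1] this gives stability of the
    Schwartz space, with powers of eps stability of negligible nets. *)
Lemma psop_rapid (I : Type) (w : I -> R) (u : I -> V -> R[i]) :
  (forall i, 0 <= w i) -> sfam u -> rapid w u ->
  sfam (fun i => psop (u i)) /\ rapid w (fun i => psop (u i)).
Proof.
move=> w0 su ru; have au := amp_psop w0 su ru; split.
  by move=> i; exact: (smooth_osc w0 i au).
exact: (osc_rapid w0 au).
Qed.

Lemma regopD j (G H : V3 -> R[i]) : smooth G -> smooth H ->
  regop j (fun p => G p + H p) = fun p => regop j G p + regop j H p.
Proof.
by move=> sG sH; apply/funext => p; rewrite /regop (pderivD _ sG sH); ring.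
Qed.

Lemma foldr_regopD l (G H : V3 -> R[i]) : smooth G -> smooth H ->
  foldr (@regop R n) (fun p => G p + H p) l =
  fun p => foldr (@regop R n) G l p + foldr (@regop R n) H l p.
Proof.
move=> sG sH; elim: l => [|j l IH]; first by [].
rewrite [LHS]/= IH.
exact: (regopD j (smooth_foldr_regop l sG) (smooth_foldr_regop l sH)).
Qed.

Let one_ge0 (j : unit) : 0 <= (1 : R). Proof. exact: ler01. Qed.

Lemma psopD f g x : smooth f -> rapid1 f -> smooth g -> rapid1 g ->
  psop (fun y => f y + g y) x = psop f x + psop g x.
Proof.
move=> sf rf sg rg.
have E : integrand (fun y => f y + g y) = fun p => integrand f p + integrand g p.
  by apply/funext => p; rewrite /integrand mulrDr.
rewrite /psop E (foldr_regopD _ (smooth_integrand sf) (smooth_integrand sg)).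
exact: (oscD one_ge0 tt x (amp_psop one_ge0 (fun=> sf) rf) (amp_psop one_ge0 (fun=> sg) rg)).
Qed.

Lemma oscint_psop (phi f : V -> R[i]) x : schwartz phi -> int_Rn phi = 1 -> smooth f -> rapid1 f ->
  oscint (fun y xi => expi (dot (x - y) xi) * a (pt3 x y xi) * f y) = psop f x.
Proof.
move=> sphi iphi sf rf.
rewrite /psop -(oscintE x sphi iphi (amp_integrand one_ge0 (fun=> sf) rf)).
congr oscint; apply/funext => y; apply/funext => xi.
by rewrite /integrand py_pt3 mulrA.
Qed.

End operator.

(** * Negligible nets and their cosets *)

Section rapid_nets.
Variables (R : realType) (n : nat).
Local Notation V := 'rV[R]_n.
Local Notation net := (R -> V -> R[i]).
Implicit Types (u v : net).

Let e_ge0 q (i : unit_itv R) : 0 <= val i ^+ q.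
Proof. by case: i => e /= /andP[e0 _]; rewrite exprn_ge0 ?ltW. Qed.

Lemma N_SP u : N_S u <-> smooth_net u /\
  forall q, rapid (fun i : unit_itv R => val i ^+ q) (fun i => u (val i)).
Proof.
split=> -[su Hu]; split=> //.
  move=> q; apply: mpow_rapid; first exact: e_ge0.
    by case=> e e01; exact: su.
  move=> alpha beta; have [c Hc] := Hu alpha beta q; exists c => -[e e01] x /=.
  have e0 : 0 < e ^+ q by rewrite exprn_gt0; case/andP: e01.
  by have := Hc e x e01; rewrite mulrC ler_pdivrMr.
move=> alpha beta q; have [c c0 Hc] := rapid_mpow alpha beta (Hu q).
exists c => e x e01; have e0 : 0 < e ^+ q by rewrite exprn_gt0; case/andP: e01.
have := Hc (exist _ e e01) x; rewrite /= => h.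
by rewrite mulrC ler_pdivrMr.
Qed.

Lemma rapidD (I : Type) (w : I -> R) (F G : I -> V -> R[i]) : sfam F -> sfam G ->
  rapid w F -> rapid w G -> rapid w (fun i x => F i x + G i x).
Proof. by move=> sF sG rF rG k L; apply: bdnD. Qed.

Lemma rapidZ (I : Type) (w : I -> R) c (F : I -> V -> R[i]) : sfam F ->
  rapid w F -> rapid w (fun i x => c * F i x).
Proof. by move=> sF rF k L; apply: (bdnZ (cmod_ge0 c)). Qed.

Lemma N_SD u v : N_S u -> N_S v -> N_S (fun e x => u e x + v e x).
Proof.
move=> /N_SP[su ru] /N_SP[sv rv]; apply/N_SP; split.
  by move=> e e01; exact: (smoothD (su e e01) (sv e e01)).
move=> q; apply: rapidD; [by case=> e; exact: su|by case=> e; exact: sv|exact: ru|exact: rv].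
Qed.

Lemma N_SZ c u : N_S u -> N_S (fun e x => c * u e x).
Proof.
move=> /N_SP[su ru]; apply/N_SP; split.
  by move=> e e01; exact: (smoothZ c (su e e01)).
by move=> q; apply: rapidZ; [case=> e; exact: su|exact: ru].
Qed.

(** Nets are total functions of eps, so equality on the meaningful range has to be distinguished
    from equality. *)
Lemma N_S_ext u v : (forall e x, 0 < e <= 1 -> u e x = v e x) -> N_S u -> N_S v.
Proof.
move=> uv; have E e : 0 < e <= 1 -> v e = u e by move=> e01; apply/funext => x; rewrite uv.
move=> [su Hu]; split; first by move=> e e01; rewrite E//; exact: su.
move=> alpha beta q; have [c Hc] := Hu alpha beta q; exists c => e x e01.
by rewrite E//; exact: Hc.
Qed.

Lemma N_S_sub_trans u v w : N_S (fun e x => u e x - v e x) ->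
  N_S (fun e x => v e x - w e x) -> N_S (fun e x => u e x - w e x).
Proof.
move=> uv vw; apply: N_S_ext (N_SD uv vw) => e x _.
by rewrite addrA subrK.
Qed.

Lemma N_S_sub_sym u v : N_S (fun e x => u e x - v e x) -> N_S (fun e x => v e x - u e x).
Proof. by move=> uv; apply: N_S_ext (N_SZ (-1) uv) => e x _; rewrite mulN1r opprB. Qed.

Lemma cls_eq u v : N_S (fun e x => u e x - v e x) -> cls u = cls v.
Proof.
move=> uv; apply/seteqP; split => w /= h; first exact: N_S_sub_trans h uv.
exact: N_S_sub_trans h (N_S_sub_sym uv).
Qed.

End rapid_nets.

(** * The extension property *)

Section extension.
Variables (R : realType) (n : nat) (phi : 'rV[R]_n -> R[i]).
Hypothesis hphi : mollifier phi.
Variable a : 'rV[R]_(n + n + n) -> R[i].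
Hypothesis ha : classical_amplitude a.
Local Notation V := 'rV[R]_n.

Let sphi : schwartz phi. Proof. by case: hphi. Qed.
Let iphi : int_Rn phi = 1. Proof. by case: hphi. Qed.

Lemma embed_schwartz (f : V -> R[i]) : schwartz f ->
  N_S (fun e x => distr f (fun y => moll phi e (x - y)) - f x).
Proof.
move=> /schwartzP[sf rf]; apply/N_SP; split.
  move=> e e01; have := smoothD (conv_smooth hphi sf rf e01) (smoothZ (-1) sf).
  by congr smooth; apply/funext => x; rewrite mulN1r.
by move=> q; exact: (conv_rapid hphi sf rf q).
Qed.

(** With v = u - f and h = phi^(eps y) - 1, the difference is v (1 + h) + f h. In the first term v
    is negligible and 1 + h grows slowly; in the second f absorbs the growth of h. *)
Lemma net_times_fourier (f : V -> R[i]) (u : R -> V -> R[i]) : schwartz f ->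
  N_S (fun e x => u e x - f x) ->
  N_S (fun e y => u e y * fourier (moll phi e) y - f y).
Proof.
move=> /schwartzP[sf rf] /N_SP[sv rv]; apply/N_SP.
pose v e y := u e y - f y; pose h e y := fourier (moll phi e) y - 1.
have sh e : 0 < e <= 1 -> smooth (h e).
  by move=> e01; exact: (smoothD (fourier_smooth hphi e01) (@smooth_cst R n (-1))).
have E e : (fun y => u e y * fourier (moll phi e) y - f y) =
    fun y => v e y * (1 + h e y) + f y * h e y.
  by apply/funext => y; rewrite /v /h; ring.
have s1h e : 0 < e <= 1 -> smooth (fun y => 1 + h e y).
  by move=> e01; exact: (smoothD (@smooth_cst R n 1) (sh e e01)).
have s1 e : 0 < e <= 1 -> smooth (fun y => v e y * (1 + h e y)).
  by move=> e01; exact: (smoothM (sv e e01) (s1h e e01)).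
have s2 e : 0 < e <= 1 -> smooth (fun y => f y * h e y).
  by move=> e01; exact: (smoothM sf (sh e e01)).
split; first by move=> e e01; rewrite E; exact: (smoothD (s1 e e01) (s2 e e01)).
move=> q.
rewrite (_ : (fun i : unit_itv R => _) =
  fun i y => v (val i) y * (1 + h (val i) y) + f y * h (val i) y); last first.
  by apply/funext => i; exact: E.
apply: rapidD.
- by case=> e; exact: s1.
- by case=> e; exact: s2.
- move=> k L.
  (* The lowest order of [fourier_bound] suffices: growth like [pw y] costs [v] only one power of
     its decay. *)
  have b1 : bdn L (fun (i : unit_itv R) y => 1 + h (val i) y) (fun _ y => pw y).
    apply: bdnD.
    + by move=> i; exact: smooth_cst.
    + by case=> e; exact: sh.
    + apply: (@bdn_cst _ _ _ _ (fun=> 1) _ 1) => // i y; first by rewrite cmod1 mul1r pw_ge1.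
      by rewrite ltW ?pw_gt0.
    + apply: (bdn_weight ler01 _ (fourier_bound hphi 0 L)) => -[e /= /andP[e0 e1]] y.
      by rewrite !expr1 mul1r ler_piMl// ltW ?pw_gt0.
  have := bdnM (fun i => sv _ (valP i)) (fun i => s1h _ (valP i)) (rv q k.+1 L) b1.
  apply: (bdn_weight ler01) => i y; rewrite mul1r -mulrA exprSr invfM.
  by rewrite -mulrA mulVf ?mulr1// gt_eqF ?pw_gt0.
- move=> k L.
  (* The additional [q.+1] powers of decay of [f] cancel the factor [pw y ^+ q.+1] that comes with
     [e ^+ q.+1]. *)
  have := bdnM (fun _ => sf) (fun i => sh _ (valP i))
    (bdn_reindex (fun _ : unit_itv R => tt) (rf (q.+1 + k)%N L)) (fourier_bound hphi q L).
  apply: (bdn_weight ler01) => -[e /= /andP[e0 e1]] y; rewrite !mul1r exprD invfM.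
  have y0 : pw y ^+ q.+1 != 0 by rewrite gt_eqF ?pwX_gt0.
  have -> : (pw y ^- q.+1 * pw y ^- k) * (e ^+ q.+1 * pw y ^+ q.+1) = e ^+ q.+1 * pw y ^- k.
    by field; rewrite y0 gt_eqF ?pwX_gt0.
  by rewrite ler_wpM2r ?pwXV_ge0// exprS ler_piMl// exprn_ge0 ?ltW.
Qed.

(** The estimate with [q = 0], read at one value of eps. *)
Lemma N_S_schwartz (v : R -> V -> R[i]) e : N_S v -> 0 < e <= 1 ->
  smooth (v e) /\ rapid1 (v e).
Proof.
move=> /N_SP[sv rv] e01; split; first exact: sv.
move=> k L; have := bdn_reindex (fun _ : unit => exist _ e e01) (rv 0 k L).
by congr bdn; apply/funext => i; apply/funext => x; rewrite /= expr0.
Qed.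

Lemma classical_op_schwartz (f : V -> R[i]) : schwartz f -> schwartz (classical_op a f).
Proof.
move=> /schwartzP[sf rf]; have [sa [M ba]] := amplitude_bound ha.
rewrite (_ : classical_op a f = fun x => ((2 * pi) ^- n : R)%:C * psop a M f x); last first.
  by apply/funext => x; rewrite /classical_op (oscint_psop sa ba x sphi iphi sf rf).
have [so ro] := psop_rapid sa ba (fun _ : unit => ler01) (fun=> sf) rf.
apply/schwartzP; split; first exact: (smoothZ _ (so tt)).
exact: (rapidZ _ so ro).
Qed.

(** For each eps both sides are values of [psop], at the Schwartz functions u phi^(eps y) and f. By
    additivity their difference is [psop] of a negligible net, which is negligible by
    [psop_rapid]. *)
Lemma net_op_sub (f : V -> R[i]) (u : R -> V -> R[i]) : schwartz f ->
  N_S (fun e x => u e x - f x) ->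
  N_S (fun e x => net_op phi a u e x - classical_op a f x).
Proof.
move=> hf uf; have vf := net_times_fourier hf uf.
have /schwartzP[sf rf] := hf; have [sa [M ba]] := amplitude_bound ha.
set g := fun e y => u e y * fourier (moll phi e) y - f y in vf.
have [sg rg] := (N_SP g).1 vf.
apply: (@N_S_ext _ _ (fun e x => ((2 * pi) ^- n : R)%:C * psop a M (g e) x)).
  move=> e x e01; have [sge rge] := N_S_schwartz vf e01.
  have E : (fun y => f y + g e y) = fun y => u e y * fourier (moll phi e) y.
    by apply/funext => y; rewrite addrCA subrr addr0.
  have sfg : smooth (fun y => f y + g e y) := smoothD sf sge.
  have rfg : rapid1 (fun y => f y + g e y) by exact: (rapidD (fun=> sf) (fun=> sge) rf rge).
  rewrite /net_op /classical_op -mulrBr; congr (_ * _).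
  rewrite (oscint_psop sa ba x sphi iphi sf rf).
  have hD := psopD sa ba x sf rf sge rge.
  rewrite E in sfg rfg hD.
  have h := oscint_psop sa ba x sphi iphi sfg rfg.
  rewrite [X in _ = X - _](_ : _ = psop a M (fun y => u e y * fourier (moll phi e) y) x).
    by rewrite hD addrAC subrr add0r.
  by rewrite -h; congr oscint; apply/funext => y; apply/funext => xi; rewrite mulrA.
apply: N_SZ; apply/N_SP.
have op q : sfam (fun i : unit_itv R => psop a M (g (val i))) /\
    rapid (fun i : unit_itv R => val i ^+ q) (fun i => psop a M (g (val i))).
  apply: (psop_rapid sa ba _ _ (rg q)).
    by case=> e /= /andP[e0 _]; rewrite exprn_ge0 ?ltW.
  by case=> e; exact: sg.
split; last by move=> q; exact: (op q).2.
by move=> e e01; exact: (op 0%N).1 (exist _ e e01).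
Qed.

End extension.

Theorem proposition6p4 (R : realType) (n : nat)
  (phi : 'rV[R]_n -> R[i]) (hphi : mollifier phi)
  (a : 'rV[R]_(n + n + n) -> R[i]) (ha : classical_amplitude a)
  (f : 'rV[R]_n -> R[i]) (hf : schwartz f) :
  G_tau_S (embed phi (distr (classical_op a f))) /\
  G_op phi a (embed phi (distr f)) = embed phi (distr (classical_op a f)).
Proof.
have hA := classical_op_schwartz hphi ha hf.
pose Z : net R n := fun _ => classical_op a f.
have embA : embed phi (distr (classical_op a f)) = cls Z.
  by apply: cls_eq; exact: embed_schwartz.
(* The zero net is negligible, being 0 times a negligible net. *)
have f_f : N_S (fun e x => (fun (_ : R) => f) e x - f x).
  by apply: N_S_ext (N_SZ 0 (embed_schwartz hphi hf)) => e x _; rewrite mul0r subrr.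
have embf : embed phi (distr f) = cls (fun=> f).
  by apply: cls_eq; exact: embed_schwartz.
rewrite embA; split.
  exists Z => //; have /schwartzP[sA rA] := hA; split; first by move=> e _; exact: sA.
  move=> alpha; have [c c0 Hc] := rapid1_bound (mseq id alpha) 0 rA.
  (* A constant net of a Schwartz function is moderate with exponent 0, as its derivatives are
     bounded. *)
  exists 0%N, c => e x _; rewrite expr0 mul1r expr0 invr1 mul1r mderivE.
  by have := Hc x; rewrite expr0 invr1 mulr1.
(* All representatives of the embedding of [f] have images in the same coset, so the union in [G_op]
   collapses. *)
have clsZ u : embed phi (distr f) u -> cls (net_op phi a u) = cls Z.
  by rewrite embf => uf; apply: cls_eq; exact: net_op_sub.
apply/seteqP; split => v.
  by move=> [u /clsZ ->].
(* For this inclusion the union must be nonempty; the constant net [f] is a representative. *)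
by move=> hv; exists (fun=> f); [rewrite embf|rewrite clsZ// embf].
Qed.
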